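(* Assume: (T1) the support $\mathbb{X}$ of $X$ is a compact subset of $\mathbb{R}^d$; (T2) there is $c>0$ such that $|B(x,r)\cap\mathbb{X}|\ge c|B(x,r)|$ for all $x\in\mathbb{X}$ and $0\le r\le\operatorname{diam}(\mathbb{X})$; (T3) $X$ has a density $f$ with respect to Lebesgue measure on $\mathbb{R}^d$ and there are $\underline f,\bar f>0$ with $\underline f\le f(x)\le\bar f$ for almost all $x\in\mathbb{X}$; (T4) for almost all $x\in\mathbb{X}$, $W$ is independent of $(Y(0),Y(1))$ conditionally on $X=x$; (T5) there is $\eta>0$ such that $\eta<\mathbb{P}(W=1\mid X=x)<1-\eta$ for almost all $x\in\mathbb{X}$; (T6) $g_0$ and $g_1$ are restrictions of twice continuously differentiable maps on an open convex neighbourhood of $\mathbb{X}$; (T7) the distributions of $X$ given $W=0$ and of $X$ given $W=1$ have densities $f_0$ and $f_1$ with respect to Lebesgue measure, which are Lipschitz-continuous on $\mathbb{X}$; (T8) $\sup_{L>0,\,w\in\{0,1\}}\left\{L^{1/d}\int_{\mathbb{X}}\exp(-L\,\delta(x,\mathbb{X}^c)^d)f_w(x)\,\mathrm dx\right\}<\infty$. Then the conditional bias $B$ satisfies $$\mathbb{E}[B^2]\le C\left(\frac kN\right)^{\min\{3,\,4/d\}},$$ where $C>0$ depends only on $d,\mathbb{X},\eta,g_0,g_1,f_0,f_1$ (in particular not on $N$ and $k$).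
   Context: $\|\cdot\|$ is the Euclidean norm on $\mathbb{R}^d$, $|B(x,r)|$ denotes Lebesgue measure of the closed ball $B(x,r)$, and $\delta(x,\mathbb{X}^c)$ is the distance from $x$ to $\mathbb{X}^c=\mathbb{R}^d\setminus\mathbb{X}$. The vectors $(W_i,X_i,Y_i(0),Y_i(1))$, $1\le i\le N$, are i.i.d. copies of $(W,X,Y(0),Y(1))$ with values in $\{0,1\}\times\mathbb{R}^d\times\mathbb{R}\times\mathbb{R}$; one observes $W_i,X_i$ and $Y_i=Y_i(W_i)$. Put $g_w(x)=\mathbb{E}[Y(w)\mid X=x]$ for $w\in\{0,1\}$. For $k\ge1$, $w\in\{0,1\}$ and $1\le\ell\le k$, $\hat i_{\ell,w}(x)$ is the index of the $\ell$th nearest neighbour of $x$ among the $X_i$ with $W_i=w$. The conditional bias of the $k$-nearest-neighbour matching estimator of the average treatment effect is $$B=\frac1N\sum_{i=1}^N(2W_i-1)\left(g_{1-W_i}(X_i)-\frac1k\sum_{\ell=1}^kg_{1-W_i}\left(X_{\hat i_{\ell,1-W_i}(X_i)}\right)\right).$$ With $N_w=\#\{i:W_i=w\}$, $B$ is defined when $N_0,N_1\ge k$; by convention $B=0$ on the event $\min(N_0,N_1)<k$. *)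

(* Defs.v *)
From HB Require Import structures.
From mathcomp Require Import all_boot all_order all_algebra.
From mathcomp Require Import all_classical all_reals all_analysis.

Set Implicit Arguments.
Unset Strict Implicit.
Unset Printing Implicit Defensive.
Import Order.TTheory GRing.Theory Num.Theory.
Import numFieldNormedType.Exports.
Local Open Scope classical_set_scope.
Local Open Scope ring_scope.

(* R^d is 'rV[R]_d, so as to have the topology and the differential calculus of
   the library.  Its sigma-algebra is generated by the d coordinate functions
   (the Borel sigma-algebra), as the library does for d.-tuple R. *)
Definition measure_rV_display : measure_display.
Proof. exact: default_measure_display. Qed.

Section measurable_rV.
Context (R : realType) (d : nat).

Definition coord_rV (i : 'I_d) (x : 'rV[R]_d) : R := x ord0 i.

Let rV_set0 : g_sigma_preimage coord_rV set0.
Proof. exact: sigma_algebra0. Qed.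

Let rV_setC A : g_sigma_preimage coord_rV A -> g_sigma_preimage coord_rV (~` A).
Proof. exact: sigma_algebraC. Qed.

Let rV_bigcup (F : (set 'rV[R]_d)^nat) :
  (forall i, g_sigma_preimage coord_rV (F i)) ->
  g_sigma_preimage coord_rV (\bigcup_i (F i)).
Proof. exact: sigma_algebra_bigcup. Qed.

HB.instance Definition _ := @isMeasurable.Build measure_rV_display
  'rV[R]_d (g_sigma_preimage coord_rV) rV_set0 rV_setC rV_bigcup.

Lemma measurable_coord_rV (i : 'I_d) : measurable_fun [set: 'rV[R]_d] (coord_rV i).
Proof.
move=> _ Y mY; rewrite setTI; apply: sub_sigma_algebra => /=.
rewrite -bigcup_seq/=; exists i => /=; first by rewrite mem_index_enum.
by exists Y => //; rewrite setTI.
Qed.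

Lemma measurable_fun_rVP d1 (T : measurableType d1) (f : T -> 'rV[R]_d) :
  (forall i, measurable_fun [set: T] (coord_rV i \o f)) ->
  measurable_fun [set: T] f.
Proof.
move=> mf.
have sub : preimage_set_system [set: T] f (g_sigma_preimage coord_rV) `<=`
    measurable.
  rewrite -g_sigma_preimage_comp.
  apply: smallest_sub; first exact: sigma_algebra_measurable.
  rewrite -bigcup_seq/=; apply: bigcup_sub => i _ A [B mB <-].
  exact: (mf i).
by move=> _ A mA; apply: sub; exists A.
Qed.

End measurable_rV.

Section sigma_finite_measureP.
Context disp (T : measurableType disp) (R : realType).
Variables (nu : {measure set T -> \bar R}) (sf : sigma_finite setT nu).

Let nu' : set T -> \bar R := nu.
HB.instance Definition _ := isMeasure.Build _ _ _ nu'
  (measure0 nu) (@measure_ge0 _ _ _ nu) (@measure_semi_sigma_additive _ _ _ nu).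
HB.instance Definition _ := Measure_isSigmaFinite.Build _ _ _ nu' sf.

Lemma sigma_finite_measureP : {m : {sigma_finite_measure set T -> \bar R} |
  (nu : set T -> \bar R) = m :> (set T -> \bar R)}.
Proof. by exists nu'. Qed.

End sigma_finite_measureP.

Section lebesgue_rV.
Context (R : realType).

Definition cons_rV d (p : measurableTypeR R * 'rV[R]_d) : 'rV[R]_d.+1 :=
  \row_(i < d.+1) if unlift ord0 i is Some j then p.2 ord0 j else p.1.

(* Lebesgue measure on R^d, as an iterated product of the Lebesgue measure on R. *)
Fixpoint lebesgue_rV d : set 'rV[R]_d -> \bar R :=
  match d return set 'rV[R]_d -> \bar R with
  | 0 => \d_(0 : 'rV[R]_0)
  | d'.+1 => pushforward (@lebesgue_measure R \x @lebesgue_rV d')%E (@cons_rV d')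
  end.

Lemma measurable_cons_rV d : measurable_fun setT (@cons_rV d).
Proof.
apply: measurable_fun_rVP => i.
case: (unliftP ord0 i) => [j ->|->].
  have -> : coord_rV (lift ord0 j) \o @cons_rV d = @coord_rV R d j \o snd.
    by apply/funext => p /=; rewrite /coord_rV mxE liftK.
  apply: measurableT_comp => //.
  exact: measurable_coord_rV.
have -> : coord_rV ord0 \o @cons_rV d = fst.
  by apply/funext => p /=; rewrite /coord_rV mxE unlift_none.
exact: measurable_fst.
Qed.


Lemma measurable_cons_rV_image d (A : set (measurableTypeR R * 'rV[R]_d)%type) :
  measurable A -> measurable (@cons_rV d @` A).
Proof.
move=> mA.
pose g (v : 'rV[R]_d.+1) : measurableTypeR R * 'rV[R]_d :=
  (v ord0 ord0, \row_i v ord0 (lift ord0 i)).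
have mg : measurable_fun setT g.
  apply/measurable_fun_pairP; split; first exact: (measurable_coord_rV ord0).
  apply: measurable_fun_rVP => i.
  rewrite (_ : _ \o _ = @coord_rV R d.+1 (lift ord0 i)).
    exact: measurable_coord_rV.
  by apply/funext => v; rewrite /coord_rV /= mxE.
suff -> : @cons_rV d @` A = setT `&` g @^-1` A by exact: mg.
have gK : cancel (@cons_rV d) g.
  move=> [a v]; congr pair; first by rewrite mxE unlift_none.
  by apply/rowP => i; rewrite !mxE liftK.
have Kg : cancel g (@cons_rV d).
  move=> v; apply/rowP => i; rewrite mxE.
  by case: (unliftP ord0 i) => [j ->|->] //; rewrite mxE.
rewrite setTI; apply/seteqP; split => [_ [p Ap <-]|v Av]; first by rewrite /= gK.
by exists (g v) => //; exact: Kg.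
Qed.

Lemma lebesgue_rV_sigma_finite_measure d :
  {m : {sigma_finite_measure set 'rV[R]_d -> \bar R} |
    @lebesgue_rV d = m :> (set 'rV[R]_d -> \bar R)}.
Proof.
elim: d => [|d [m mE]]; first by exists \d_(0 : 'rV[R]_0).

have sf : sigma_finite setT (pushforward (@lebesgue_measure R \x m)%E (@cons_rV d)).
  have /sigma_finiteP[F [FT Fnd Ffin]] := sigma_finiteT (@lebesgue_measure R).
  have /sigma_finiteP[G [GT Gnd Gfin]] := sigma_finiteT m.
  exists (fun i => @cons_rV d @` (F i `*` G i)).
    apply/esym/seteqP; split => // v _.
    have : (\bigcup_i (F i `*` G i)) (v ord0 ord0, \row_i v ord0 (lift ord0 i)).
      have : (\bigcup_i F i) (v ord0 ord0) by rewrite -FT.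
      have : (\bigcup_i G i) (\row_i v ord0 (lift ord0 i)) by rewrite -GT.
      move=> [j _ Gj] [i _ Fi]; exists (maxn i j) => //; split => /=.
        by move: Fi; apply/subsetPset/Fnd; rewrite leq_maxl.
      by move: Gj; apply/subsetPset/Gnd; rewrite leq_maxr.
    move=> [i _ FGi]; exists i => //.
    exists (v ord0 ord0, \row_i v ord0 (lift ord0 i)) => //.
    apply/rowP => j; rewrite mxE.
    by case: (unliftP ord0 j) => [k ->|->] //; rewrite mxE.
  move=> i; have [mF Flty] := Ffin i; have [mG Glty] := Gfin i.
  split; first exact: measurable_cons_rV_image (measurableX mF mG).
  rewrite /pushforward (_ : _ @^-1` _ = F i `*` G i); last first.
    apply/seteqP; split => [p [q Fq qp]|p Fp]; last by exists p.
    suff -> : p = q by [].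
    move: qp => /rowP; case: p q Fq => [a v] [b w] _ qp.
    congr pair; first by have := qp ord0; rewrite !mxE unlift_none.
    by apply/rowP => k; have := qp (lift ord0 k); rewrite !mxE liftK.
  by rewrite product_measure1E// lte_mul_pinfty// ge0_fin_numE.
rewrite /= mE.
pose mu : {measure set _ -> \bar R} := (@lebesgue_measure R \x m)%E.
pose nu : {measure set _ -> \bar R} :=
  measure_function_pushforward__canonical__measure_function_Measure mu
    (@measurable_cons_rV d).
exact (@sigma_finite_measureP _ _ _ nu sf).
Qed.

Lemma lebesgue_rV0 d : @lebesgue_rV d set0 = 0%E.
Proof. by have [m ->] := lebesgue_rV_sigma_finite_measure d; exact: measure0. Qed.

Lemma lebesgue_rV_ge0 d A : (0 <= @lebesgue_rV d A)%E.
Proof. by have [m ->] := lebesgue_rV_sigma_finite_measure d; exact: measure_ge0. Qed.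

Lemma lebesgue_rV_semi_sigma_additive d : semi_sigma_additive (@lebesgue_rV d).
Proof.
have [m ->] := lebesgue_rV_sigma_finite_measure d.
exact: measure_semi_sigma_additive.
Qed.

HB.instance Definition _ d := isMeasure.Build _ _ _ (@lebesgue_rV d)
  (@lebesgue_rV0 d) (@lebesgue_rV_ge0 d) (@lebesgue_rV_semi_sigma_additive d).

Lemma lebesgue_rV_sigma_finite d : sigma_finite setT (@lebesgue_rV d).
Proof.
by have [m ->] := lebesgue_rV_sigma_finite_measure d; exact: sigma_finiteT.
Qed.

HB.instance Definition _ d := Measure_isSigmaFinite.Build _ _ _ (@lebesgue_rV d)
  (@lebesgue_rV_sigma_finite d).

Lemma lebesgue_rV_box d (A : 'I_d -> set (measurableTypeR R)) :
  (forall i, measurable (A i)) ->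
  @lebesgue_rV d [set x | forall i, A i (x ord0 i)] =
  (\prod_(i < d) @lebesgue_measure R (A i))%E.
Proof.
elim: d A => [|d ih] A mA.
  rewrite big_ord0 /= diracE mem_set// => -[]//.
rewrite big_ord_recl -(ih (fun i => A (lift ord0 i)))//=.
have mB : measurable [set x : 'rV[R]_d | forall i, A (lift ord0 i) (x ord0 i)].
  rewrite (_ : [set _ | _] =
    \bigcap_(i in [set: 'I_d]) (coord_rV i @^-1` A (lift ord0 i))).
    apply: fin_bigcap_measurable => [|i _]; first exact: finite_finset.
    rewrite -[X in measurable X]setTI.
    exact (@measurable_coord_rV R d i measurableT _ (mA (lift ord0 i))).
  by apply/seteqP; split => [x Ax i _|x Ax i]; exact: Ax.
rewrite /pushforward (_ : _ @^-1` _ =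
  A ord0 `*` [set x : 'rV[R]_d | forall i, A (lift ord0 i) (x ord0 i)]).
  by rewrite product_measure1E.
apply/seteqP; split => [[a v] /= Av|[a v] /= [Aa Av] i].
  split=> [|i] /=.
    by have := Av ord0; rewrite mxE unlift_none.
  by have := Av (lift ord0 i); rewrite mxE liftK.
by rewrite mxE; case: (unliftP ord0 i) => [j ->|->].
Qed.

End lebesgue_rV.

Section euclidean.
Context (R : realType) (d : nat).
Implicit Types (x y : 'rV[R]_d) (A : set 'rV[R]_d).

(* The norm of the library on 'rV[R]_d is the sup norm. *)
Definition enorm x : R := Num.sqrt (\sum_(i < d) x ord0 i ^+ 2).

Definition eball x (r : R) : set 'rV[R]_d := [set y | enorm (y - x) <= r].

Definition ediam A : R := sup [set enorm (x - y) | x in A & y in A].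

Definition dist_to x A : R := inf [set enorm (x - y) | y in A].

Definition lipschitz_on_set A (h : 'rV[R]_d -> R) :=
  exists K : R, forall x y, A x -> A y -> `|h x - h y| <= K * enorm (x - y).

(* 'D_u ('D_v h) x is the second differential of h at x applied to (u, v); h is
   twice differentiable iff h and all its directional derivatives are
   differentiable. *)
Definition C2_on A (h : 'rV[R]_d -> R) := forall x, A x ->
  [/\ differentiable h x,
      forall v, differentiable ('D_v h) x &
      forall u v, {for x, continuous ('D_u ('D_v h))}].

Definition ball_volume_regular A := exists2 c : R, 0 < c &
  forall x r, A x -> 0 <= r <= ediam A ->
    (c%:E * lebesgue_rV (eball x r) <= lebesgue_rV (eball x r `&` A))%E.

Definition is_density (mu : set 'rV[R]_d -> \bar R) (f : 'rV[R]_d -> R) :=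
  [/\ measurable_fun [set: 'rV[R]_d] f,
      forall x, 0 <= f x &
      forall A, measurable A ->
        mu A = (\int[@lebesgue_rV R d]_(x in A) (f x)%:E)%E].

Definition boundary_sup A (f : bool -> 'rV[R]_d -> R) : \bar R :=
  ereal_sup [set ((p.1 `^ d%:R^-1)%:E *
     \int[@lebesgue_rV R d]_(x in A)
       (expR (- p.1 * dist_to x (~` A) ^+ d) * f p.2 x)%:E)%E
   | p in [set p : R * bool | 0 < p.1]].

End euclidean.

Section conditioning.
Context (R : realType) (disp disp1 disp2 : measure_display)
  (Omega : measurableType disp) (T1 : measurableType disp1)
  (T2 : measurableType disp2) (P : probability Omega R).

(* g is a version of x |-> E[Y | X = x]. *)
Definition is_cond_expectation (X : Omega -> T1) (Y : Omega -> R) (g : T1 -> R) :=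
  [/\ P.-integrable [set: Omega] (EFin \o Y),
      measurable_fun [set: T1] g &
      forall A, measurable A ->
        (\int[P]_(w in X @^-1` A) (Y w)%:E =
         \int[P]_(w in X @^-1` A) (g (X w))%:E)%E].

(* kappa is a regular conditional distribution of Z given X, that is, kappa x is
   a version of the law of Z conditionally on X = x. *)
Definition is_cond_law (X : Omega -> T1) (Z : Omega -> T2)
    (kappa : R.-pker T1 ~> T2) :=
  forall A B, measurable A -> measurable B ->
    (P (X @^-1` A `&` Z @^-1` B) = \int[P]_(w in X @^-1` A) kappa (X w) B)%E.

Definition identically_distributed (Z Z' : {RV P >-> T1}) :=
  forall A, measurable A -> distribution P Z A = distribution P Z' A.

Definition mutually_independent N (Z : 'I_N -> {RV P >-> T1}) :=
  forall A : 'I_N -> set T1, (forall i, measurable (A i)) ->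
    (P (\bigcap_(i in [set: 'I_N]) (Z i @^-1` A i)) =
     \prod_(i < N) P (Z i @^-1` A i))%E.

End conditioning.

Section matching.
Context (R : realType) (d : nat).

(* (W, X, (Y(0), Y(1))), the arm w = 0, 1 being encoded as w = false, true. *)
Definition unit_data := (bool * 'rV[R]_d * (R * R))%type.

Definition treatment (z : unit_data) : bool := z.1.1.
Definition covariate (z : unit_data) : 'rV[R]_d := z.1.2.
Definition outcomes (z : unit_data) : R * R := z.2.
Definition outcome (w : bool) (z : unit_data) : R := if w then z.2.2 else z.2.1.

Section population.
Context (disp : measure_display) (Omega : measurableType disp)
  (P : probability Omega R) (Z : {RV P >-> unit_data}).

Definition law_covariate (A : set 'rV[R]_d) : \bar R :=
  P ((covariate \o Z) @^-1` A).

Definition law_covariate_given (w : bool) (A : set 'rV[R]_d) : \bar R :=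
  (P ((treatment \o Z) @^-1` [set w] `&` (covariate \o Z) @^-1` A) /
   P ((treatment \o Z) @^-1` [set w]))%E.

Definition support_covariate : set 'rV[R]_d :=
  [set x | forall U, open U -> U x -> (0 < law_covariate U)%E].

Definition bounded_density (XX : set 'rV[R]_d) := exists f : 'rV[R]_d -> R,
  is_density law_covariate f /\
  exists lo hi : R, [/\ 0 < lo, 0 < hi &
    {ae @lebesgue_rV R d, forall x, XX x -> lo <= f x <= hi}].

Definition unconfounded (XX : set 'rV[R]_d) :=
  exists kappa : R.-pker 'rV[R]_d ~> (bool * (R * R))%type,
    is_cond_law P (covariate \o Z) (fun s => (treatment (Z s), outcomes (Z s)))
      kappa /\
    {ae @lebesgue_rV R d, forall x, XX x ->
      forall (A : set bool) (B : set (R * R)), measurable B ->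
        kappa x (A `*` B) = (kappa x (A `*` setT) * kappa x (setT `*` B))%E}.

Definition overlap (XX : set 'rV[R]_d) (eta : R) :=
  exists e : 'rV[R]_d -> R,
    is_cond_expectation P (covariate \o Z) (fun s => (treatment (Z s))%:R) e /\
    {ae @lebesgue_rV R d, forall x, XX x -> eta < e x < 1 - eta}.

End population.

Definition smooth_regression (XX : set 'rV[R]_d) (g : bool -> 'rV[R]_d -> R) :=
  exists U : set 'rV[R]_d,
    [/\ open U, convex_set (U : set (convex_lmodType 'rV[R]_d)), XX `<=` U &
     forall w, exists2 h, C2_on U h & forall x, XX x -> g w x = h x].

Section sample.
Context (N : nat) (W : 'I_N -> bool) (X : 'I_N -> 'rV[R]_d).

Definition arm_size (w : bool) : nat := #|[pred i | W i == w]|.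

(* Units of arm w by increasing distance to x, ties going to the smaller index
   (the sort of the library is stable). *)
Definition ranked_arm (w : bool) (x : 'rV[R]_d) : seq 'I_N :=
  sort (fun i j => enorm (X i - x) <= enorm (X j - x))
    [seq i <- enum 'I_N | W i == w].

(* i0 is a dummy value, returned when l > arm_size w. *)
Definition nearest_index (i0 : 'I_N) (w : bool) (x : 'rV[R]_d) (l : nat) : 'I_N :=
  nth i0 (ranked_arm w x) l.-1.

Definition matching_bias (g : bool -> 'rV[R]_d -> R) (k : nat) : R :=
  if (k <= minn (arm_size false) (arm_size true))%N then
    N%:R^-1 * \sum_(i < N) (2 * (W i)%:R - 1) *
      (g (~~ W i) (X i)
       - k%:R^-1 * \sum_(1 <= l < k.+1)
                     g (~~ W i) (X (nearest_index i (~~ W i) (X i) l)))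
  else 0.

End sample.
End matching.

Arguments treatment {R d} z.
Arguments covariate {R d} z.
Arguments outcomes {R d} z.
Arguments outcome {R d} w z.

(* Main.v *)
Require Import Defs.
From HB Require Import structures.
From mathcomp Require Import all_boot all_order all_algebra.
From mathcomp Require Import all_classical all_reals all_analysis.
From mathcomp Require Import measurable_realfun ring lra.

Set Implicit Arguments.
Unset Strict Implicit.
Unset Printing Implicit Defensive.
Import Order.TTheory GRing.Theory Num.Theory.
Import numFieldNormedType.Exports.
Local Open Scope classical_set_scope.
Local Open Scope ring_scope.

(** The matching discrepancy of unit [i] with its neighbour [j] in the other arm is
    [g w (X i) - g w (X j)], and [B] is an average of [N * k] signed discrepancies.  Put
    [rho = (k / N) ^ (1 / d)], the typical distance from a unit to its [k] nearest
    neighbours.  As [g] is Lipschitz, each discrepancy is of order [rho], which alone gives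
    only [rho ^ 2] for the second moment.  The gain comes from expanding [B ^ 2] into a sum
    over pairs of matches [(i, j)] and [(i', j')], split according to whether the two
    matches overlap, that is, whether [|X i - X i'| <= |X j - X i| + |X j' - X i'|].

    Overlapping matches: the product is of order [rho ^ 2], and for [i != i'] an overlap
    puts [X i'] within a distance of order [rho] of [X i], which has probability of order
    [rho ^ d].  Together with the [N] diagonal terms, of weight [1 / N <= rho ^ d], they
    contribute [rho ^ (2 + d)].

    Disjoint matches: the four units are distinct, and the event that [j] is matched to
    [i] and [j'] to [i'] with disjoint matches is unchanged when [X j] is replaced by its
    mirror image [2 * X i - X j].  Indeed the distance from [X i] is preserved, and both
    [X j] and its image are farther from [X i'] than [X j'] is.  So in expectation the
    discrepancy can be replaced by its average over the two mirror positions, weighted by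
    the density of [X j] ([expectation_symg], used for each of the two matches in
    [expectation_coupled]).  If the match is shorter than the distance from [X i] to the
    complement of the support, the image stays in the support, and that average is of
    order [|X j - X i| ^ 2] because [g] is twice differentiable and the density is
    Lipschitz and bounded below ([symg_le]).  Otherwise it is only of order
    [|X j - X i|], but then [X i] lies within the matching distance of the boundary, and
    the integral condition on the distance to the complement says that this costs another
    factor [rho] ([edge_weight_mean]).  Each of the two factors is thus of order [rho ^ 2]
    in mean, and these terms contribute [rho ^ 4].

    The sum [rho ^ (2 + d) + rho ^ 4] is at most twice [(k / N) ^ min (3, 4 / d)]: for
    [d = 1] the first term is the cube of [k / N], and for [d >= 2] the exponent [4 / d]
    of the second one is the smaller.

    The matching distances are random and correlated with everything else.  They are
    controlled by the weights [spread_weight], which dominate an exponential of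
    [(distance / rho) ^ d] over all neighbours of [i] at once.  A weight is a sum, over
    growing radii, of indicators that fewer than [k] units of the other arm lie within
    that radius, the unit [i'] being left out of the count.  By Chernoff's bound its
    conditional mean given units [i] and [i'] is bounded ([spread_weight_mean]).  Hence
    distances can be replaced by multiples of [rho] in the mean of any nonnegative function
    of two units.

    Independence is only ever used in the form of [resample]: integrating a function of
    the sample is the same as first redrawing one of the units.

    The constant depends on the population only through [XX], [f], [g] and [eta]: the
    numbers of [design_constants] bound quantities defined from those data, and any
    population that satisfies the hypotheses yields such numbers. *)

(** * Redrawing one unit of an independent sample *)

Section boxes.
Context d1 d2 (T : measurableType d1) (E : measurableType d2) (n : nat).
Variable coor : 'I_n -> T -> E.
Hypothesis measurableT_E : @measurable d1 T = g_sigma_preimage coor.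

Definition box (A : 'I_n -> set E) : set T := [set x | forall i, A i (coor i x)].

Definition boxes : set (set T) :=
  [set X | exists2 A, (forall i, measurable (A i)) & X = box A].

Lemma measurable_coor (i : 'I_n) : measurable_fun [set: T] (coor i).
Proof.
move=> _ Y mY; rewrite setTI measurableT_E; apply: sub_sigma_algebra => /=.
rewrite -bigcup_seq/=; exists i => /=; first by rewrite mem_index_enum.
by exists Y => //; rewrite setTI.
Qed.

Lemma boxE (A : 'I_n -> set E) :
  box A = \bigcap_(i in [set: 'I_n]) (coor i @^-1` A i).
Proof. by apply/seteqP; split => [x Ax i _|x Ax i]; exact: Ax. Qed.

Lemma measurable_box (A : 'I_n -> set E) :
  (forall i, measurable (A i)) -> measurable (box A).
Proof.
move=> mA; rewrite boxE; apply: fin_bigcap_measurable => [|i _].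
  exact: finite_finset.
by rewrite -[X in measurable X]setTI; apply: measurable_coor.
Qed.

Lemma measurable_boxesE : @measurable d1 T = <<s boxes >>.
Proof.
apply/seteqP; split.
  rewrite measurableT_E; apply: smallest_sub; first exact: smallest_sigma_algebra.
  rewrite -bigcup_seq/=; apply: bigcup_sub => i _ A [B mB <-].
  apply: sub_sigma_algebra; exists (fun j => if j == i then B else setT).
    by move=> j; case: ifP.
  apply/seteqP; split => [x [_ Bx] j|x Bx]; first by case: eqP => [->|].
  by split=> //; have := Bx i; rewrite eqxx.
apply: smallest_sub; first exact: sigma_algebra_measurable.
by move=> _ [A mA ->]; exact: measurable_box.
Qed.

Lemma boxes_setI_closed : setI_closed boxes.
Proof.
move=> _ _ [A mA ->] [B mB ->]; exists (fun i => A i `&` B i).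
  by move=> i; exact: measurableI.
apply/seteqP; split => [x [Ax Bx] i|x ABx]; first by split; [exact: Ax|exact: Bx].
by split=> i; have [] := ABx i.
Qed.

(** The boxes are closed under intersection and generate the sigma-algebra, both for
    tuples and for vectors. *)
Lemma box_measure_unique (R : realType) (g : nat -> 'I_n -> set E)
    (m1 m2 : {measure set T -> \bar R}) :
  (forall k i, measurable (g k i)) -> \bigcup_k box (g k) = setT ->
  (forall k, (m1 (box (g k)) < +oo)%E) ->
  (forall A, (forall i, measurable (A i)) -> m1 (box A) = m2 (box A)) ->
  forall X, measurable X -> m1 X = m2 X.
Proof.
move=> mg gT goo m12; apply: (measure_unique boxes (fun k => box (g k))) => //.
- exact: measurable_boxesE.
- exact: boxes_setI_closed.
- by move=> k; exists (g k).
- by move=> _ [A mA ->]; exact: m12.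
Qed.

End boxes.

Section resampling.
Context d0 d1 (Om : measurableType d0) (E : measurableType d1) (R : realType).
Variables (P : probability Om R) (Q : probability E R) (N : nat).
Variable V : 'I_N -> Om -> E.

Definition iid_sample :=
  [/\ forall i, measurable_fun setT (V i),
      forall i A, measurable A -> P (V i @^-1` A) = Q A &
      forall A : 'I_N -> set E, (forall i, measurable (A i)) ->
        P (\bigcap_(i in [set: 'I_N]) (V i @^-1` A i)) = (\prod_i Q (A i))%E].

Definition upd (j : 'I_N) (z : E) (t : N.-tuple E) : N.-tuple E :=
  [tuple if l == j then z else tnth t l | l < N].

Definition sample (s : Om) : N.-tuple E := [tuple V i s | i < N].

Hypothesis V_iid : iid_sample.

Lemma measurable_sample : measurable_fun setT sample.
Proof.
apply/measurable_fun_tnthP => i; case: V_iid => mV _ _.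
rewrite (_ : _ \o _ = V i)//; apply/funext => s /=.
by rewrite /sample tnth_mktuple.
Qed.

Lemma measurable_upd (j : 'I_N) :
  measurable_fun setT (fun p : E * N.-tuple E => upd j p.1 p.2).
Proof.
apply/measurable_fun_tnthP => i.
rewrite (_ : _ \o _ = if i == j then fst else (fun t => tnth t i) \o snd).
  case: ifP => _ //; apply: measurableT_comp => //; exact: measurable_tnth.
by apply/funext => p /=; rewrite /upd tnth_mktuple; case: ifP.
Qed.

Let sample_mfun : {mfun Om >-> N.-tuple E} :=
  HB.pack sample (isMeasurableFun.Build _ _ _ _ sample measurable_sample).
Let law : probability (N.-tuple E) R := distribution P sample_mfun.
Let mtuple : @measurable _ (N.-tuple E) =
  g_sigma_preimage (fun (i : 'I_N) (t : N.-tuple E) => tnth t i) := erefl.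

Lemma sample_box (A : 'I_N -> set E) : (forall i, measurable (A i)) ->
  P (sample @^-1` box (fun (i : 'I_N) (t : N.-tuple E) => tnth t i) A) =
  (\prod_i Q (A i))%E.
Proof.
move=> mA; case: V_iid => _ _ <- //; congr (P _).
apply/seteqP; split => [s As i _|s As i].
  by have := As i; rewrite /sample tnth_mktuple.
by rewrite /sample tnth_mktuple; exact: As.
Qed.

Let updM (j : 'I_N) (p : N.-tuple E * E) := upd j p.2 p.1.

Let measurable_updM j : measurable_fun setT (updM j).
Proof.
rewrite (_ : updM j = (fun p => upd j p.1 p.2) \o (fun p => (p.2, p.1)))//.
apply: measurableT_comp; first exact: measurable_upd.
exact: measurable_fun_pair.
Qed.

(** On a box, redrawing coordinate [j] replaces the factor of index [j] of a product by
    the same number. *)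
Lemma law_updE j X : measurable X ->
  law X = pushforward (law \x Q)%E (updM j) X.
Proof.
move=> mX.
pose m2 : {measure set (N.-tuple E) -> \bar R} :=
  measure_function_pushforward__canonical__measure_function_Measure
    (law \x Q)%E (measurable_updM j).
rewrite -[RHS]/(m2 X).
apply: (box_measure_unique mtuple (g := fun _ _ => setT)) => //.
- by apply/seteqP; split=> // t _; exists 0%N.
- by move=> k; rewrite (le_lt_trans (probability_le1 _ _)) ?ltry//;
    exact: measurable_box.
move=> A mA; rewrite /m2/= /pushforward.
have -> : updM j @^-1` box (fun (i : 'I_N) (t : N.-tuple E) => tnth t i) A =
    box (fun (i : 'I_N) (t : N.-tuple E) => tnth t i)
        (fun i => if i == j then setT else A i) `*` A j.
  apply/seteqP; split => [[t z] /= Az|[t z] /= [At Az] i].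
    split=> /= [i|]; last by have := Az j; rewrite /updM /upd tnth_mktuple eqxx.
    by have := Az i; rewrite /updM /upd tnth_mktuple; case: ifP.
  rewrite /updM /upd tnth_mktuple; have := At i.
  by case: eqP => [->|].
have mA' i : measurable (if i == j then setT else A i) by case: ifP.
rewrite product_measure1E//; last exact: measurable_box.
have lawE B : (forall i, measurable (B i)) -> law (box
    (fun (i : 'I_N) (t : N.-tuple E) => tnth t i) B) = (\prod_i Q (B i))%E.
  exact: sample_box.
transitivity ((\prod_i Q (A i)) : \bar R)%E; first exact: lawE.
rewrite [X in (X * _)%E]lawE// (bigD1 j)//= [in RHS](bigD1 j)//= eqxx.
rewrite probability_setT mul1e muleC; congr (_ * _)%E.
by apply: eq_bigr => i /negbTE ->.
Qed.

(** The law of an independent sample does not change when one coordinate is redrawn, so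
    Tonelli's theorem integrates out that coordinate alone. *)
Lemma resample (j : 'I_N) (F : N.-tuple E -> \bar R) :
  measurable_fun [set: N.-tuple E] F -> (forall t, 0 <= F t)%E ->
  (\int[P]_s F (sample s) = \int[P]_s \int[Q]_z F (upd j z (sample s)))%E.
Proof.
move=> mF F0.
have lawE G : measurable_fun [set: N.-tuple E] G -> (forall t, 0 <= G t)%E ->
    (\int[P]_s G (sample s) = \int[law]_t G t)%E.
  move=> mG G0; rewrite ge0_integral_pushforward//.
have mFu : measurable_fun setT (F \o updM j).
  by apply: measurableT_comp => //; exact: measurable_updM.
rewrite (lawE F)//.
transitivity (\int[pushforward (law \x Q)%E (updM j)]_t F t)%E.
  by apply: eq_measure_integral => X mX _; exact: law_updE.
rewrite ge0_integral_pushforward//= preimage_setT.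
rewrite (fubini_tonelli1 (F \o updM j))//.
rewrite -(lawE (fubini_F Q (F \o updM j))) => //.
  by apply: measurable_fun_fubini_tonelli_F => // -[t z]; exact: F0.
by move=> t; apply: integral_ge0 => z _; exact: F0.
all: try by move=> p; exact: F0.
all: try by move=> p _; exact: F0.
Qed.

End resampling.

(** * Integration against a density *)
Section density.
Local Open Scope ereal_scope.
Context d (T : measurableType d) (R : realType).
Variables (mu la : {measure set T -> \bar R}) (f : T -> R).
Hypotheses (mf : measurable_fun setT f) (f0 : forall x, (0 <= f x)%R).
Hypothesis muE : forall A, measurable A -> mu A = \int[la]_(x in A) (f x)%:E.
Import HBNNSimple.

(** True by assumption for indicators, hence for simple functions, hence in the limit of
    the monotone approximation of [psi]. *)
Lemma ge0_integral_density (psi : T -> \bar R) :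
  measurable_fun setT psi -> (forall x, 0 <= psi x) ->
  \int[mu]_x psi x = \int[la]_x (psi x * (f x)%:E).
Proof.
move=> mpsi psi0.
have mfE : measurable_fun setT (fun x => (f x)%:E) by exact/measurable_EFinP.
pose h := nnsfun_approx measurableT mpsi.
have indicE A : measurable A ->
    \int[mu]_x (\1_A x)%:E = \int[la]_x ((\1_A x)%:E * (f x)%:E).
  move=> mA; rewrite integral_indic// setIT muE//.
  rewrite integral_mkcond epatch_indic.
  by apply: eq_integral => x _; rewrite muleC.
have hE n : \int[mu]_x (h n x)%:E = \int[la]_x ((h n x)%:E * (f x)%:E).
  have mI (r : R) : measurable (h n @^-1` [set r]) by exact: measurable_sfunP.
  under eq_integral do rewrite fimfunE -fsumEFin//.
  rewrite ge0_integral_fsum//; last 2 first.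
    by move=> r; exact/measurable_EFinP/measurableT_comp.
    by move=> r x _; rewrite EFinM nnfun_muleindic_ge0.
  under [RHS]eq_integral => x _.
    rewrite fimfunE -fsumEFin// ge0_mule_fsuml; last first.
      by move=> r; rewrite EFinM nnfun_muleindic_ge0.
    over.
  rewrite ge0_integral_fsum//; last 2 first.
    move=> r; apply: emeasurable_funM => //.
    by apply/measurable_EFinP/measurableT_comp.
    by move=> r x _; rewrite mule_ge0// ?lee_fin// -lee_fin EFinM nnfun_muleindic_ge0.
  apply: eq_fsbigr => r _.
  have [r0|r0] := leP 0%R r.
    under eq_integral do rewrite EFinM.
    rewrite ge0_integralZl//; last exact/measurable_EFinP/measurable_indic.
    rewrite indicE//.
    under [RHS]eq_integral do rewrite EFinM -muleA.
    rewrite ge0_integralZl//.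
      by apply: emeasurable_funM => //; exact/measurable_EFinP/measurable_indic.
    by move=> x _; rewrite mule_ge0// lee_fin.
  have -> : h n @^-1` [set r] = set0.
    by rewrite preimage_nnfun0.
  rewrite !integral0_eq// => x _; first by rewrite indic0 mulr0 mul0e.
  by rewrite indic0 mulr0.
transitivity (limn (fun n => \int[mu]_x (h n x)%:E)).
  rewrite -monotone_convergence//.
  - by apply: eq_integral => x _; apply/esym/cvg_lim => //; exact: cvg_nnsfun_approx.
  - by move=> n; exact/measurable_EFinP.
  - by move=> n x _; rewrite lee_fin.
  - by move=> x _ a b ab; rewrite lee_fin; exact/lefP/nd_nnsfun_approx.
transitivity (limn (fun n => \int[la]_x ((h n x)%:E * (f x)%:E))).
  by congr (limn _); apply/funext => n; exact: hE.
rewrite -monotone_convergence//.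
- apply: eq_integral => x _; apply/cvg_lim => //; apply: cvgeZr => //.
  exact: cvg_nnsfun_approx.
- by move=> n; apply: emeasurable_funM => //; exact/measurable_EFinP.
- by move=> n x _; rewrite mule_ge0// lee_fin.
- move=> x _ a b ab; rewrite lee_wpmul2r ?lee_fin//.
  exact/lefP/nd_nnsfun_approx.
Qed.

End density.

(** * Borel sets of the Euclidean space and supports of measures *)
Section rV_topology.
Context (R : realType) (d : nat).
Implicit Types (x y : 'rV[R]_d) (U : set 'rV[R]_d).

(** A countable base of the topology, made of boxes: [ball] refers to the sup norm. *)
Definition rat_ball (p : 'rV[rat]_d * nat) : set 'rV[R]_d :=
  ball (map_mx ratr p.1 : 'rV[R]_d) (p.2.+1%:R^-1 : R).

Lemma rat_ball_cover U : open U ->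
  U = \bigcup_(p in [set p | rat_ball p `<=` U]) rat_ball p.
Proof.
move=> oU; apply/seteqP; split=> [x Ux|x [p pU px]]; last exact: pU.
have /nbhs_ballP[e /= e0 eU] : nbhs x U by exact: open_nbhs_nbhs.
have [n] : exists n : nat, 0 + (n.+1%:R^-1 : R) < e / 2.
  by apply: ltr_add_invr; rewrite divr_gt0.
rewrite add0r => ne.
have n0 : 0 < (n.+1%:R^-1 : R) by rewrite invr_gt0.
have /choice[q xq] : forall i, exists q : rat,
    `|ratr q - x ord0 i| < (n.+1%:R^-1 : R).
  move=> i; have : x ord0 i - n.+1%:R^-1 < x ord0 i + n.+1%:R^-1.
    by rewrite ltrBlDr -addrA ltrDl addr_gt0.
  move=> /rat_in_itvoo[q]; rewrite in_itv/= => /andP[q1 q2].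
  by exists q; rewrite ltr_distl q1.
exists (\row_i q i, n); last first.
  by split=> // i j; rewrite /ball/= !mxE !ord1; exact: xq.
move=> y qy; apply: eU; apply: (@le_ball _ _ _ (n.+1%:R^-1 + n.+1%:R^-1)).
  by rewrite [leRHS]splitr lerD// ltW.
apply: ball_triangle qy.
apply: ball_sym; split=> // i j; rewrite /ball/= !mxE !ord1; exact: xq.
Qed.

Lemma measurable_rat_ball p : measurable (rat_ball p).
Proof.
rewrite (_ : rat_ball p = box (@coord_rV R d)
    (fun i => ball (ratr (p.1 ord0 i) : R) (p.2.+1%:R^-1 : R))).
  by apply: measurable_box => // i; exact: measurable_ball.
apply/seteqP; split=> [x [_ px] i|x px].
  by have := px ord0 i; rewrite mxE.
split=> [|i j]; first by rewrite invr_gt0.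
by rewrite mxE ord1; exact: px.
Qed.

Lemma countable_bigcup_seq (I : countType) T (D : set I) (F : I -> set T) :
  \bigcup_(i in D) F i = \bigcup_n
    (if unpickle n is Some i then if i \in D then F i else set0 else set0).
Proof.
apply/seteqP; split=> [x [i Di Fx]|x [n _]].
  by exists (pickle i) => //; rewrite pickleK mem_set.
by case: unpickle => [i|//]; case: ifPn => [/set_mem Di Fx|//]; exists i.
Qed.

Lemma open_measurable_rV U : open U -> measurable U.
Proof.
move=> /rat_ball_cover ->; rewrite countable_bigcup_seq.
apply: bigcupT_measurable => n; case: unpickle => [p|//].
by case: ifP => // _; exact: measurable_rat_ball.
Qed.

Lemma closed_measurable_rV U : closed U -> measurable U.
Proof.
move=> cU; rewrite -[U]setCK; apply: measurableC; apply: open_measurable_rV.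
exact: closed_openC.
Qed.

Lemma continuous_measurable_rV (h : 'rV[R]_d -> R) :
  continuous h -> measurable_fun [set: 'rV[R]_d] h.
Proof.
move=> /continuousP ch; apply: (measurability _ (RGenOpens.measurableE R)).
move=> _ [_ [a [b ->] <-]]; rewrite setTI; apply: open_measurable_rV.
exact/ch/interval_open.
Qed.

(** The complement of the support is covered by the countably many rational
    balls that the measure does not charge. *)
Lemma support_conegligible (mu : {measure set 'rV[R]_d -> \bar R}) (A : set 'rV[R]_d) :
  A = [set x | forall U, open U -> U x -> (0 < mu U)%E] -> mu.-negligible (~` A).
Proof.
move=> AE; pose D := [set p | mu (rat_ball p) = 0%E].
apply: (@negligibleS _ _ _ _ (\bigcup_(p in D) rat_ball p)).
  move=> x; rewrite AE => /= /existsNP[U /not_implyP[oU /not_implyP[Ux U0]]].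
  have mU0 : mu U = 0%E.
    by apply/eqP; rewrite eq_le measure_ge0 andbT leNgt; apply/negP.
  move: (Ux); rewrite {1}(rat_ball_cover oU) => -[p pU px]; exists p => //.
  apply/eqP; rewrite eq_le measure_ge0 andbT -mU0.
  by rewrite le_measure// inE; [exact: measurable_rat_ball|exact: open_measurable_rV].
rewrite countable_bigcup_seq; apply: negligible_bigcup => n.
case: unpickle => [p|]; last exact: negligible_set0.
case: ifPn => [/set_mem Dp|_]; last exact: negligible_set0.
apply/negligibleP => //; exact: measurable_rat_ball.
Qed.

End rV_topology.

(** * The Euclidean norm *)
Section enorm_theory.
Context (R : realType) (d : nat).
Implicit Types (x y z : 'rV[R]_d) (A : set 'rV[R]_d).

Lemma enorm_ge0 x : 0 <= enorm x.
Proof. exact: sqrtr_ge0. Qed.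

Lemma enormX2 x : enorm x ^+ 2 = \sum_(i < d) x ord0 i ^+ 2.
Proof. by rewrite sqr_sqrtr// sumr_ge0// => i _; exact: sqr_ge0. Qed.

Lemma enormZ (a : R) x : enorm (a *: x) = `|a| * enorm x.
Proof.
rewrite /enorm -sqrtr_sqr -sqrtrM ?sqr_ge0// mulr_sumr; congr Num.sqrt.
by apply: eq_bigr => i _; rewrite mxE exprMn.
Qed.

Lemma enormN x : enorm (- x) = enorm x.
Proof. by rewrite -scaleN1r enormZ normrN normr1 mul1r. Qed.

Lemma enorm0 : enorm (0 : 'rV[R]_d) = 0.
Proof. by rewrite -(scale0r (0 : 'rV[R]_d)) enormZ normr0 mul0r. Qed.

Lemma enormB x y : enorm (x - y) = enorm (y - x).
Proof. by rewrite -opprB enormN. Qed.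

Lemma coord_le_enorm x (i : 'I_d) : `|x ord0 i| <= enorm x.
Proof.
rewrite -sqrtr_sqr /enorm ler_wsqrtr// (bigD1 i)//= lerDl.
by apply: sumr_ge0 => j _; exact: sqr_ge0.
Qed.

Lemma enorm_le_sup x (r : R) : (forall i, `|x ord0 i| <= r) ->
  enorm x <= Num.sqrt d%:R * r.
Proof.
have [d0 _|d0 xr] := posnP d.
  rewrite (_ : d%:R = 0 :> R) ?d0// sqrtr0 mul0r /enorm big1 ?sqrtr0// => i _.
  by have := ltn_ord i; rewrite {2}d0.
have r0 : 0 <= r by exact: le_trans (xr (Ordinal d0)).
rewrite -[r]ger0_norm// -sqrtr_sqr -sqrtrM// ler_wsqrtr//.
apply: (@le_trans _ _ (\sum_(i < d) r ^+ 2)).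
  by apply: ler_sum => i _; rewrite -[_ ^+ 2]ger0_norm ?sqr_ge0// normrX lerXn2r ?nnegrE.
by rewrite sumr_const card_ord mulr_natl.
Qed.

Lemma cauchy_schwarz x y :
  \sum_(i < d) x ord0 i * y ord0 i <= enorm x * enorm y.
Proof.
have enorm_eq0 z : enorm z = 0 -> forall i, z ord0 i = 0.
  by move=> z0 i; apply/eqP; rewrite -normr_le0 -z0 coord_le_enorm.
have := enorm_ge0 x; rewrite le_eqVlt => /orP[/eqP x0|x0].
  by rewrite -x0 mul0r big1// => i _; rewrite (enorm_eq0 x)// mul0r.
have := enorm_ge0 y; rewrite le_eqVlt => /orP[/eqP y0|y0].
  by rewrite -y0 mulr0 big1// => i _; rewrite (enorm_eq0 y)// mulr0.
set a := enorm x; set b := enorm y.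
apply: (@le_trans _ _ (\sum_(i < d) ((b / (2 * a)) * x ord0 i ^+ 2
    + (a / (2 * b)) * y ord0 i ^+ 2))).
  apply: ler_sum => i _; rewrite -subr_ge0.
  rewrite (_ : _ - _ = (b * x ord0 i - a * y ord0 i) ^+ 2 / (2 * a * b)).
    by rewrite divr_ge0 ?sqr_ge0// ?mulr_ge0 ?ltW.
  by field; rewrite !gt_eqF.
rewrite big_split/= -!mulr_sumr -!enormX2 -/a -/b le_eqVlt; apply/orP; left.
by apply/eqP; field; rewrite !gt_eqF.
Qed.

Lemma enormD x y : enorm (x + y) <= enorm x + enorm y.
Proof.
rewrite -(@ler_pXn2r _ 2)// ?nnegrE ?addr_ge0 ?enorm_ge0//.
rewrite sqrrD !enormX2 (eq_bigr (fun i => x ord0 i ^+ 2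
   + 2 * (x ord0 i * y ord0 i) + y ord0 i ^+ 2)); last first.
  by move=> i _; rewrite mxE sqrrD mulr_natl.
rewrite !big_split/= lerD2r lerD2l -mulr_sumr -[leRHS]mulr_natl ler_pM2l//.
exact: cauchy_schwarz.
Qed.

Lemma enorm_triangle y x z : enorm (x - z) <= enorm (x - y) + enorm (y - z).
Proof. by rewrite (le_trans _ (enormD _ _))// addrA subrK. Qed.

Lemma elipschitz_continuous (h : 'rV[R]_d -> R) :
  (forall x y, `|h x - h y| <= enorm (x - y)) -> continuous h.
Proof.
move=> hlip x; apply/(@cvgrPdist_le _ R^o _ (nbhs x) (nbhs_filter x)) => e e0.
pose c : R := Num.sqrt d%:R + 1.
have c0 : 0 < c by rewrite ltr_wpDl// sqrtr_ge0.
apply/nbhs_ballP; exists (e / c) => /=; first by rewrite divr_gt0.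
move=> y; rewrite -ball_normE => /ltW xy; rewrite (le_trans (hlip _ _))//.
rewrite (le_trans (@enorm_le_sup _ (e / c) _))//.
  move=> i; apply: le_trans xy.
  rewrite /Num.norm/= mx_normrE.
  have := le_bigmax 0 (fun p : 'I_1 * 'I_d => `|(x - y) p.1 p.2|) (ord0, i).
  exact: le_trans.
rewrite mulrA ler_pdivrMr// mulrC ler_pM2l// /c lerDl; exact: ler01.
Qed.

Lemma enorm_sub_continuous y : continuous (fun x => enorm (x - y)).
Proof.
apply: elipschitz_continuous => x z; rewrite ler_norml; apply/andP; split.
  by have := enorm_triangle x z y; rewrite (enormB z x); lra.
by have := enorm_triangle z x y; lra.
Qed.

Lemma measurable_fun_enorm d1 (T : measurableType d1) (u v : T -> 'rV[R]_d) :
  measurable_fun setT u -> measurable_fun setT v ->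
  measurable_fun setT (fun s => enorm (u s - v s)).
Proof.
move=> mu mv; rewrite (_ : (fun _ => _) = Num.sqrt \o
    (fun s => \sum_(i < d) (coord_rV i (u s) - coord_rV i (v s)) ^+ 2)).
  apply: measurableT_comp.
    by apply: continuous_measurable_fun; exact: sqrt_continuous.
  apply: measurable_sum => i; apply: measurable_funX; apply: measurable_funB.
    by apply: measurableT_comp mu; exact: measurable_coord_rV.
  by apply: measurableT_comp mv; exact: measurable_coord_rV.
by apply/funext => s /=; congr Num.sqrt; apply: eq_bigr => i _; rewrite !mxE.
Qed.

Lemma measurable_eball x (r : R) : measurable (eball x r).
Proof.
rewrite (_ : eball x r = (fun y => enorm (y - x)) @^-1` `]-oo, r]).
  rewrite -[X in measurable X]setTI; apply: measurable_fun_enorm => //.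
by apply/seteqP; split => y; rewrite /eball/= in_itv.
Qed.

Lemma dist_to_lipschitz A x y : A !=set0 ->
  `|dist_to x A - dist_to y A| <= enorm (x - y).
Proof.
move=> [a Aa].
suff H u v : dist_to u A <= dist_to v A + enorm (u - v).
  by rewrite ler_norml; have := H x y; have := H y x; rewrite (enormB y x); lra.
rewrite -lerBlDr; apply: lb_le_inf; first by exists (enorm (v - a)), a.
move=> _ [b Ab <-]; rewrite lerBlDr addrC.
rewrite (le_trans _ (enorm_triangle v u b))//.
apply: ge_inf; last by exists b.
by exists 0 => _ [c _ <-]; exact: enorm_ge0.
Qed.

Lemma dist_to_ge0 x A : 0 <= dist_to x A.
Proof.
rewrite /dist_to; have [->|/set0P[a Aa]] := eqVneq A set0.
  by rewrite image_set0 inf0.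
by apply: lb_le_inf => [|_ [b _ <-]]; [exists (enorm (x - a)), a|exact: enorm_ge0].
Qed.

Lemma measurable_dist_to A :
  A !=set0 -> measurable_fun setT (fun x => dist_to x A).
Proof.
move=> A0; apply: continuous_measurable_rV; apply: elipschitz_continuous => x y.
exact: dist_to_lipschitz.
Qed.

Lemma lt_dist_to x y A : enorm (x - y) < dist_to x (~` A) -> A y.
Proof.
move=> xy; apply: contrapT => Ay; move: xy; apply/negP; rewrite -leNgt.
by apply: ge_inf; [exists 0 => _ [c _ <-]; exact: enorm_ge0|exists y].
Qed.

End enorm_theory.

(** * Point reflections and volumes of balls *)
Section lebesgue_rV_theory.
Context (R : realType) (d : nat).
Implicit Types (x y : 'rV[R]_d) (A : set 'rV[R]_d).
Let la := @lebesgue_rV R d.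

Lemma lebesgue_reflect (c : R) (A : set (measurableTypeR R)) : measurable A ->
  @lebesgue_measure R ((fun a => c - a) @^-1` A) = @lebesgue_measure R A.
Proof.
move=> mA; have mphi : measurable_fun setT
    (fun a : measurableTypeR R => c - a : measurableTypeR R).
  by apply: measurable_funB.
pose m2 : {measure set (measurableTypeR R) -> \bar R} :=
  measure_function_pushforward__canonical__measure_function_Measure
    (@lebesgue_measure R) mphi.
apply/esym; rewrite -[RHS]/(m2 A).
apply: lebesgue_measure_unique => // _ [[a b]] _ <-.
rewrite /m2/= /pushforward (_ : _ @^-1` _ = `[c - b, c - a[%classic).
  rewrite !lebesgue_measure_itv/= !lte_fin ltrD2l ltrN2 -!EFinB.
  by case: ifP => // _; congr EFin; lra.
by apply/seteqP; split=> z /=; rewrite !in_itv/=; lra.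
Qed.

Definition reflect_at x y : 'rV[R]_d := x + x - y.

Lemma reflect_atK x : involutive (reflect_at x).
Proof. by move=> y; rewrite /reflect_at opprB addrC subrK. Qed.

Lemma measurable_reflect_at x : measurable_fun setT (reflect_at x).
Proof.
apply: measurable_fun_rVP => i.
rewrite (_ : _ \o _ = fun y => (x + x) ord0 i - coord_rV i y).
  by apply: measurable_funB => //; exact: measurable_coord_rV.
by apply/funext => y; rewrite /= /coord_rV /reflect_at !mxE.
Qed.

Lemma lebesgue_box (A : 'I_d -> set (measurableTypeR R)) :
  (forall i, measurable (A i)) ->
  la (box (@coord_rV R d) A) = (\prod_(i < d) @lebesgue_measure R (A i))%E.
Proof. exact: lebesgue_rV_box. Qed.

(** Both sides are measures of [A]; on boxes they agree coordinate by coordinate. *)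
Lemma lebesgue_rV_reflect x A : measurable A -> la (reflect_at x @^-1` A) = la A.
Proof.
move=> mA.
pose m2 : {measure set 'rV[R]_d -> \bar R} :=
  measure_function_pushforward__canonical__measure_function_Measure
    la (measurable_reflect_at x).
apply/esym; rewrite -[RHS]/(m2 A).
apply: (@box_measure_unique _ _ _ _ _ (@coord_rV R d) erefl R
  (fun k _ => `[- k%:R, k%:R]%classic)) => //.
- apply/seteqP; split=> // y _.
  exists (Num.truncn (enorm y)).+1 => // i; rewrite /= in_itv/=.
  rewrite -ler_norml (le_trans (coord_le_enorm y i))// ltW//.
  by rewrite real_truncnS_gt ?num_real.
- move=> k; rewrite [X in (X < _)%E]lebesgue_box//.
  rewrite -ge0_fin_numE ?prode_ge0// prode_fin_num// => i _.
  rewrite ge0_fin_numE// lebesgue_measure_itv; case: ifP => _; exact: ltry.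
have mphi i : measurable_fun setT
    (fun a : measurableTypeR R => (x + x) ord0 i - a : measurableTypeR R).
  by apply: measurable_funB.
move=> B mB; rewrite /m2/= /pushforward.
rewrite (_ : _ @^-1` _ =
    box (@coord_rV R d) (fun i => (fun a => (x + x) ord0 i - a) @^-1` B i)).
  rewrite [LHS]lebesgue_box; last exact: mB.
  rewrite [RHS]lebesgue_box; last first.
    move=> i; rewrite -[X in measurable X]setTI; apply: mphi => //; exact: mB.
  by apply: eq_bigr => i _; rewrite lebesgue_reflect//; exact: mB.
by apply/seteqP; split=> y By i; have := By i; rewrite /= /coord_rV /reflect_at !mxE.
Qed.

Lemma lebesgue_cube x (r : R) : 0 <= r ->
  la (box (@coord_rV R d) (fun i => `[x ord0 i - r, x ord0 i + r]%classic)) =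
  ((2 * r) ^+ d)%:E.
Proof.
move=> r0; rewrite lebesgue_box//.
rewrite (eq_bigr (fun _ => (2 * r)%:E)).
  by rewrite prodEFin prodr_const card_ord.
move=> i _; rewrite lebesgue_measure_itv/= lte_fin -EFinB.
have [xr|xr] := ltP; first by congr EFin; lra.
by congr EFin; lra.
Qed.

(** The ball lies in the cube of half-side [r], and contains the one of half-side
    [r / sqrt d]. *)
Lemma lebesgue_eball_le x (r : R) : 0 <= r ->
  (la (eball x r) <= ((2 * r) ^+ d)%:E)%E.
Proof.
move=> r0; rewrite -(lebesgue_cube x r0); apply: le_measure; rewrite ?inE.
- exact: measurable_eball.
- by apply: (@measurable_box _ _ _ _ _ (@coord_rV R d) erefl) => i.
move=> y; rewrite /eball/= => yr i; rewrite /= in_itv/= /coord_rV.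
have := le_trans (coord_le_enorm (y - x) i) yr.
by rewrite !mxE ler_norml; lra.
Qed.

Lemma lebesgue_eball_ge x (r : R) : (0 < d)%N -> 0 <= r ->
  (((2 / Num.sqrt d%:R * r) ^+ d)%:E <= la (eball x r))%E.
Proof.
move=> d0 r0; have sd0 : 0 < Num.sqrt d%:R :> R by rewrite sqrtr_gt0 ltr0n.
have r'0 : 0 <= r / Num.sqrt d%:R by rewrite divr_ge0// ltW.
rewrite -mulrA (mulrC _^-1) -(lebesgue_cube x r'0); apply: le_measure; rewrite ?inE.
- by apply: (@measurable_box _ _ _ _ _ (@coord_rV R d) erefl) => i.
- exact: measurable_eball.
move=> y /= yr; rewrite /eball/=.
apply: (@le_trans _ _ (Num.sqrt d%:R * (r / Num.sqrt d%:R))).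
  apply: enorm_le_sup => i; have := yr i; rewrite /= in_itv/= /coord_rV !mxE ler_norml; lra.
by rewrite mulrCA divff ?mulr1// gt_eqF.
Qed.

End lebesgue_rV_theory.

(** * Uniform Taylor bounds on compact sets *)
Section C2_bounds.
Context (R : realType) (d : nat).
Implicit Types (x y z v : 'rV[R]_d) (A K U : set 'rV[R]_d) (h : 'rV[R]_d -> R).

Lemma is_derive_line h x v (t : R) : differentiable h (x + t *: v) ->
  is_derive t (1 : R) (fun s => h (x + s *: v)) ('D_v h (x + t *: v)).
Proof.
move=> dh; have E : (fun k : R => k^-1 *: (h (x + (k *: 1 + t) *: v) - h (x + t *: v)))
    = (fun k : R => k^-1 *: (h (k *: v + (x + t *: v)) - h (x + t *: v))).
  apply/funext => k; congr (_ *: (h _ - _)).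
  by rewrite scalerDl -[k *: 1]/(k * 1) mulr1 addrCA.
have dv : derivable h (x + t *: v) v by exact: diff_derivable.
by split; rewrite /derivable /derive /= ?E.
Qed.

(** The mean value theorem along a segment, which only asks for differentiability there:
    the set on which bounds are wanted need not be convex. *)
Lemma mvt_line h x v : (forall t : R, 0 <= t <= 1 -> differentiable h (x + t *: v)) ->
  exists2 t : R, 0 <= t <= 1 & h (x + v) - h x = 'D_v h (x + t *: v).
Proof.
move=> dh.
have D (t : R) : t \in `[0, 1]%R -> is_derive t (1 : R) (fun s : R => h (x + s *: v))
    ('D_v h (x + t *: v)).
  by rewrite in_itv/= => /dh; exact: is_derive_line.
pose f (s : R) : R := h (x + s *: v).
pose df (s : R) : R := 'D_v h (x + s *: v).
have cf : {within `[0, 1], continuous f}.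
  by apply: derivable_within_continuous => t /D Dt; exact: ex_derive.
have Df (s : R) : s \in `]0, 1[%R -> is_derive s (1 : R) f (df s).
  by move=> /subset_itv_oo_cc; exact: D.
have [t t01] := MVT_segment ler01 Df cf.
rewrite /f scale1r scale0r addr0 subr0 mulr1 => ->.
by exists t => //; move: t01; rewrite in_itv.
Qed.

Definition basis_rV (i : 'I_d) : 'rV[R]_d := delta_mx ord0 i.

Lemma derive_coord h x v : differentiable h x ->
  'D_v h x = \sum_(i < d) v ord0 i * 'D_(basis_rV i) h x.
Proof.
move=> dh; rewrite deriveE// {1}(row_sum_delta v) linear_sum/=.
by apply: eq_bigr => i _; rewrite linearZ/= deriveE.
Qed.

Lemma coord_le_norm v (i : 'I_d) : `|v ord0 i| <= `|v|.
Proof.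
rewrite [leRHS]mx_normrE.
exact: (le_bigmax 0 (fun p : 'I_1 * 'I_d => `|v p.1 p.2|) (ord0, i)).
Qed.

Lemma norm_le_enorm v : `|v| <= enorm v.
Proof.
rewrite [leLHS]mx_normrE; apply/bigmax_leP; split=> [|[j i] _].
  exact: enorm_ge0.
by rewrite ord1; exact: coord_le_enorm.
Qed.

Lemma sum_coord_le v (F : 'I_d -> R) (M : R) : (forall i, `|F i| <= M) ->
  `|\sum_(i < d) v ord0 i * F i| <= d%:R * M * `|v|.
Proof.
move=> FM; rewrite (le_trans (ler_norm_sum _ _ _))//.
apply: (@le_trans _ _ (\sum_(i < d) M * `|v|)).
  by apply: ler_sum => i _; rewrite normrM mulrC ler_pM// coord_le_norm.
by rewrite sumr_const card_ord -[leLHS]mulr_natl mulrA.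
Qed.

Lemma ball_segment a (r : R) x v t : ball a r x -> ball a r (x + v) ->
  0 <= t <= 1 -> ball a r (x + t *: v).
Proof.
rewrite -!ball_normE /ball_/= => ax axv /andP[t0 t1].
rewrite (_ : _ - _ = (1 - t) *: (a - x) + t *: (a - (x + v))); last first.
  by apply/rowP => i; rewrite !mxE; ring.
rewrite (le_lt_trans (ler_normD _ _))// !normrZ !ger0_norm ?subr_ge0//.
set p := `|a - x| in ax *; set q := `|a - (x + v)| in axv *.
have : Num.max p q < r by rewrite gt_max ax.
apply: le_lt_trans.
rewrite (_ : Num.max p q = (1 - t) * Num.max p q + t * Num.max p q);
  last by rewrite -mulrDl subrK mul1r.
apply: lerD.
  by rewrite ler_wpM2l ?subr_ge0// le_max lexx.
by rewrite ler_wpM2l// le_max lexx orbT.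
Qed.

Lemma local_lipschitz h a (r M : R) :
  (forall z, ball a r z -> differentiable h z) ->
  (forall z i, ball a r z -> `|'D_(basis_rV i) h z| <= M) ->
  forall x y, ball a r x -> ball a r y -> `|h y - h x| <= d%:R * M * `|y - x|.
Proof.
move=> dh hM x y ax ay.
have xy t : 0 <= t <= 1 -> ball a r (x + t *: (y - x)).
  by apply: ball_segment => //; rewrite addrC subrK.
have [t t01] := @mvt_line h x (y - x) (fun t t01 => dh _ (xy t t01)).
rewrite [x + _]addrC subrK => ->; rewrite derive_coord; last exact/dh/xy.
by apply: sum_coord_le => i; apply: hM; exact: xy.
Qed.

(** A local bound whose constant may be enlarged holds with one constant on a compact set. *)
Lemma compact_uniform_bound K (Q : R -> 'rV[R]_d -> Prop) : compact K ->
  (forall M M' x, M <= M' -> Q M x -> Q M' x) ->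
  (forall a, K a -> exists M, \forall x \near a, Q M x) ->
  exists2 M : R, 0 < M & forall x, K x -> Q M x.
Proof.
move=> /compact_near_coveringP cK Qmono Qloc.
have : \forall M \near +oo, K `<=` Q M.
  apply: cK => a /Qloc[M QM]; exists ([set x | Q M x], [set M' | M <= M']).
    by split => //=; apply: nbhs_pinfty_ge; exact: num_real.
  by move=> [x M'] /= [Qx MM']; exact: Qmono Qx.
move=> [M [Mreal MK]]; exists (`|M| + 1); first by rewrite ltr_wpDl.
by apply: MK; rewrite (le_lt_trans (ler_norm _))// ltrDl.
Qed.

Lemma near_bounded h a : {for a, continuous h} ->
  \forall x \near a, `|h x| <= `|h a| + 1.
Proof.
move=> /(@cvgrPdist_le _ R^o _ (nbhs a) (nbhs_filter a))/(_ 1 ltr01).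
apply: filterS => x; rewrite -lerBlDl; apply: le_trans.
by rewrite distrC lerB_dist.
Qed.

Lemma le_term_sum (I : finType) (F : I -> R) (i : I) :
  (forall k, 0 <= F k) -> F i <= \sum_k F k.
Proof.
by move=> F0; rewrite (bigD1 i)//= lerDl; apply: sumr_ge0 => k _; exact: F0.
Qed.

Lemma C2_local_bounds U h a : open U -> C2_on U h -> U a ->
  exists r M : R, [/\ 0 < r, 0 <= M & forall z, ball a r z ->
    [/\ U z, forall i, `|'D_(basis_rV i) h z| <= M &
        forall i j, `|'D_(basis_rV j) ('D_(basis_rV i) h) z| <= M]].
Proof.
move=> oU cU Ua; have [dh d2h c2h] := cU a Ua.
pose M : R := (\sum_(i < d) (`|'D_(basis_rV i) h a| + 1)) +
  \sum_(i < d) \sum_(j < d) (`|'D_(basis_rV j) ('D_(basis_rV i) h) a| + 1).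
have t1 (i : 'I_d) : 0 <= `|'D_(basis_rV i) h a| + 1 by rewrite addr_ge0.
have t2 (i j : 'I_d) : 0 <= `|'D_(basis_rV j) ('D_(basis_rV i) h) a| + 1.
  by rewrite addr_ge0.
have s1 : 0 <= \sum_(i < d) (`|'D_(basis_rV i) h a| + 1).
  by apply: sumr_ge0 => i _; exact: t1.
have s2 i : 0 <= \sum_(j < d) (`|'D_(basis_rV j) ('D_(basis_rV i) h) a| + 1).
  by apply: sumr_ge0 => j _; exact: t2.
have : \forall z \near a, [/\ U z, forall i, `|'D_(basis_rV i) h z| <= M &
    forall i j, `|'D_(basis_rV j) ('D_(basis_rV i) h) z| <= M].
  have FF : Filter (nbhs a) := nbhs_filter a.
  have n1 : \forall z \near a, U z by exact: open_nbhs_nbhs.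
  have n2 : \forall z \near a, forall i, `|'D_(basis_rV i) h z| <= M.
    apply: (@filter_forall _ 'I_d
      (fun i z => `|'D_(basis_rV i) h z| <= M) _ FF) => i.
    have /near_bounded : {for a, continuous ('D_(basis_rV i) h)}.
      exact: differentiable_continuous.
    apply: filterS => z /le_trans; apply.
    apply: ler_wpDr; last exact: (le_term_sum i t1).
    by apply: sumr_ge0 => k _; exact: s2.
  have n3 : \forall z \near a, forall i j,
      `|'D_(basis_rV j) ('D_(basis_rV i) h) z| <= M.
    apply: (@filter_forall _ 'I_d (fun i z => forall j,
      `|'D_(basis_rV j) ('D_(basis_rV i) h) z| <= M) _ FF) => i.
    apply: (@filter_forall _ 'I_d (fun j z =>
      `|'D_(basis_rV j) ('D_(basis_rV i) h) z| <= M) _ FF) => j.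
    have /near_bounded := c2h (basis_rV j) (basis_rV i).
    apply: filterS => z /le_trans; apply.
    apply: ler_wpDl => //; apply: le_trans (le_term_sum i s2).
    exact: (le_term_sum j (t2 i)).
  by apply: filterS3 n1 n2 n3 => z.
move=> /nbhs_ballP[r /= r0 ar]; exists r, M; split=> //.
by rewrite addr_ge0// sumr_ge0.
Qed.

Lemma C2_bounded K U h : compact K -> K `<=` U -> C2_on U h ->
  exists2 M : R, 0 < M & forall x, K x -> `|h x| <= M.
Proof.
move=> cK KU cU.
have [||M M0 MK] := @compact_uniform_bound K (fun M x => `|h x| <= M) cK.
- by move=> M M' x MM' /le_trans; exact.
- move=> a /KU/cU[dh _ _]; exists (`|h a| + 1); apply: near_bounded.
  exact: differentiable_continuous.
by exists M.
Qed.

(** The compact set is not assumed convex, so the mean value theorem applies only inside a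
    small ball; for points at distance at least [r / 2], boundedness of [h] is enough. *)
Lemma C2_lipschitz K U h : compact K -> open U -> K `<=` U -> C2_on U h ->
  exists2 M : R, 0 < M & forall x y, K x -> K y -> `|h x - h y| <= M * enorm (x - y).
Proof.
move=> cK oU KU cU; have [B B0 hB] := C2_bounded cK KU cU.
have [||M M0 MK] := @compact_uniform_bound K
  (fun M x => K x -> forall y, K y -> `|h x - h y| <= M * `|x - y|) cK.
- move=> M M' x MM' + Kx y Ky => /(_ Kx y Ky)/le_trans; apply.
  by rewrite ler_wpM2r.
- move=> a /KU Ua; have [r [M [r0 M0 rM]]] := C2_local_bounds oU cU Ua.
  exists (d%:R * M + 4 * B / r); apply/nbhs_ballP; exists (r / 2) => /=.
    by rewrite divr_gt0.
  move=> x ax Kx y Ky.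
  have axr : ball a r x by apply: le_ball ax; rewrite ler_pdivrMr//; lra.
  rewrite [leRHS]mulrDl; have [ayr|ayr] := pselect (ball a r y).
    rewrite ler_wpDr//; first by rewrite !mulr_ge0// ?invr_ge0 ltW.
    apply: (local_lipschitz _ _ ayr axr) => z => [az|i az].
      by have [/cU[]] := rM z az.
    by have [_ + _] := rM z az; apply.
  rewrite ler_wpDl//; first by rewrite !mulr_ge0.
  have xyr : r / 2 <= `|x - y|.
    rewrite leNgt; apply/negP => xy; apply: ayr.
    rewrite [r]splitr; apply: ball_triangle ax _.
    by rewrite -ball_normE.
  apply: (@le_trans _ _ (B + B)).
    by rewrite (le_trans (ler_normB _ _))// lerD// hB.
  apply: (@le_trans _ _ (4 * B / r * (r / 2))).
    by rewrite le_eqVlt; apply/orP; left; apply/eqP; field; rewrite gt_eqF.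
  by rewrite ler_wpM2l// !mulr_ge0// ?invr_ge0 ltW.
exists M => // x y Kx Ky; rewrite (le_trans (MK x Kx Kx y Ky))//.
by rewrite ler_wpM2l ?norm_le_enorm// ltW.
Qed.

(** For short [v], the two increments are first derivatives at two points of the segment,
    and these differ by at most a second derivative times [2 * |v|]; for long [v],
    boundedness of [h] is enough. *)
Lemma C2_second_difference K U h :
  compact K -> open U -> K `<=` U -> C2_on U h ->
  exists2 M : R, 0 < M & forall x v, K x -> K (x + v) -> K (x - v) ->
    `|h (x + v) + h (x - v) - 2 * h x| <= M * enorm v ^+ 2.
Proof.
move=> cK oU KU cU; have [B B0 hB] := C2_bounded cK KU cU.
have [||M M0 MK] := @compact_uniform_bound K
  (fun M x => K x -> forall v, K (x + v) -> K (x - v) ->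
    `|h (x + v) + h (x - v) - 2 * h x| <= M * `|v| ^+ 2) cK.
- move=> M M' x MM' + Kx v K1 K2 => /(_ Kx v K1 K2)/le_trans; apply.
  by rewrite ler_wpM2r// exprn_ge0.
- move=> a /KU Ua; have [r [M [r0 M0 rM]]] := C2_local_bounds oU cU Ua.
  have dhr z : ball a r z -> differentiable h z.
    by move=> az; have [/cU[]] := rM z az.
  pose L : R := d%:R * M.
  have L0 : 0 <= L by rewrite mulr_ge0.
  exists (d%:R * (L * 2) + 16 * B / r ^+ 2); apply/nbhs_ballP; exists (r / 2) => /=.
    by rewrite divr_gt0.
  move=> x ax Kx v K1 K2.
  have axr : ball a r x by apply: le_ball ax; rewrite ler_pdivrMr//; lra.
  rewrite [leRHS]mulrDl; have [vr|vr] := ltP `|v| (r / 2).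
    rewrite ler_wpDr//.
      by rewrite mulr_ge0 ?exprn_ge0// mulr_ge0 ?invr_ge0 ?exprn_ge0 ?mulr_ge0// ltW.
    have xv w : `|w| < r / 2 -> forall t, 0 <= t <= 1 -> ball a r (x + t *: w).
      move=> wr t; apply: ball_segment => //; rewrite [r]splitr.
      by apply: ball_triangle ax _; rewrite -ball_normE/= opprD addrA subrr sub0r normrN.
    have vr' : `|- v| < r / 2 by rewrite normrN.
    have [t t01 Et] := @mvt_line h x v (fun t t01 => dhr _ (xv v vr t t01)).
    have [s s01 Es] := @mvt_line h x (- v) (fun t t01 => dhr _ (xv _ vr' t t01)).
    rewrite (_ : _ + _ - _ = (h (x + v) - h x) + (h (x - v) - h x)); last by ring.
    rewrite Et Es !derive_coord; [|exact/dhr/xv|exact/dhr/xv].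
    rewrite -big_split/= (eq_bigr (fun i => v ord0 i *
       ('D_(basis_rV i) h (x + t *: v) - 'D_(basis_rV i) h (x + s *: - v)))); last first.
      by move=> i _; rewrite mxE; ring.
    have -> : d%:R * (L * 2) * `|v| ^+ 2 = d%:R * (L * (2 * `|v|)) * `|v| by ring.
    apply: sum_coord_le => i.
    have := @local_lipschitz ('D_(basis_rV i) h) a r M _ _ (x + s *: - v) (x + t *: v)
      (xv _ vr' s s01) (xv _ vr t t01).
    move=> H; apply: le_trans (H _ _) _ => {H}.
    + by move=> z az; have [/cU[]] := rM z az.
    + by move=> z j az; have [_ _ +] := rM z az; apply.
    rewrite -/L ler_wpM2l//.
    rewrite (_ : _ - _ = (t + s) *: v); last by apply/rowP => j; rewrite !mxE; ring.
    rewrite normrZ ler_wpM2r// ger0_norm; lra.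
  rewrite ler_wpDl//; first by rewrite !mulr_ge0// ?exprn_ge0.
  apply: (@le_trans _ _ (4 * B)).
    have -> : 4 * B = B + B + 2 * B by ring.
    rewrite (le_trans (ler_normB _ _))// lerD//.
      by rewrite (le_trans (ler_normD _ _))// lerD// hB.
    by rewrite normrM ger0_norm// ler_wpM2l// hB.
  apply: (@le_trans _ _ (16 * B / r ^+ 2 * (r / 2) ^+ 2)).
    by rewrite le_eqVlt; apply/orP; left; apply/eqP; field; rewrite gt_eqF.
  rewrite ler_wpM2l//.
    by rewrite mulr_ge0 ?invr_ge0 ?exprn_ge0// ?mulr_ge0// ltW.
  by rewrite lerXn2r// nnegrE// ltW// divr_gt0.
exists M => // x v Kx K1 K2; rewrite (le_trans (MK x Kx Kx v K1 K2))//.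
apply: ler_wpM2l; first exact: ltW.
by rewrite lerXn2r ?nnegrE ?enorm_ge0 ?norm_le_enorm.
Qed.

End C2_bounds.

(** * Nearest neighbours by counting *)
Section nearest_neighbours.
Context (R : realType) (d N : nat).
Variables (W : 'I_N -> bool) (X : 'I_N -> 'rV[R]_d).
Implicit Types (x : 'rV[R]_d) (i j l : 'I_N).

(** The strict order in which [ranked_arm] lists the units: by distance, ties being broken
    by index because the sort is stable. *)
Definition closer x l j : bool :=
  (enorm (X l - x) <= enorm (X j - x)) &&
  ((enorm (X j - x) <= enorm (X l - x)) ==> (l < j)%N).

Definition rank_below (w : bool) x j : nat :=
  #|[pred l | (W l == w) && closer x l j]|.

Definition knn (k : nat) i j : bool :=
  (W j == ~~ W i) && (rank_below (~~ W i) (X i) j < k)%N.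

Lemma closer_irr x j : closer x j j = false.
Proof. by rewrite /closer lexx ltnn. Qed.

Lemma closer_asym x l j : closer x l j -> ~~ closer x j l.
Proof.
rewrite /closer => /andP[lj jl]; rewrite lj implyTb.
by apply/negP => /andP[/[dup] jl' /(implyP jl) + lj']; rewrite ltnNge ltnW.
Qed.

Lemma closer_trans x : transitive (closer x).
Proof.
move=> b a c /andP[ab ba] /andP[bc cb]; rewrite /closer (le_trans ab bc)/=.
apply/implyP => ca.
by rewrite (ltn_trans (implyP ba (le_trans bc ca)) (implyP cb (le_trans ca ab))).
Qed.

(** The elements below [j] are exactly those that precede it. *)
Lemma index_sorted (lt : rel 'I_N) (s : seq 'I_N) j :
  (forall a, lt a a = false) -> (forall a b, lt a b -> ~~ lt b a) ->
  pairwise lt s -> j \in s -> index j s = count (lt ^~ j) s.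
Proof.
move=> irr asym; elim: s => //= y s IH /andP[/allP ys ps].
rewrite inE eq_sym; have [<- _|yj /= js] := eqVneq y j.
  rewrite irr add0n; apply/esym/eqP; rewrite -leqn0 leqNgt -has_count.
  by apply/hasPn => z zs; apply: asym; exact: ys.
by rewrite (ys j js) IH.
Qed.

Let ranked (w : bool) x := ranked_arm W X w x.

Lemma ranked_uniq w x : uniq (ranked w x).
Proof. by rewrite sort_uniq filter_uniq// enum_uniq. Qed.

Lemma mem_ranked w x j : (j \in ranked w x) = (W j == w).
Proof. by rewrite mem_sort mem_filter mem_enum andbT. Qed.

Lemma size_ranked w x : size (ranked w x) = arm_size W w.
Proof.
rewrite size_sort /arm_size cardE /enum_mem -enumT !size_filter.
by rewrite count_filter; apply: eq_count => l; rewrite /= andbT.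
Qed.

Lemma ranked_pairwise w x : pairwise (closer x) (ranked w x).
Proof.
rewrite -(sorted_pairwise (@closer_trans x)).
apply: (@sort_stable _ _ (fun i j : 'I_N => (i < j)%N)).
- by move=> i j; exact: le_total.
- by move=> b a c; exact: ltn_trans.
apply: sorted_filter; first by move=> b a c; exact: ltn_trans.
by have := iota_ltn_sorted 0 N; rewrite -val_enum_ord sorted_map.
Qed.

Lemma index_ranked w x j : W j == w -> index j (ranked w x) = rank_below w x j.
Proof.
move=> Wj; rewrite (index_sorted (@closer_irr x) (@closer_asym x))//.
- rewrite (permP (permEl (perm_sort _ _))) count_filter /rank_below cardE.
  rewrite /enum_mem size_filter -enumT count_filter.
  by apply: eq_count => l; rewrite /= andbT andbC.
- exact: ranked_pairwise.
- by rewrite mem_ranked.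
Qed.

Lemma mem_take_ranked k i j :
  (j \in take k (ranked (~~ W i) (X i))) = knn k i j.
Proof.
rewrite /knn; have [Wj|Wj]/= := boolP (W j == ~~ W i).
  by rewrite in_take ?mem_ranked// index_ranked.
by apply/negP => /mem_take; rewrite mem_ranked (negbTE Wj).
Qed.

Lemma card_knn k i : (k <= arm_size W (~~ W i))%N -> #|knn k i| = k.
Proof.
move=> kW; rewrite -(@eq_card _ (mem (take k (ranked (~~ W i) (X i))))).
  rewrite (card_uniqP _) ?take_uniq ?ranked_uniq// size_takel//.
  by rewrite size_ranked.
by move=> j; rewrite mem_take_ranked.
Qed.

Lemma sum_nearest (G : 'I_N -> R) k i : (k <= arm_size W (~~ W i))%N ->
  \sum_(1 <= l < k.+1) G (nearest_index W X i (~~ W i) (X i) l) =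
  \sum_(j | knn k i j) G j.
Proof.
move=> kW; rewrite big_add1 big_mkord.
under eq_bigr do rewrite /nearest_index/=.
have sz : size (take k (ranked (~~ W i) (X i))) = k.
  by rewrite size_takel// size_ranked.
transitivity (\sum_(j <- take k (ranked (~~ W i) (X i))) G j).
  rewrite (big_nth i) sz big_mkord; apply: eq_bigr => l _.
  by rewrite nth_take.
rewrite big_uniq ?take_uniq ?ranked_uniq//.
by apply: eq_bigl => j; rewrite mem_take_ranked.
Qed.

(** The nearest neighbours are a set rather than a list: being one of them is a condition
    on a rank, that is, on the number of closer units. *)
Lemma matching_biasE (g : bool -> 'rV[R]_d -> R) k : (0 < k)%N ->
  matching_bias W X g k =
  if (k <= minn (arm_size W false) (arm_size W true))%N then
    N%:R^-1 * \sum_(i < N) (2 * (W i)%:R - 1) *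
      (k%:R^-1 * \sum_(j | knn k i j) (g (~~ W i) (X i) - g (~~ W i) (X j)))
  else 0.
Proof.
move=> k0; rewrite /matching_bias; case: ifP => // kmin; congr (_ * _).
apply: eq_bigr => i _; congr (_ * _).
have kW : (k <= arm_size W (~~ W i))%N.
  by move: kmin; rewrite leq_min => /andP[]; case: (W i).
rewrite (sum_nearest (fun j => g (~~ W i) (X j)))// sumrB mulrBr; congr (_ - _).
rewrite sumr_const (_ : #|_| = k); last exact: card_knn.
by rewrite -[X in _ = _ * X]mulr_natr mulrCA mulVf ?mulr1// pnatr_eq0 -lt0n.
Qed.

(** The units of the other arm within distance [r] all come before [j] in the ranking. *)
Lemma knn_farther k i j (r : R) : knn k i j -> r < enorm (X j - X i) ->
  (#|[pred l | (W l == ~~ W i) && (enorm (X l - X i)%R <= r)%R]| < k)%N.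
Proof.
move=> /andP[_]; rewrite /rank_below => jk rj; apply: leq_ltn_trans jk.
apply: subset_leq_card; apply/fintype.subsetP => l; rewrite !inE => /andP[-> lr]/=.
have lj := le_lt_trans lr rj.
by rewrite /closer (ltW lj) leNgt lj.
Qed.

End nearest_neighbours.

(** * Chernoff bounds for the number of close units *)
Section chernoff.
Context d0 d1 (Om : measurableType d0) (E : measurableType d1) (R : realType).
Variables (P : probability Om R) (Q : probability E R) (N : nat).
Variable V : 'I_N -> Om -> E.
Hypothesis V_iid : iid_sample P Q V.
Let smp := sample V.

Lemma tnth_upd (j l : 'I_N) (z : E) (t : N.-tuple E) :
  tnth (upd j z t) l = if l == j then z else tnth t l.
Proof. by rewrite /upd tnth_mktuple. Qed.

Lemma measurable_pair_of (F : E -> E -> R) (i e : 'I_N) :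
  measurable_fun setT (fun p : E * E => F p.1 p.2) ->
  measurable_fun [set: N.-tuple E] (fun t => F (tnth t i) (tnth t e)).
Proof.
move=> mF; pose h (t : N.-tuple E) := (tnth t i, tnth t e).
rewrite (_ : (fun _ => _) = (fun p : E * E => F p.1 p.2) \o h)//.
apply: measurableT_comp => //.
by apply: measurable_fun_pair; exact: measurable_tnth.
Qed.

Lemma measurable_resampled (l : 'I_N) (F : N.-tuple E -> \bar R) :
  measurable_fun [set: N.-tuple E] F -> (forall t, 0 <= F t)%E ->
  measurable_fun [set: N.-tuple E] (fun t => \int[Q]_z F (upd l z t))%E.
Proof.
move=> mF F0; pose h (p : N.-tuple E * E) := upd l p.2 p.1.
apply: (@measurable_fun_fubini_tonelli_F _ _ _ _ _ Q (F \o h)).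
  apply: measurableT_comp => //.
  rewrite (_ : h = (fun p => upd l p.1 p.2) \o (fun p => (p.2, p.1)))//.
  apply: measurableT_comp; first exact: measurable_upd.
  exact: measurable_fun_pair.
by move=> p; exact: F0.
Qed.

Lemma measurable_sample_comp (F : N.-tuple E -> \bar R) :
  measurable_fun [set: N.-tuple E] F -> measurable_fun setT (fun s => F (smp s)).
Proof. by move=> mF; apply: measurableT_comp mF _; exact: measurable_sample V_iid. Qed.

(** The units of [L] are independent of units [i] and [e] and of each other: integrating
    them out one by one yields a factor [b] each.  The bound on [phi] is asked only where
    [Phi] does not vanish, because it relies on the position of [z]. *)
Lemma expectation_prod_le (i e : 'I_N) (Phi phi : E -> E -> R) (b : R)
    (L : seq 'I_N) :
  measurable_fun setT (fun p : E * E => Phi p.1 p.2) ->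
  measurable_fun setT (fun p : E * E => phi p.1 p.2) ->
  (forall z z', 0 <= Phi z z') -> (forall z z', 0 <= phi z z') -> 0 <= b ->
  (forall z z', Phi z z' != 0 -> (\int[Q]_y (phi z y)%:E <= b%:E)%E) ->
  uniq L -> i \notin L -> e \notin L ->
  (\int[P]_s (Phi (tnth (smp s) i) (tnth (smp s) e) *
      \prod_(l <- L) phi (tnth (smp s) i) (tnth (smp s) l))%:E
   <= (b ^+ size L)%:E * \int[P]_s (Phi (tnth (smp s) i) (tnth (smp s) e))%:E)%E.
Proof.
move=> mPhi mphi Phi0 phi0 b0 hb.
elim: L => [_ _ _|l L IH /= /andP[lL uL]].
  by under eq_integral do rewrite big_nil mulr1; rewrite expr0 mul1e.
rewrite !inE !negb_or => /andP[il iL] /andP[el eL].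
pose G (t : N.-tuple E) := Phi (tnth t i) (tnth t e) *
  \prod_(l <- L) phi (tnth t i) (tnth t l).
have mG : measurable_fun setT G.
  apply: measurable_funM; first exact: measurable_pair_of.
  by apply: measurable_prod => m _; exact: measurable_pair_of.
have G0 t : 0 <= G t by rewrite mulr_ge0// prodr_ge0.
pose F (t : N.-tuple E) := (G t * phi (tnth t i) (tnth t l))%:E.
have mF : measurable_fun setT F.
  by apply/measurable_EFinP/measurable_funM => //; exact: measurable_pair_of.
have F0 t : (0 <= F t)%E by rewrite lee_fin mulr_ge0.
rewrite (_ : integral _ _ _ = \int[P]_s F (smp s))%E; last first.
  apply: eq_integral => s _; rewrite /F /G big_cons; congr EFin.
  by rewrite -!mulrA; congr (_ * _); rewrite mulrC.
rewrite (resample V_iid l mF F0) exprSr EFinM.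
have GE t z : G (upd l z t) = G t.
  rewrite /G !tnth_upd (negbTE il) (negbTE el); congr (_ * _).
  rewrite !big_seq; apply: eq_bigr => m mL; rewrite !tnth_upd.
  by case: eqP => // ml; rewrite -ml mL in lL.
apply: (@le_trans _ _ (\int[P]_s (b%:E * (G (smp s))%:E))%E).
  apply: ge0_le_integral => //.
  - by move=> s _; apply: integral_ge0 => z _; exact: F0.
  - apply: (measurable_sample_comp (F := fun t => \int[Q]_z F (upd l z t))%E).
    exact: measurable_resampled.
  - apply: emeasurable_funM => //.
    by apply: (measurable_sample_comp (F := EFin \o G)); exact/measurable_EFinP.
  move=> s _; rewrite /F.
  under eq_integral do rewrite GE tnth_upd (negbTE il) tnth_upd eqxx EFinM.
  rewrite ge0_integralZl_EFin//; last 2 first.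
  - by move=> z _; rewrite lee_fin.
  - apply/measurable_EFinP; exact: (measurable_fun_pair2 _ mphi).
  rewrite muleC; have [Phi00|Phin0] := eqVneq (Phi (tnth (smp s) i) (tnth (smp s) e)) 0.
    by rewrite /G Phi00 !mul0r !mule0.
  by rewrite lee_wpmul2r ?lee_fin//; exact: hb Phin0.
rewrite ge0_integralZl_EFin//; last 2 first.
- by move=> s _; rewrite lee_fin.
- by apply: (measurable_sample_comp (F := EFin \o G)); exact/measurable_EFinP.
by rewrite -muleA muleCA lee_wpmul2l ?lee_fin//; exact: IH.
Qed.

End chernoff.

Lemma geometric_sum_le (R : realType) (q : R) (n : nat) : 0 <= q -> q < 1 ->
  \sum_(s < n) q ^+ s <= (1 - q)^-1.
Proof.
move=> q0 q1; have q1' : 0 < 1 - q by rewrite subr_gt0.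
have E : (1 - q) * \sum_(s < n) q ^+ s = 1 - q ^+ n.
  by rewrite -[RHS]opprB subrX1 -mulNr opprB.
by rewrite -[leRHS]div1r ler_pdivlMr// mulrC E gerBl exprn_ge0.
Qed.

Section neighbour_counts.
Context (R : realType) (d : nat).
Notation unit_WX := (bool * 'rV[R]_d)%type.

Definition near_opp (r : R) (z z' : unit_WX) : bool :=
  (z'.1 == ~~ z.1) && (enorm (z'.2 - z.2) <= r).

(** Unit [e] is left out of the count in order to stay independent of it. *)
Definition opp_count N (t : N.-tuple unit_WX) (i e : 'I_N) (r : R) : nat :=
  #|[pred l | [&& l != i, l != e & near_opp r (tnth t i) (tnth t l)]]|.

Lemma measurable_bool_natr d0 (T : measurableType d0) (b : T -> bool) :
  measurable_fun setT b -> measurable_fun setT (fun x => (b x)%:R : R).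
Proof.
move=> mb; rewrite (_ : (fun _ => _) = (fun x => if b x then 1 else 0 : R)).
  exact: measurable_fun_ifT.
by apply/funext => x; case: (b x).
Qed.

Lemma measurable_near_opp d0 (T : measurableType d0) (r : R) (u v : T -> unit_WX) :
  measurable_fun setT u -> measurable_fun setT v ->
  measurable_fun setT (fun s => near_opp r (u s) (v s)).
Proof.
move=> mu mv; apply: measurable_and.
  have mu1 : measurable_fun setT (fun s => (u s).1) by exact: measurableT_comp mu.
  have mv1 : measurable_fun setT (fun s => (v s).1) by exact: measurableT_comp mv.
  rewrite (_ : (fun _ => _) = (fun s => ((u s).1 && ~~ (v s).1) ||
      (~~ (u s).1 && (v s).1))); last first.
    by apply/funext => s; case: (u s).1; case: (v s).1.
  by apply: measurable_or; apply: measurable_and => //; apply: measurable_neg.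
apply: measurable_fun_ler => //; apply: measurable_fun_enorm.
  exact: measurableT_comp mv.
exact: measurableT_comp mu.
Qed.

Lemma opp_countE N (t : N.-tuple unit_WX) (i e : 'I_N) (r : R) :
  (opp_count t i e r)%:R = \sum_(l <- [seq l <- enum 'I_N | (l != i) && (l != e)])
    (near_opp r (tnth t i) (tnth t l))%:R :> R.
Proof.
rewrite /opp_count -sum1_card natr_sum big_filter big_enum_cond/=.
rewrite big_mkcond [RHS]big_mkcond/=; apply: eq_bigr => l _.
by rewrite !inE; case: (l != i) => //; case: (l != e) => //=; case: near_opp.
Qed.

Section tail.
Context d0 (Om : measurableType d0).
Variables (P : probability Om R) (Q : probability unit_WX R) (N : nat).
Variable V : 'I_N -> Om -> unit_WX.
Hypothesis V_iid : iid_sample P Q V.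
Variables (XX : set 'rV[R]_d) (c1 D0 : R).
Hypothesis mass : forall w x r, XX x -> 0 <= r <= D0 ->
  ((c1 * r ^+ d)%:E <= Q [set z | z.1 = w /\ (enorm (z.2 - x) <= r)%R])%E.
Hypothesis c10 : 0 < c1.
Let smp := sample V.

Lemma measurable_opp_count (i e : 'I_N) (r : R) :
  measurable_fun [set: N.-tuple unit_WX] (fun t => (opp_count t i e r)%:R : R).
Proof.
rewrite (_ : (fun _ => _) = (fun t => \sum_(l <- [seq l <- enum 'I_N | (l != i) && (l != e)])
    (near_opp r (tnth t i) (tnth t l))%:R)).
  apply: measurable_sum => l; apply: measurable_bool_natr.
  by apply: measurable_near_opp; exact: measurable_tnth.
by apply/funext => t; rewrite opp_countE.
Qed.

Lemma measurable_few_opp (i e : 'I_N) (r : R) (k : nat) :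
  measurable_fun [set: N.-tuple unit_WX] (fun t => (opp_count t i e r < k)%N%:R : R).
Proof.
rewrite (_ : (fun _ => _) = (fun t => ((opp_count t i e r)%:R < k%:R :> R)%R%:R)).
  apply: measurable_bool_natr; apply: measurable_fun_ltr => //.
  exact: measurable_opp_count.
by apply/funext => t; rewrite ltr_nat.
Qed.

Lemma measurable_near_set w x (r : R) :
  measurable [set z : unit_WX | z.1 = w /\ (enorm (z.2 - x) <= r)%R].
Proof.
rewrite (_ : [set _ | _] = [set w] `*` eball x r).
  by apply: measurableX => //; exact: measurable_eball.
by apply/seteqP; split=> -[a b] /= [].
Qed.

(** Chernoff's bound, with the exponential moment of parameter [-1]: each of the
    at least [N - 2] points that are free lands in the ball with probability at
    least [c1 * r ^+ d]. *)
Lemma few_neighbours_le (i e : 'I_N) (Phi : unit_WX -> unit_WX -> R) (r : R) (k : nat) :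
  measurable_fun setT (fun p : unit_WX * unit_WX => Phi p.1 p.2) ->
  (forall z z', 0 <= Phi z z') -> (forall z z', Phi z z' != 0 -> XX z.2) ->
  0 <= r <= D0 -> (0 < k)%N ->
  (\int[P]_s (Phi (tnth (smp s) i) (tnth (smp s) e) *
      (opp_count (smp s) i e r < k)%N%:R)%:E
   <= (expR (2 * k%:R - N%:R * (c1 * r ^+ d) / 2))%:E *
      \int[P]_s (Phi (tnth (smp s) i) (tnth (smp s) e))%:E)%E.
Proof.
move=> mPhi Phi0 PhiXX rD k0; set p := c1 * r ^+ d.
have p0 : 0 <= p by case/andP: rD => r0 _; rewrite mulr_ge0 ?exprn_ge0// ltW.
pose L := [seq l <- enum 'I_N | (l != i) && (l != e)].
have uL : uniq L by rewrite filter_uniq ?enum_uniq.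
have iL : i \notin L by rewrite mem_filter eqxx.
have eL : e \notin L by rewrite mem_filter eqxx andbF.
have szL : (N <= size L + 2)%N.
  rewrite /L size_filter -[leqLHS]size_enum_ord.
  rewrite -(count_predC (fun l => (l != i) && (l != e)) (enum 'I_N)) leq_add2l.
  rewrite -size_filter; apply: (@leq_trans (size [:: i; e])) => //.
  apply: uniq_leq_size; first by rewrite filter_uniq ?enum_uniq.
  by move=> l; rewrite mem_filter !inE /= negb_and !negbK => /andP[].
pose phi (z z' : unit_WX) : R := expR (- (near_opp r z z')%:R).
have mphi : measurable_fun setT (fun p : unit_WX * unit_WX => phi p.1 p.2).
  apply: measurableT_comp; first exact: measurable_expR.
  apply: measurable_funN; apply: measurable_bool_natr.
  by apply: measurable_near_opp.
have hb z z' : Phi z z' != 0 -> (\int[Q]_y (phi z y)%:E <= (expR (- p / 2))%:E)%E.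
  move=> /PhiXX XXz.
  pose S := [set y : unit_WX | y.1 = ~~ z.1 /\ (enorm (y.2 - z.2) <= r)%R].
  have mS : measurable S by exact: measurable_near_set.
  (* the exponential moment of one unit is 1 - p / 2 at most *)
  have e2 : (expR (-1) : R) <= 2^-1.
    rewrite expRN lef_pV2 ?posrE ?expR_gt0//.
    by have := @expR_ge1Dx R 1; lra.
  apply: (@le_trans _ _ (\int[Q]_y ((\1_(~` S) y)%:E + (2^-1 * \1_S y)%:E))%E).
    apply: ge0_le_integral => //.
    - by move=> y _; rewrite lee_fin expR_ge0.
    - by apply/measurable_EFinP; exact: (measurable_fun_pair2 _ mphi).
    - apply: emeasurable_funD; apply/measurable_EFinP.
        exact/measurable_indic/measurableC.
      by apply: measurable_funM => //; exact: measurable_indic.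
    move=> y _; rewrite -EFinD lee_fin /phi !indicE in_setC.
    have -> : near_opp r z y = (y \in S).
      apply/idP/idP => [/andP[/eqP y1 y2]|/set_mem[y1 y2]].
        by rewrite inE.
      by rewrite /near_opp y1 eqxx.
    by case: (y \in S) => /=; rewrite ?oppr0 ?expR0; move: e2; lra.
  have m1 : measurable_fun setT (fun y => (\1_(~` S) y)%:E : \bar R).
    exact/measurable_EFinP/measurable_indic/measurableC.
  have m2 : measurable_fun setT (fun y => (2^-1 * \1_S y)%:E : \bar R).
    by apply/measurable_EFinP/measurable_funM => //; exact: measurable_indic.
  rewrite ge0_integralD//.
  under [X in (_ + X)%E]eq_integral do rewrite EFinM.
  rewrite ge0_integralZl_EFin//; last exact/measurable_EFinP/measurable_indic.
  rewrite !integral_indic//; last exact: measurableC.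
  rewrite !setIT [X in (X + _)%E](_ : _ = 1 - Q S)%E; last first.
    exact: probability_setC.
  have pS : (p%:E <= Q S)%E by exact: mass.
  have finS : Q S \is a fin_num by exact: fin_num_measure.
  change (1 - Q S + (2^-1)%:E * Q S <= (expR (- p / 2))%:E)%E.
  move: (Q S) pS finS => [q| |]// pq _.
  rewrite -EFinB -EFinM -EFinD lee_fin; rewrite lee_fin in pq.
  apply: le_trans (expR_ge1Dx _); move: pq; lra.
have p1 : (exists z, XX z) -> p <= 1.
  move=> [x XXx]; rewrite -lee_fin.
  apply: (le_trans (mass true XXx rD)); apply: probability_le1.
  exact: measurable_near_set.
have [p1'|pN] := pselect (exists z, XX z); last first.
  have Phi00 z z' : Phi z z' = 0.
    by apply/eqP; apply/negPn/negP => /PhiXX XXz; apply: pN; exists z.2.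
  rewrite integral0_eq => [|s _]; last by rewrite Phi00 mul0r.
  by apply: mule_ge0; rewrite ?lee_fin ?expR_ge0//; apply: integral_ge0 => s _; rewrite lee_fin.
pose Pr (t : N.-tuple unit_WX) := Phi (tnth t i) (tnth t e) *
  \prod_(l <- L) phi (tnth t i) (tnth t l).
have mPr : measurable_fun setT Pr.
  apply: measurable_funM; first exact: measurable_pair_of.
  by apply: measurable_prod => m _; exact: measurable_pair_of.
have Pr0 t : 0 <= Pr t.
  by rewrite mulr_ge0// prodr_ge0// => l _; exact: expR_ge0.
apply: (@le_trans _ _ (\int[P]_s ((expR k%:R)%:E * (Pr (smp s))%:E))%E).
  apply: ge0_le_integral => //.
  - by move=> s _; rewrite lee_fin mulr_ge0.
  - apply: (measurable_sample_comp V_iid (F := fun t => (Phi (tnth t i) (tnth t e) *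
      (opp_count t i e r < k)%N%:R)%:E)).
    apply/measurable_EFinP/measurable_funM; first exact: measurable_pair_of.
    exact: measurable_few_opp.
  - apply: (measurable_sample_comp V_iid
      (F := fun t => ((expR k%:R)%:E * (Pr t)%:E)%E)).
    by apply: emeasurable_funM => //; exact/measurable_EFinP.
  move=> s _; rewrite -EFinM lee_fin /Pr mulrCA ler_wpM2l//.
  rewrite /phi -expR_sum -expRD sumrN -opp_countE.
  case: ltnP => [ck|_]; last exact: expR_ge0.
  rewrite -[X in X <= _]expR0 ler_expR subr_ge0 ler_nat; exact: ltnW.
have mPrs : measurable_fun setT (fun s => (Pr (smp s))%:E).
  by apply: (measurable_sample_comp V_iid (F := EFin \o Pr)); exact/measurable_EFinP.
rewrite ge0_integralZl_EFin ?expR_ge0//; last by move=> s _; rewrite lee_fin.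
have b0 : 0 <= expR (- p / 2) :> R by exact: expR_ge0.
have IPhi : (0 <= \int[P]_s (Phi (tnth (smp s) i) (tnth (smp s) e))%:E)%E.
  by apply: integral_ge0 => s _; rewrite lee_fin.
have /= H := expectation_prod_le V_iid mPhi mphi Phi0
  (fun z z' => expR_ge0 _) b0 hb uL iL eL.
apply: (le_trans (lee_wpmul2l _ H)); first by rewrite lee_fin expR_ge0.
rewrite muleA lee_wpmul2r// -EFinM lee_fin -expRM_natl -expRD ler_expR.
have pk : p <= k%:R by rewrite (le_trans (p1 p1'))// ler1n.
have szp : N%:R * p <= ((size L)%:R + 2) * p.
  by rewrite ler_wpM2r// -natrD ler_nat.
by move: szp; rewrite -[_ *+ _]mulr_natl; lra.
Qed.

End tail.
End neighbour_counts.

(** * Exponential moments of the matching distance *)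
Section exponential_moment.
Context (R : realType) (d : nat).
Notation unit_WX := (bool * 'rV[R]_d)%type.
Hypothesis d0 : (0 < d)%N.

Lemma root_powK (x : R) : 0 <= x -> (x `^ d%:R^-1) ^+ d = x.
Proof.
move=> x0; rewrite -powR_mulrn ?powR_ge0// -powRrM mulVf ?powRr1//.
by rewrite pnatr_eq0 -lt0n.
Qed.

Variables (N k : nat) (c1 D0 : R).
Hypotheses (N0 : (0 < N)%N) (k0 : (0 < k)%N) (c10 : 0 < c1).

(** The natural scale of the distance to the [k]-th neighbour. *)
Definition scale : R := (k%:R / N%:R) `^ d%:R^-1.

Definition shell (s : nat) : R := scale * (s%:R `^ d%:R^-1).

Definition decay : R := c1 / 8.

Lemma scale_gt0 : 0 < scale.
Proof. by rewrite powR_gt0// divr_gt0// ltr0n. Qed.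

Lemma scaleXd : scale ^+ d = k%:R / N%:R.
Proof. by rewrite root_powK// divr_ge0. Qed.

Lemma shell_ge0 s : 0 <= shell s.
Proof. by rewrite mulr_ge0 ?powR_ge0 ?ltW// scale_gt0. Qed.

Lemma shellXd s : shell s ^+ d = k%:R / N%:R * s%:R.
Proof. by rewrite exprMn scaleXd root_powK. Qed.

(** This weight dominates the exponential of [decay * (dist / scale) ^+ d] at
    every one of the [k] nearest neighbours of [i], without depending on the
    unit [e]. *)
Definition spread_weight (T : nat) (t : N.-tuple unit_WX) (i e : 'I_N) : R :=
  1 + \sum_(s < T) (shell s <= D0)%R%:R *
    (expR (decay * s.+1%:R) * (opp_count t i e (shell s) < k)%N%:R).

Definition spread_bound : R := 1 + expR (decay + 2) / (1 - expR (- decay)).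

Lemma decay_gt0 : 0 < decay. Proof. by rewrite divr_gt0. Qed.

Lemma spread_weight_ge1 T t i e : 1 <= spread_weight T t i e.
Proof.
rewrite /spread_weight lerDl; apply: sumr_ge0 => s _.
by rewrite !mulr_ge0// expR_ge0.
Qed.

Lemma spread_weight_ge0 T t i e : 0 <= spread_weight T t i e.
Proof. exact: le_trans ler01 (spread_weight_ge1 T t i e). Qed.

Lemma spread_bound_gt0 : 0 < spread_bound.
Proof.
rewrite /spread_bound ltr_pwDl// divr_ge0 ?expR_ge0// subr_ge0 expR_le1.
by rewrite oppr_le0 ltW// decay_gt0.
Qed.

Lemma measurable_spread_weight T (i e : 'I_N) :
  measurable_fun [set: N.-tuple unit_WX] (fun t => spread_weight T t i e).
Proof.
apply: measurable_funD => //; apply: measurable_sum => s.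
apply: measurable_funM => //; apply: measurable_funM => //.
exact: measurable_few_opp.
Qed.

Lemma exists_shell (y : R) : 0 < y -> exists s : nat, s%:R < y <= s.+1%:R.
Proof.
move=> y0; have [n] : exists n : nat, y <= n%:R.
  by exists (Num.truncn y).+1; rewrite ltW// real_truncnS_gt ?num_real.
elim: n => [|n IH yn]; first by rewrite leNgt y0.
by have [/IH//|ny] := leP y n%:R; exists n; rewrite ny.
Qed.

(** If [j] lies in shell [s], then fewer than [k] units are closer than the inner radius of
    that shell, and the term of index [s] of the weight is already large enough. *)
Lemma knn_le_spread_weight T (t : N.-tuple unit_WX) (i e j : 'I_N) :
  N%:R / k%:R * D0 ^+ d <= T%:R ->
  knn (fun l => (tnth t l).1) (fun l => (tnth t l).2) k i j ->
  enorm ((tnth t j).2 - (tnth t i).2) <= D0 ->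
  expR (decay * (enorm ((tnth t j).2 - (tnth t i).2) / scale) ^+ d)
    <= spread_weight T t i e.
Proof.
move=> TD kij; set v := enorm _ => vD; set y := (v / scale) ^+ d.
have v0 : 0 <= v by exact: enorm_ge0.
have y0 : 0 <= y by rewrite exprn_ge0// divr_ge0// ltW// scale_gt0.
have := y0; rewrite le_eqVlt => /orP[/eqP <-|yp].
  by rewrite mulr0 expR0 spread_weight_ge1.
have [s /andP[sy ys]] := exists_shell yp.
have vE : v ^+ d = k%:R / N%:R * y.
  by rewrite -scaleXd -exprMn mulrC divfK// gt_eqF// scale_gt0.
have kN0 : 0 < k%:R / N%:R :> R by rewrite divr_gt0// ltr0n.
have sv : shell s < v.
  rewrite -(@ltr_pXn2r _ d)// ?nnegrE ?shell_ge0// shellXd vE.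
  by rewrite ltr_pM2l.
have sT : (s < T)%N.
  rewrite -(ltr_nat R) (lt_le_trans sy)// (le_trans _ TD)//.
  rewrite -(@ler_pM2l _ (k%:R / N%:R))// -vE mulrA mulf_div mulrC.
  rewrite [_ * N%:R]mulrC divff ?mulr1; last by rewrite mulf_neq0// pnatr_eq0 -lt0n.
  by rewrite lerXn2r// nnegrE// (le_trans v0).
rewrite /spread_weight (bigD1 (Ordinal sT))//= addrCA.
rewrite (ltW (lt_le_trans sv vD)) mul1r.
have -> : (opp_count t i e (shell s) < k)%N.
  apply: leq_ltn_trans (knn_farther kij sv).
  apply: subset_leq_card; apply/fintype.subsetP => l; rewrite !inE.
  by case/and3P.
rewrite mulr1 ler_wpDr//.
  by rewrite addr_ge0// sumr_ge0// => m _; rewrite !mulr_ge0// expR_ge0.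
by rewrite ler_expR ler_pM2l// decay_gt0.
Qed.

Context dO (Om : measurableType dO).
Variables (P : probability Om R) (Q : probability unit_WX R).
Variable V : 'I_N -> Om -> unit_WX.
Hypothesis V_iid : iid_sample P Q V.
Variables (XX : set 'rV[R]_d).
Hypothesis mass : forall w x r, XX x -> 0 <= r <= D0 ->
  ((c1 * r ^+ d)%:E <= Q [set z | z.1 = w /\ (enorm (z.2 - x) <= r)%R])%E.
Let smp := sample V.

(** Shell [s] weighs [expR (decay * s.+1)], while the probability that it holds fewer than
    [k] units is at most [expR (2 - 2 * decay * s)]: the series is geometric. *)
Lemma spread_weight_mean (T : nat) (i e : 'I_N) (Phi : unit_WX -> unit_WX -> R) :
  measurable_fun setT (fun p : unit_WX * unit_WX => Phi p.1 p.2) ->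
  (forall z z', 0 <= Phi z z') -> (forall z z', Phi z z' != 0 -> XX z.2) ->
  (\int[P]_s (Phi (tnth (smp s) i) (tnth (smp s) e) * spread_weight T (smp s) i e)%:E
   <= spread_bound%:E * \int[P]_s (Phi (tnth (smp s) i) (tnth (smp s) e))%:E)%E.
Proof.
move=> mPhi Phi0 PhiXX.
pose F (t : N.-tuple unit_WX) := Phi (tnth t i) (tnth t e).
have mF : measurable_fun setT F by exact: measurable_pair_of.
have F0 t : 0 <= F t by exact: Phi0.
have mFs : measurable_fun setT (fun s => (F (smp s))%:E).
  by apply: (measurable_sample_comp V_iid (F := EFin \o F)); exact/measurable_EFinP.
pose G (s : nat) (t : N.-tuple unit_WX) := F t * (opp_count t i e (shell s) < k)%N%:R.
have G0 s t : 0 <= G s t by rewrite mulr_ge0.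
have mG s : measurable_fun setT (G s).
  by apply: measurable_funM => //; exact: measurable_few_opp.
have mGs s : measurable_fun setT (fun o => (G s (smp o))%:E).
  by apply: (measurable_sample_comp V_iid (F := EFin \o G s)); exact/measurable_EFinP.
set I := (\int[P]_s (Phi _ _)%:E)%E.
have I0 : (0 <= I)%E by apply: integral_ge0 => s _; rewrite lee_fin.
have IG s : (\int[P]_o (G s (smp o))%:E <= I)%E.
  apply: ge0_le_integral => //.
  - by move=> o _; rewrite lee_fin.
  by move=> o _; rewrite lee_fin /G ler_piMr//; case: (_ < _)%N.
have Gle s : shell s <= D0 ->
    (\int[P]_o (G s (smp o))%:E <= (expR (2 - 2 * decay * s%:R))%:E * I)%E.
  (* Chernoff's exponent [k * (2 - c1 * s / 2)] is negative only for large [s]; for small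
     [s] the right-hand side exceeds 1 anyway *)
  move=> sD; have [s8|s8] := leP (c1 * s%:R) 8.
    apply: le_trans (IG s) _; rewrite -[leLHS]mul1e lee_wpmul2r// lee_fin.
    by rewrite -[leLHS]expR0 ler_expR /decay; lra.
  have sD' : 0 <= shell s <= D0 by rewrite shell_ge0.
  apply: le_trans (few_neighbours_le V_iid mass c10 i e mPhi Phi0 PhiXX sD' k0) _.
  rewrite lee_wpmul2r// lee_fin ler_expR shellXd.
  have -> : N%:R * (c1 * (k%:R / N%:R * s%:R)) / 2 = k%:R * (c1 * s%:R / 2).
    by field; rewrite pnatr_eq0 -lt0n.
  have -> : 2 - 2 * decay * s%:R = 2 - c1 * s%:R / 4 by rewrite /decay; field.
  have k1 : 1 <= k%:R :> R by rewrite ler1n.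
  move: s8; set y := c1 * s%:R => s8; nra.
have FwE t : F t * spread_weight T t i e = F t + \sum_(s < T)
    (shell s <= D0)%R%:R * expR (decay * s.+1%:R) * G s t.
  rewrite /spread_weight mulrDr mulr1 mulr_sumr; congr (_ + _).
  by apply: eq_bigr => s _; rewrite /G; ring.
rewrite (_ : integral _ _ _ = I + \sum_(s < T)
    ((shell s <= D0)%R%:R * expR (decay * s.+1%:R))%:E *
      \int[P]_o (G s (smp o))%:E)%E; last first.
  transitivity (\int[P]_o ((F (smp o))%:E + \sum_(s < T)
    (((shell s <= D0)%R%:R * expR (decay * s.+1%:R)) * G s (smp o))%:E))%E.
    by apply: eq_integral => o _; rewrite -[LHS]/((F (smp o) * _)%:E) FwE EFinD sumEFin.
  have w0 s : 0 <= (shell s <= D0)%R%:R * expR (decay * s.+1%:R).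
    by rewrite mulr_ge0// expR_ge0.
  have mw s : measurable_fun setT (fun o =>
      (((shell s <= D0)%R%:R * expR (decay * s.+1%:R)) * G s (smp o))%:E).
    apply/measurable_EFinP/measurable_funM => //.
    by apply/measurable_EFinP; exact: mGs.
  rewrite ge0_integralD//; last 2 first.
  - by move=> o _; rewrite sumEFin lee_fin sumr_ge0// => s _; rewrite mulr_ge0.
  - by apply: emeasurable_sum => s.
  congr (_ + _)%E; rewrite ge0_integral_sum//; last first.
    by move=> s o _; rewrite lee_fin mulr_ge0.
  apply: eq_bigr => s _; under eq_integral do rewrite EFinM.
  by rewrite ge0_integralZl_EFin// => o _; rewrite lee_fin.
  by move=> o _; rewrite lee_fin.
rewrite /spread_bound EFinD ge0_muleDl ?lee_fin//; last first.
  rewrite divr_ge0 ?expR_ge0// subr_ge0 expR_le1.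
  by rewrite oppr_le0 ltW// decay_gt0.
rewrite mul1e leeD2l//.
have ed : expR (- decay) < 1 by rewrite expR_lt1 oppr_lt0 decay_gt0.
apply: (@le_trans _ _ (\sum_(s < T) (expR (decay + 2) * expR (- decay) ^+ s)%:E * I)%E).
  apply: lee_sum => s _; have [sD|sD] := boolP (shell s <= D0); last first.
    by rewrite mul0r mul0e mule_ge0// lee_fin mulr_ge0// ?exprn_ge0 ?expR_ge0.
  rewrite mul1r; apply: (le_trans (lee_wpmul2l _ (Gle s sD))).
    by rewrite lee_fin expR_ge0.
  rewrite muleA lee_wpmul2r// -EFinM lee_fin -expRM_natl -!expRD ler_expR.
  by rewrite -natr1; lra.
rewrite -ge0_sume_distrl; last first.
  by move=> s _; rewrite lee_fin mulr_ge0// ?exprn_ge0 ?expR_ge0.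
rewrite lee_wpmul2r// sumEFin lee_fin -mulr_sumr ler_wpM2l ?expR_ge0//.
by apply: geometric_sum_le => //; exact: expR_ge0.
Qed.

End exponential_moment.

(** * Symmetrized increments of the regression functions *)
Section symmetrization.
Context (R : realType) (d : nat).
Notation unit_WX := (bool * 'rV[R]_d)%type.
Variables (XX : set 'rV[R]_d) (f g : bool -> 'rV[R]_d -> R).
Variables (D0 lo hi Kg K2 Kf : R).
Hypotheses (mXX : measurable XX) (XXC : ~` XX !=set0).
Hypotheses (mf : forall w, measurable_fun setT (f w)).
Hypotheses (f0 : forall w x, 0 <= f w x).
Hypotheses (mg : forall w, measurable_fun setT (g w)).
Hypothesis diam : forall x y, XX x -> XX y -> enorm (x - y) <= D0.
Hypotheses (lo0 : 0 < lo) (Kg0 : 0 <= Kg) (K20 : 0 <= K2) (Kf0 : 0 <= Kf).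
Hypothesis f_bounds : forall w x, XX x -> lo <= f w x <= hi.
Hypothesis g_lip : forall w x y, XX x -> XX y -> `|g w x - g w y| <= Kg * enorm (x - y).
Hypothesis f_lip : forall w x y, XX x -> XX y -> `|f w x - f w y| <= Kf * enorm (x - y).
Hypothesis g_second : forall w x v, XX x -> XX (x + v) -> XX (x - v) ->
  `|g w (x + v) + g w (x - v) - 2 * g w x| <= K2 * enorm v ^+ 2.

Definition bdist (x : 'rV[R]_d) : R := dist_to x (~` XX).

Definition interior_pair (z z' : unit_WX) : bool :=
  enorm (z'.2 - z.2) < bdist z.2.

Definition both_in (z z' : unit_WX) : R := \1_XX z.2 * \1_XX z'.2.

Definition diffg (z z' : unit_WX) : R :=
  both_in z z' * (g z'.1 z.2 - g z'.1 z'.2).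

Definition symg (z z' : unit_WX) : R :=
  both_in z z' * (if interior_pair z z' then
    let y' := reflect_at z.2 z'.2 in
    ((g z'.1 z.2 - g z'.1 z'.2) * f z'.1 z'.2 +
     (g z'.1 z.2 - g z'.1 y') * f z'.1 y') / (2 * f z'.1 z'.2)
  else g z'.1 z.2 - g z'.1 z'.2).

Lemma both_inP z z' : (both_in z z' = 0) \/ (both_in z z' = 1 /\ XX z.2 /\ XX z'.2).
Proof.
rewrite /both_in !indicE.
have [/set_mem x1|_] := boolP (z.2 \in XX); last by left; rewrite mul0r.
have [/set_mem x2|_] := boolP (z'.2 \in XX); last by left; rewrite mulr0.
by right; rewrite mulr1.
Qed.

Lemma reflect_sub (x y : 'rV[R]_d) : reflect_at x y - x = x - y.
Proof. by rewrite /reflect_at addrAC addrK. Qed.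

Lemma interior_in z z' : interior_pair z z' ->
  XX z'.2 /\ XX (reflect_at z.2 z'.2).
Proof.
rewrite /interior_pair => zz'; split; apply: (@lt_dist_to R d z.2).
  by rewrite enormB.
by rewrite enormB reflect_sub enormB.
Qed.

Lemma diffg_le z z' :
  `|diffg z z'| <= both_in z z' * (Kg * enorm (z'.2 - z.2)).
Proof.
rewrite /diffg; have [->|[-> [x1 x2]]] := both_inP z z'.
  by rewrite !mul0r normr0.
by rewrite !mul1r enormB g_lip.
Qed.

Definition Ksym : R := Num.max Kg ((Kg * Kf + hi * K2 / 2) / lo).

Lemma Ksym_ge0 : 0 <= Ksym. Proof. by rewrite le_max Kg0. Qed.

(** With [v = y - x], the numerator is a product of a first difference of [g] and a first
    difference of [f], plus [f] times a second difference of [g]; each is of order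
    [enorm v ^+ 2]. *)
Lemma symg_le z z' :
  `|symg z z'| <= both_in z z' * (Ksym *
    (if interior_pair z z' then enorm (z'.2 - z.2) ^+ 2 else enorm (z'.2 - z.2))).
Proof.
rewrite /symg; have [->|[-> [x1 x2]]] := both_inP z z'.
  by rewrite !mul0r normr0.
rewrite !mul1r; case: ifPn => [zz'|_]; last first.
  rewrite enormB (le_trans (g_lip _ x1 x2))// ler_wpM2r ?enorm_ge0//.
  by rewrite le_max lexx.
have [_ x3] := interior_in zz'; move: x3.
set x := z.2 in x1 zz' *; set y := z'.2 in x2 zz' *; set w := z'.1.
set y' := reflect_at x y => x3; set v := y - x.
have yE : y = x + v by rewrite /v addrC subrK.
have y'E : y' = x - v by rewrite /y' /reflect_at /v opprB addrA.
have fy : 0 < f w y by apply: lt_le_trans lo0 _; case/andP: (f_bounds w x2).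
rewrite (_ : _ / _ = ((g w x - g w y) * (f w y - f w y') -
    f w y' * (g w y + g w y' - 2 * g w x)) / (2 * f w y)); last first.
  by congr (_ / _); ring.
have ev : enorm (x - y) = enorm v by rewrite enormB.
have h1 : `|(g w x - g w y) * (f w y - f w y')| <= Kg * Kf * 2 * enorm v ^+ 2.
  have -> : Kg * Kf * 2 * enorm v ^+ 2 = (Kg * enorm v) * (Kf * (2 * enorm v)) by ring.
  rewrite normrM ler_pM// -ev; first exact: g_lip.
  rewrite (le_trans (f_lip w x2 x3))// ler_wpM2l//.
  rewrite ev yE y'E opprB addrC addrA subrK -mulr2n -scaler_nat enormZ.
  by rewrite ger0_norm.
have h2 : `|f w y' * (g w y + g w y' - 2 * g w x)| <= hi * (K2 * enorm v ^+ 2).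
  rewrite normrM ger0_norm// ler_pM//; first by case/andP: (f_bounds w x3).
  by rewrite yE y'E g_second// -?yE -?y'E.
rewrite normrM normfV (ger0_norm (mulr_ge0 _ (ltW fy)))//.
rewrite ler_pdivrMr ?mulr_gt0//.
apply: (@le_trans _ _ ((Kg * Kf * 2 + hi * K2) * enorm v ^+ 2)).
  by rewrite (le_trans (ler_normB _ _))// [leRHS]mulrDl lerD// -mulrA.
rewrite [leRHS]mulrAC ler_wpM2r ?exprn_ge0 ?enorm_ge0//.
apply: (@le_trans _ _ ((Kg * Kf + hi * K2 / 2) / lo * (2 * lo))).
  by rewrite le_eqVlt; apply/orP; left; apply/eqP; field; rewrite gt_eqF.
rewrite ler_pM//.
- have hi0 : 0 <= hi.
    by case/andP: (f_bounds w x2) => a b; apply: le_trans b; apply: le_trans a; exact: ltW.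
  rewrite divr_ge0 ?addr_ge0 ?mulr_ge0 ?invr_ge0// ltW//.
- by rewrite mulr_ge0// ltW.
- by rewrite le_max lexx orbT.
- by rewrite ler_pM2l//; case/andP: (f_bounds w x2).
Qed.

Lemma diffg_bounded z z' : `|diffg z z'| <= Kg * `|D0|.
Proof.
apply: le_trans (diffg_le z z') _; have [->|[-> [x1 x2]]] := both_inP z z'.
  by rewrite mul0r mulr_ge0.
by rewrite mul1r ler_wpM2l// (le_trans (diam x2 x1))// ler_norm.
Qed.

Lemma symg_bounded z z' : `|symg z z'| <= Ksym * (`|D0| ^+ 2 + `|D0|).
Proof.
apply: le_trans (symg_le z z') _; have [->|[-> [x1 x2]]] := both_inP z z'.
  by rewrite mul0r mulr_ge0 ?Ksym_ge0// addr_ge0// exprn_ge0.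
have vD : enorm (z'.2 - z.2) <= `|D0| by rewrite (le_trans (diam x2 x1))// ler_norm.
rewrite mul1r ler_wpM2l ?Ksym_ge0//; case: ifP => _; last by rewrite ler_wpDl// exprn_ge0.
by rewrite ler_wpDr// lerXn2r// nnegrE enorm_ge0.
Qed.

Section measurability.
Context dT (T : measurableType dT) (u v : T -> unit_WX).
Hypotheses (mu : measurable_fun setT u) (mv : measurable_fun setT v).

Let mu1 : measurable_fun setT (fun s => (u s).1).
Proof. exact: measurableT_comp mu. Qed.
Let mu2 : measurable_fun setT (fun s => (u s).2).
Proof. exact: measurableT_comp mu. Qed.
Let mv1 : measurable_fun setT (fun s => (v s).1).
Proof. exact: measurableT_comp mv. Qed.
Let mv2 : measurable_fun setT (fun s => (v s).2).
Proof. exact: measurableT_comp mv. Qed.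

Lemma measurable_by_arm (b : T -> bool) (h : bool -> 'rV[R]_d -> R) (y : T -> 'rV[R]_d) :
  measurable_fun setT b -> (forall w, measurable_fun setT (h w)) ->
  measurable_fun setT y -> measurable_fun setT (fun s => h (b s) (y s)).
Proof.
move=> mb mh my; rewrite (_ : (fun _ => _) =
    (fun s => if b s then h true (y s) else h false (y s))).
  by apply: measurable_fun_ifT => //; apply: measurableT_comp.
by apply/funext => s; case: (b s).
Qed.

Lemma measurable_both_in : measurable_fun setT (fun s => both_in (u s) (v s)).
Proof.
by apply: measurable_funM; apply: measurableT_comp => //; exact: measurable_indic.
Qed.

Lemma measurable_bdist : measurable_fun setT (fun s => bdist (u s).2).
Proof. by apply: measurableT_comp mu2; exact: measurable_dist_to. Qed.

Lemma measurable_interior_pair :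
  measurable_fun setT (fun s => interior_pair (u s) (v s)).
Proof.
apply: measurable_fun_ltr; last exact: measurable_bdist.
exact: measurable_fun_enorm.
Qed.

Lemma measurable_diffg : measurable_fun setT (fun s => diffg (u s) (v s)).
Proof.
apply: measurable_funM; first exact: measurable_both_in.
by apply: measurable_funB; exact: measurable_by_arm.
Qed.

Lemma measurable_reflect : measurable_fun setT (fun s => reflect_at (u s).2 (v s).2).
Proof.
apply: measurable_fun_rVP => i; rewrite (_ : _ \o _ =
    fun s => coord_rV i (u s).2 + coord_rV i (u s).2 - coord_rV i (v s).2).
  apply: measurable_funB.
    by apply: measurable_funD; apply: measurableT_comp mu2; exact: measurable_coord_rV.
  by apply: measurableT_comp mv2; exact: measurable_coord_rV.
by apply/funext => s; rewrite /= /coord_rV /reflect_at !mxE.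
Qed.

Lemma measurable_symg : measurable_fun setT (fun s => symg (u s) (v s)).
Proof.
apply: measurable_funM; first exact: measurable_both_in.
have m1 : measurable_fun setT (fun s => g (v s).1 (u s).2) by exact: measurable_by_arm.
have m2 : measurable_fun setT (fun s => g (v s).1 (v s).2) by exact: measurable_by_arm.
have m3 : measurable_fun setT (fun s => f (v s).1 (v s).2) by exact: measurable_by_arm.
have m4 : measurable_fun setT (fun s => g (v s).1 (reflect_at (u s).2 (v s).2)).
  by apply: measurable_by_arm => //; exact: measurable_reflect.
have m5 : measurable_fun setT (fun s => f (v s).1 (reflect_at (u s).2 (v s).2)).
  by apply: measurable_by_arm => //; exact: measurable_reflect.
apply: measurable_fun_ifT; first exact: measurable_interior_pair.
  apply: measurable_funM; first apply: measurable_funD.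
  - by apply: measurable_funM => //; exact: measurable_funB.
  - by apply: measurable_funM => //; exact: measurable_funB.
  - rewrite (_ : (fun _ => _) = (@powR R ^~ (-1)) \o (fun s => 2 * f (v s).1 (v s).2)).
      apply: measurableT_comp; first exact: measurable_powR.
      exact: measurable_funM.
    by apply/funext => s /=; rewrite powR_inv1// mulr_ge0.
by apply: measurable_funB.
Qed.

End measurability.
End symmetrization.

Section symmetrized_expectation.
Context (R : realType) (d : nat).
Notation unit_WX := (bool * 'rV[R]_d)%type.
Let la := @lebesgue_rV R d.

Lemma integral_reflect (x : 'rV[R]_d) (h : 'rV[R]_d -> \bar R) :
  measurable_fun setT h -> (forall y, 0 <= h y)%E ->
  (\int[la]_y h (reflect_at x y) = \int[la]_y h y)%E.
Proof.
move=> mh h0; transitivity (\int[pushforward la (reflect_at x)]_y h y)%E.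
  rewrite ge0_integral_pushforward//; exact: measurable_reflect_at.
apply: eq_measure_integral => [|mx A mA _]; first exact: measurable_reflect_at.
exact: lebesgue_rV_reflect.
Qed.

Variables (XX : set 'rV[R]_d) (f g : bool -> 'rV[R]_d -> R).
Variables (lo : R) (mXX : measurable XX) (XXC : ~` XX !=set0).
Hypotheses (mf : forall w, measurable_fun setT (f w)).
Hypotheses (f0 : forall w x, 0 <= f w x).
Hypotheses (mg : forall w, measurable_fun setT (g w)).
Hypotheses (lo0 : 0 < lo).
Hypothesis f_lower : forall w x, XX x -> lo <= f w x.

Context d0 (Om : measurableType d0).
Variables (P : probability Om R) (Q : probability unit_WX R) (N : nat).
Variable V : 'I_N -> Om -> unit_WX.
Hypothesis V_iid : iid_sample P Q V.
Variable pr : bool -> R.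
Hypothesis pr0 : forall w, 0 <= pr w.
Hypothesis disint : forall psi : unit_WX -> \bar R,
  measurable_fun setT psi -> (forall z, 0 <= psi z)%E ->
  (\int[Q]_z psi z = \sum_(w : bool) (pr w)%:E *
     \int[la]_y (psi (w, y) * (f w y)%:E))%E.
Let smp := sample V.

Definition reflect_unit (z z' : unit_WX) : unit_WX := (z'.1, reflect_at z.2 z'.2).

(** The part of the increment that the symmetrization removes. *)
Definition asymg z z' := diffg XX g z z' - symg XX f g z z'.

Lemma asymg_odd z w y : asymg z (w, reflect_at z.2 y) * f w (reflect_at z.2 y) =
  - (asymg z (w, y) * f w y).
Proof.
rewrite /asymg /diffg /symg /both_in.
have rK : reflect_at z.2 (reflect_at z.2 y) = y by exact: reflect_atK.
have ipE : interior_pair XX z (w, reflect_at z.2 y) = interior_pair XX z (w, y).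
  by rewrite /interior_pair/= reflect_sub enormB.
rewrite ipE /= rK; case: ifPn => [ip|_]; last by rewrite !subrr !mul0r oppr0.
have [/= y1 y2] := interior_in ip.
have fy : 0 < f w y by apply: lt_le_trans lo0 (f_lower _ _).
have fy' : 0 < f w (reflect_at z.2 y) by apply: lt_le_trans lo0 (f_lower _ _).
rewrite !indicE (mem_set y1) (mem_set y2).
by field; rewrite !gt_eqF.
Qed.

Lemma asymg_eq0 z z' : ~~ interior_pair XX z z' -> asymg z z' = 0.
Proof. by rewrite /asymg /diffg /symg => /negbTE ->; rewrite subrr. Qed.

Lemma updK (j : 'I_N) z z' (t : N.-tuple unit_WX) : upd j z (upd j z' t) = upd j z t.
Proof. by apply: eq_from_tnth => l; rewrite !tnth_upd; case: eqP. Qed.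

Lemma bounded_integrable (h : Om -> R) (M : R) : measurable_fun setT h ->
  (forall s, `|h s| <= M) -> P.-integrable setT (EFin \o h).
Proof.
move=> mh hM; apply: measurable_bounded_integrable => //.
  by apply: (le_lt_trans (probability_le1 P measurableT)); exact: ltry.
exists M; split; first exact: num_real.
by move=> M' MM' s _; apply: le_trans (hM s) _; exact: ltW.
Qed.

(** On the ball of radius [bdist X_i] around [X_i], the difference of the two increments is
    odd under the reflection about [X_i] once multiplied by the density of [X_j]; it
    vanishes outside.  Hence it integrates to zero against a weight that is blind to the
    reflection. *)
Lemma expectation_symg (i j : 'I_N) (H : N.-tuple unit_WX -> R) (CH Cd Cs : R) :
  i != j -> measurable_fun setT H -> (forall t, `|H t| <= CH) ->
  (forall z z', `|diffg XX g z z'| <= Cd) -> (forall z z', `|symg XX f g z z'| <= Cs) ->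
  (forall t, interior_pair XX (tnth t i) (tnth t j) ->
     H (upd j (reflect_unit (tnth t i) (tnth t j)) t) = H t) ->
  (\int[P]_s (H (smp s) * diffg XX g (tnth (smp s) i) (tnth (smp s) j))%:E =
   \int[P]_s (H (smp s) * symg XX f g (tnth (smp s) i) (tnth (smp s) j))%:E)%E.
Proof.
move=> ij mH HC dC sC Hinv.
pose D (t : N.-tuple unit_WX) := diffg XX g (tnth t i) (tnth t j).
pose S (t : N.-tuple unit_WX) := symg XX f g (tnth t i) (tnth t j).
have mD : measurable_fun setT D by apply: measurable_diffg => //; exact: measurable_tnth.
have mS : measurable_fun setT S.
  by apply: (measurable_symg mXX XXC mf f0 mg) => //; exact: measurable_tnth.
pose F (t : N.-tuple unit_WX) := H t * asymg (tnth t i) (tnth t j).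
have mF : measurable_fun setT F.
  by apply: measurable_funM => //; exact: measurable_funB.
have msmp := measurable_sample V_iid.
have mFE : measurable_fun setT (fun t => (F t)%:E) by exact/measurable_EFinP.
have Fpn t : (\int[Q]_z ((fun t => (F t)%:E)^\+ (upd j z t)) =
              \int[Q]_z ((fun t => (F t)%:E)^\- (upd j z t)))%E.
  set zi := tnth t i.
  have mFu w : measurable_fun setT (fun y => F (upd j (w, y) t)).
    apply: (measurableT_comp mF).
    rewrite (_ : (fun _ => _) = (fun p => upd j p.1 p.2) \o (fun y => ((w, y), t)))//.
    apply: measurableT_comp; first exact: measurable_upd.
    by apply: measurable_fun_pair => //; exact: measurable_fun_pair.
  have mupd : measurable_fun setT (fun z => upd j z t).
    rewrite (_ : (fun _ => _) = (fun p => upd j p.1 p.2) \o (fun z => (z, t)))//.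
    apply: measurableT_comp; first exact: measurable_upd.
    exact: measurable_fun_pair.
  have mFp : measurable_fun setT (fun z => (fun t => (F t)%:E)^\+%E (upd j z t)).
    exact: measurableT_comp (measurable_funepos mFE) mupd.
  have mFn : measurable_fun setT (fun z => (fun t => (F t)%:E)^\-%E (upd j z t)).
    exact: measurableT_comp (measurable_funeneg mFE) mupd.
  rewrite (disint mFp (fun z => funepos_ge0 _ _)) (disint mFn (fun z => funeneg_ge0 _ _)).
  apply: eq_bigr => w _; congr (_ * _)%E.
  pose phi y := F (upd j (w, y) t) * f w y.
  have mphi : measurable_fun setT phi by exact: measurable_funM.
  have phi_odd y : phi (reflect_at zi.2 y) = - phi y.
    rewrite /phi /F !tnth_upd (negbTE ij) eqxx -/zi.
    have [ip|nip] := boolP (interior_pair XX zi (w, y)); last first.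
      have nip' : ~~ interior_pair XX zi (w, reflect_at zi.2 y).
        by move: nip; rewrite /interior_pair/= reflect_sub enormB.
      by rewrite !asymg_eq0// !mulr0 !mul0r oppr0.
    rewrite -mulrA asymg_odd mulrN -mulrA; congr (- (_ * _)).
    have := Hinv (upd j (w, y) t); rewrite !tnth_upd (negbTE ij) eqxx updK.
    exact.
  transitivity (\int[la]_y (fun y => (phi y)%:E)^\+ y)%E.
    apply: eq_integral => y _; rewrite !funeposE -[X in (_ = maxe _ X)%E](mul0e (f w y)%:E).
    by rewrite /phi EFinM maxe_pMl ?lee_fin.
  have mphiE : measurable_fun setT (fun y => (phi y)%:E) by exact/measurable_EFinP.
  rewrite -(integral_reflect zi.2 (measurable_funepos mphiE))//.
  apply: eq_integral => y _; rewrite funeposE funenegE phi_odd.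
  rewrite -[X in (maxe _ X = _)%E](mul0e (f w y)%:E).
  by rewrite /phi EFinN EFinM -mulNe maxe_pMl ?lee_fin.
have FB t : `|F t| <= CH * (Cd + Cs).
  rewrite normrM ler_pM// /asymg (le_trans (ler_normB _ _))// lerD//.
have iF : P.-integrable setT (EFin \o (F \o smp)).
  by apply: bounded_integrable (fun s => FB (smp s)); exact: measurableT_comp.
have F0 : (\int[P]_s (F (smp s))%:E = 0)%E.
  have r1 := resample V_iid j (measurable_funepos mFE) (fun t => funepos_ge0 _ t).
  have r2 := resample V_iid j (measurable_funeneg mFE) (fun t => funeneg_ge0 _ t).
  have pn : (\int[P]_s (fun s => (F (smp s))%:E)^\+ s =
      \int[P]_s (fun s => (F (smp s))%:E)^\- s)%E.
    transitivity (\int[P]_s (fun t => (F t)%:E)^\+ (smp s))%E.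
      by apply: eq_integral => s _; rewrite !funeposE.
    transitivity (\int[P]_s (fun t => (F t)%:E)^\- (smp s))%E.
      by rewrite r1 r2; apply: eq_integral => s _; exact: Fpn.
    by apply: eq_integral => s _; rewrite !funenegE.
  by rewrite integralE pn subee//; exact: (integrable_neg_fin_num _ iF).
have iD : P.-integrable setT (EFin \o (fun s => H (smp s) * D (smp s))).
  apply: (@bounded_integrable _ (CH * Cd)).
    by apply: measurable_funM; apply: measurableT_comp.
  by move=> s; rewrite normrM; apply: ler_pM; rewrite // ?dC ?sC.
have iS : P.-integrable setT (EFin \o (fun s => H (smp s) * S (smp s))).
  apply: (@bounded_integrable _ (CH * Cs)).
    by apply: measurable_funM; apply: measurableT_comp.
  by move=> s; rewrite normrM; apply: ler_pM; rewrite // ?dC ?sC.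
have : (\int[P]_s (F (smp s))%:E = \int[P]_s (H (smp s) * D (smp s))%:E -
    \int[P]_s (H (smp s) * S (smp s))%:E)%E.
  rewrite -integralB_EFin//; apply: eq_integral => s _.
  by rewrite -EFinB -mulrBr.
rewrite F0 => /esym/eqP; rewrite sube_eq ?add0e; first by move=> /eqP.
- exact: (integrable_fin_num _ iD).
- by rewrite fin_num_adde_defl//; exact: (integrable_fin_num _ iS).
Qed.

End symmetrized_expectation.

(** * Pairs of matches *)
Section quadruples.
Context (R : realType) (d N k : nat).
Notation unit_WX := (bool * 'rV[R]_d)%type.
Notation sample_WX := (N.-tuple unit_WX).
Implicit Types (t : sample_WX) (i j : 'I_N).

Definition arm_of t : 'I_N -> bool := fun i => (tnth t i).1.
Definition pos_of t : 'I_N -> 'rV[R]_d := fun i => (tnth t i).2.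

Definition dist_of t i j : R := enorm (pos_of t j - pos_of t i).

Definition enough t : bool :=
  (k <= minn (arm_size (arm_of t) false) (arm_size (arm_of t) true))%N.

Definition matched t i j : bool := enough t && knn (arm_of t) (pos_of t) k i j.

(** The balls centred at the two matched units and reaching their neighbours are disjoint. *)
Definition apart t i i' j j' : bool :=
  dist_of t i j + dist_of t i' j' < dist_of t i i'.

Lemma dist_of_sym t i j : dist_of t i j = dist_of t j i.
Proof. by rewrite /dist_of enormB. Qed.

Lemma dist_of_ge0 t i j : 0 <= dist_of t i j.
Proof. exact: enorm_ge0. Qed.

Lemma dist_of_triangle t l i j : dist_of t i j <= dist_of t i l + dist_of t l j.
Proof. by rewrite addrC /dist_of enorm_triangle. Qed.

Lemma apart_sym t i i' j j' : apart t i i' j j' = apart t i' i j' j.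
Proof. by rewrite /apart addrC (dist_of_sym t i i'). Qed.

Lemma dist_ofii t i : dist_of t i i = 0.
Proof. by rewrite /dist_of subrr enorm0. Qed.

Lemma apart_neq t i i' j j' : apart t i i' j j' -> [/\ j != i', j' != i & j != j'].
Proof.
rewrite /apart => a; split; apply/eqP => E; move: a; rewrite E ltNge.
- by rewrite lerDl dist_of_ge0.
- by rewrite (dist_of_sym t i') lerDr dist_of_ge0.
- by rewrite (dist_of_sym t i') dist_of_triangle.
Qed.

Lemma matched_neq t i j : matched t i j -> j != i.
Proof.
move=> /andP[_ /andP[+ _]]; apply: contraTneq => ->.
by case: (arm_of t i).
Qed.

Lemma eq_knn (W W' : 'I_N -> bool) (X X' : 'I_N -> 'rV[R]_d) i j :
  W =1 W' -> (forall l, closer X (X i) l j = closer X' (X' i) l j) ->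
  knn W X k i j = knn W' X' k i j.
Proof.
move=> WW cc; rewrite /knn !WW; congr (_ && (_ < _)%N).
by apply: eq_card => l; rewrite !inE WW cc.
Qed.

Section reflection.
Variables (t : sample_WX) (i i' j j' : 'I_N).
Hypotheses (ji : j != i) (ji' : j != i') (jj' : j != j').
Let t' := upd j (reflect_unit (tnth t i) (tnth t j)) t.

Lemma arm_reflected l : arm_of t' l = arm_of t l.
Proof. by rewrite /arm_of tnth_upd; case: eqP => [->|]. Qed.

Let pos_reflected l : l != j -> pos_of t' l = pos_of t l.
Proof. by move=> /negbTE lj; rewrite /pos_of tnth_upd lj. Qed.

Let posj_reflected : pos_of t' j = reflect_at (pos_of t i) (pos_of t j).
Proof. by rewrite /pos_of tnth_upd eqxx. Qed.

Lemma dist_reflected l : dist_of t' i l = dist_of t i l.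
Proof.
rewrite /dist_of (pos_reflected (l := i)); last by rewrite eq_sym.
have [->|lj] := eqVneq l j; last by rewrite pos_reflected.
by rewrite posj_reflected reflect_sub enormB.
Qed.

Lemma dist_away l l' : l != j -> l' != j -> dist_of t' l l' = dist_of t l l'.
Proof. by move=> lj lj'; rewrite /dist_of !pos_reflected. Qed.

Lemma enough_reflected : enough t' = enough t.
Proof.
have E w : arm_size (arm_of t') w = arm_size (arm_of t) w.
  by apply: eq_card => l; rewrite !inE arm_reflected.
by rewrite /enough !E.
Qed.

Lemma apart_reflected : apart t' i i' j j' = apart t i i' j j'.
Proof.
rewrite /apart !dist_reflected dist_away// eq_sym//.
Qed.

Lemma matched_reflected : matched t' i j = matched t i j.
Proof.
rewrite /matched enough_reflected; congr (_ && _); apply: eq_knn => [|l]; first exact: arm_reflected.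
by rewrite /closer -!/(dist_of _ _ _) !dist_reflected.
Qed.

Lemma apart_farther s : apart s i i' j j' -> dist_of s i' j' < dist_of s i' j.
Proof.
rewrite /apart => a; have := dist_of_triangle s j i i'.
by rewrite (dist_of_sym s j i'); move: a; lra.
Qed.

(** Whether [j'] is a neighbour of [i'] depends on [X j] only through its comparison with
    [j'], and [j] is the farther one before and after the reflection. *)
Lemma matched_other_reflected : apart t i i' j j' -> matched t' i' j' = matched t i' j'.
Proof.
move=> a; have a' : apart t' i i' j j' by rewrite apart_reflected.
rewrite /matched enough_reflected; congr (_ && _); apply: eq_knn => [|l]; first exact: arm_reflected.
rewrite /closer -!/(dist_of _ _ _).
have [->|lj] := eqVneq l j.
  by rewrite leNgt (apart_farther a')/= leNgt (apart_farther a).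
by rewrite !dist_away// eq_sym.
Qed.

Definition coupled s : bool :=
  [&& apart s i i' j j', matched s i j & matched s i' j'].

Lemma coupled_reflected : coupled t' = coupled t.
Proof.
rewrite /coupled apart_reflected matched_reflected.
by have [a|//] := boolP (apart t i i' j j'); rewrite matched_other_reflected.
Qed.

End reflection.

Lemma coupled_sym t i i' j j' : coupled i i' j j' t = coupled i' i j' j t.
Proof. by rewrite /coupled apart_sym; congr (_ && _); exact: andbC. Qed.

Definition arm_sign t i : R := 2 * (arm_of t i)%:R - 1.

Lemma normr_arm_sign t i : `|arm_sign t i| = 1.
Proof.
rewrite /arm_sign; case: (arm_of t i) => /=.
  by rewrite (_ : _ - _ = 1) ?normr1//; lra.
by rewrite (_ : _ - _ = -1) ?normrN1//; lra.
Qed.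

Lemma measurable_arm_of i : measurable_fun [set: sample_WX] (fun t => arm_of t i).
Proof. by apply: measurableT_comp => //; exact: measurable_tnth. Qed.

Lemma measurable_pos_of i : measurable_fun [set: sample_WX] (fun t => pos_of t i).
Proof. by apply: measurableT_comp => //; exact: measurable_tnth. Qed.

Lemma measurable_dist_of i j : measurable_fun [set: sample_WX] (fun t => dist_of t i j).
Proof. by apply: measurable_fun_enorm; exact: measurable_pos_of. Qed.

Lemma measurable_apart i i' j j' :
  measurable_fun [set: sample_WX] (fun t => apart t i i' j j').
Proof.
apply: measurable_fun_ltr; last exact: measurable_dist_of.
by apply: measurable_funD; exact: measurable_dist_of.
Qed.

Lemma measurable_card (p : sample_WX -> pred 'I_N) :
  (forall l, measurable_fun [set: sample_WX] (fun t => p t l)) ->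
  measurable_fun [set: sample_WX] (fun t => #|p t|%:R : R).
Proof.
move=> mp; rewrite (_ : (fun _ => _) = (fun t => \sum_(l < N) (p t l)%:R)).
  by apply: measurable_sum => l; exact: measurable_bool_natr.
apply/funext => t; rewrite -sum1_card natr_sum big_mkcond/=.
by apply: eq_bigr => l _; rewrite unfold_in; case: (p t l).
Qed.

Lemma measurable_arm_eq i (b : sample_WX -> bool) :
  measurable_fun setT b -> measurable_fun setT (fun t => arm_of t i == b t).
Proof.
move=> mb; rewrite (_ : (fun _ => _) = (fun t => (arm_of t i && b t) ||
   (~~ arm_of t i && ~~ b t))).
  by apply: measurable_or; apply: measurable_and => //; try apply: measurable_neg => //;
    exact: measurable_arm_of.
by apply/funext => t; case: (arm_of t i); case: (b t).
Qed.

Lemma measurable_enough : measurable_fun [set: sample_WX] enough.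
Proof.
have mE w : measurable_fun [set: sample_WX] (fun t => k%:R <= (arm_size (arm_of t) w)%:R :> R).
  apply: measurable_fun_ler => //; apply: measurable_card => l.
  by apply: measurable_arm_eq.
rewrite (_ : enough = fun t => (k%:R <= (arm_size (arm_of t) false)%:R :> R)
   && (k%:R <= (arm_size (arm_of t) true)%:R :> R)).
  exact: measurable_and.
by apply/funext => t; rewrite /enough leq_min !ler_nat.
Qed.

Lemma measurable_matched i j : measurable_fun [set: sample_WX] (fun t => matched t i j).
Proof.
apply: measurable_and; first exact: measurable_enough.
have mW : measurable_fun [set: sample_WX] (fun t => ~~ arm_of t i).
  by apply: measurable_neg; exact: measurable_arm_of.
apply: measurable_and; first exact: measurable_arm_eq.
rewrite (_ : (fun _ => _) = (fun t =>
   (rank_below (arm_of t) (pos_of t) (~~ arm_of t i) (pos_of t i) j)%:R < k%:R :> R)).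
  apply: measurable_fun_ltr => //; apply: measurable_card => l.
  apply: measurable_and; first exact: measurable_arm_eq.
  apply: measurable_and; first by apply: measurable_fun_ler; exact: measurable_dist_of.
  rewrite (_ : (fun _ => _) = (fun t => ~~ (dist_of t i j <= dist_of t i l) || (l < j)%N)).
    apply: measurable_or => //; apply: measurable_neg.
    by apply: measurable_fun_ler; exact: measurable_dist_of.
  by apply/funext => t; rewrite implybE.
by apply/funext => t; rewrite ltr_nat.
Qed.

Lemma measurable_coupled i i' j j' : measurable_fun [set: sample_WX] (coupled i i' j j').
Proof.
apply: measurable_and; first exact: measurable_apart.
by apply: measurable_and; exact: measurable_matched.
Qed.

Lemma measurable_arm_sign i : measurable_fun [set: sample_WX] (fun t => arm_sign t i).
Proof.
apply: measurable_funB => //; apply: measurable_funM => //.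
by apply: measurable_bool_natr; exact: measurable_arm_of.
Qed.

End quadruples.

(** * The second moment of the bias *)
Section nonneg_real_integrals.
Context dT (T : measurableType dT) (R : realType) (mu : {measure set T -> \bar R}).
Implicit Types h : T -> R.

Lemma integral_realD h1 h2 : measurable_fun setT h1 -> measurable_fun setT h2 ->
  (forall x, 0 <= h1 x) -> (forall x, 0 <= h2 x) ->
  (\int[mu]_x (h1 x + h2 x)%:E = \int[mu]_x (h1 x)%:E + \int[mu]_x (h2 x)%:E)%E.
Proof.
move=> m1 m2 p1 p2; under eq_integral do rewrite EFinD.
rewrite (ge0_integralD mu measurableT (f1 := EFin \o h1) (f2 := EFin \o h2))//.
- by move=> x _; rewrite lee_fin.
- exact/measurable_EFinP.
- by move=> x _; rewrite lee_fin.
- exact/measurable_EFinP.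
Qed.

Lemma integral_realZ (c : R) h : measurable_fun setT h -> (forall x, 0 <= h x) ->
  0 <= c -> (\int[mu]_x (c * h x)%:E = c%:E * \int[mu]_x (h x)%:E)%E.
Proof.
move=> mh p c0; under eq_integral do rewrite EFinM.
rewrite (ge0_integralZl_EFin mu measurableT (f1 := EFin \o h))//.
- by move=> x _; rewrite lee_fin.
- exact/measurable_EFinP.
Qed.

Lemma integral_real_sum (I : finType) (h : I -> T -> R) :
  (forall i, measurable_fun setT (h i)) -> (forall i x, 0 <= h i x) ->
  (\int[mu]_x (\sum_i h i x)%:E = \sum_i \int[mu]_x (h i x)%:E)%E.
Proof.
move=> mh p; under eq_integral do rewrite -sumEFin.
rewrite (ge0_integral_sum mu measurableT (f := fun i => EFin \o h i))//.
- by move=> i; exact/measurable_EFinP.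
- by move=> i x _; rewrite lee_fin.
Qed.

Lemma integral_real_le h1 h2 : measurable_fun setT h1 -> measurable_fun setT h2 ->
  (forall x, 0 <= h1 x) -> (forall x, h1 x <= h2 x) ->
  (\int[mu]_x (h1 x)%:E <= \int[mu]_x (h2 x)%:E)%E.
Proof.
move=> m1 m2 p1 h12; apply: ge0_le_integral => //.
- by move=> x _; rewrite lee_fin.
- exact/measurable_EFinP.
- exact/measurable_EFinP.
- by move=> x _; rewrite lee_fin.
Qed.

End nonneg_real_integrals.

Lemma integral_probability_cst dT (T : measurableType dT) (R : realType)
  (mu : probability T R) (c : \bar R) : (\int[mu]_x c = c)%E.
Proof.
rewrite integral_cst//; transitivity (c * 1)%E; last by rewrite mule1.
by congr (_ * _)%E; exact: probability_setT.
Qed.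

Section second_moment.
Context (R : realType) (d : nat).
Notation unit_WX := (bool * 'rV[R]_d)%type.
Notation la := (@lebesgue_rV R d).
Variables (XX : set 'rV[R]_d) (f g : bool -> 'rV[R]_d -> R).
Variables (D0 lo hi Kg K2 Kf c1 c2 M8 : R).

(** The properties of the support, of the arm densities [f] and of the regression functions
    [g] that enter the bound, with explicit constants. *)
Record regular_design : Prop := RegularDesign {
  rd_dim : (0 < d)%N;
  rd_closed : measurable XX;
  rd_proper : ~` XX !=set0;
  rd_diam : forall x y, XX x -> XX y -> enorm (x - y) <= D0;
  rd_lo : 0 < lo;
  rd_Kg : 0 <= Kg;
  rd_K2 : 0 <= K2;
  rd_Kf : 0 <= Kf;
  rd_c1 : 0 < c1;
  rd_c2 : 0 <= c2;
  rd_M8 : 0 <= M8;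
  rd_mf : forall w, measurable_fun setT (f w);
  rd_f0 : forall w x, 0 <= f w x;
  rd_mg : forall w, measurable_fun setT (g w);
  rd_f_bounds : forall w x, XX x -> lo <= f w x <= hi;
  rd_g_lip : forall w x y, XX x -> XX y -> `|g w x - g w y| <= Kg * enorm (x - y);
  rd_f_lip : forall w x y, XX x -> XX y -> `|f w x - f w y| <= Kf * enorm (x - y);
  rd_g_second : forall w x v, XX x -> XX (x + v) -> XX (x - v) ->
    `|g w (x + v) + g w (x - v) - 2 * g w x| <= K2 * enorm v ^+ 2 }.

Hypothesis rd : regular_design.

Context d0 (Om : measurableType d0).
Variables (P : probability Om R) (Q : probability unit_WX R) (N k : nat).
Variable V : 'I_N -> Om -> unit_WX.
Variable pr : bool -> R.

(** The law [Q] of a pair (arm, covariate), with arm probabilities [pr], and an independent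
    sample [V] of it.  The last three fields are what is needed about [Q] and distances:
    balls around points of the support have mass of order [r ^+ d], and the mass near the
    boundary is small. *)
Record sampling : Prop := Sampling {
  sp_iid : iid_sample P Q V;
  sp_pr : forall w, 0 <= pr w;
  sp_disint : forall psi : unit_WX -> \bar R,
    measurable_fun setT psi -> (forall z, 0 <= psi z)%E ->
    (\int[Q]_z psi z = \sum_(w : bool) (pr w)%:E *
      \int[la]_y (psi (w, y) * (f w y)%:E))%E;
  sp_mass_ge : forall w x r, XX x -> 0 <= r <= D0 ->
    ((c1 * r ^+ d)%:E <= Q [set z | z.1 = w /\ (enorm (z.2 - x) <= r)%R])%E;
  sp_mass_le : forall x r, 0 <= r ->
    (Q [set z | XX z.2 /\ (enorm (z.2 - x) <= r)%R] <= (c2 * r ^+ d)%:E)%E;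
  sp_boundary : forall L, 0 < L ->
    (\int[Q]_z (\1_XX z.2 * expR (- L * bdist XX z.2 ^+ d))%:E
      <= (M8 * L^-1 `^ d%:R^-1)%:E)%E }.

Hypothesis sp : sampling.
Hypotheses (k0 : (0 < k)%N) (kN : (k <= N)%N).
Notation sample_WX := (N.-tuple unit_WX).
Let smp := sample V.
Let N0 : (0 < N)%N := leq_trans k0 kN.
Notation rho := (scale R d N k).

Definition increment (t : sample_WX) i j := diffg XX g (tnth t i) (tnth t j).
Definition sym_increment (t : sample_WX) i j := symg XX f g (tnth t i) (tnth t j).

(** The factor of the product of two increments that a reflection leaves unchanged. *)
Definition coupled_sign i i' j j' (t : sample_WX) : R :=
  (coupled k i i' j j' t)%:R * (arm_sign t i * arm_sign t i').

Lemma measurable_increment i j :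
  measurable_fun [set: sample_WX] (fun t => increment t i j).
Proof.
apply: measurable_diffg; [exact: rd_closed rd|exact: rd_mg rd|..];
  exact: measurable_tnth.
Qed.

Lemma measurable_sym_increment i j :
  measurable_fun [set: sample_WX] (fun t => sym_increment t i j).
Proof.
apply: measurable_symg; [exact: rd_closed rd|exact: rd_proper rd|exact: rd_mf rd|
  exact: rd_f0 rd|exact: rd_mg rd|..]; exact: measurable_tnth.
Qed.

Lemma measurable_coupled_sign i i' j j' :
  measurable_fun [set: sample_WX] (coupled_sign i i' j j').
Proof.
apply: measurable_funM.
  by apply: measurable_bool_natr; exact: measurable_coupled.
by apply: measurable_funM; exact: measurable_arm_sign.
Qed.

Lemma coupled_sign_le1 i i' j j' t : `|coupled_sign i i' j j' t| <= 1.
Proof.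
by rewrite !normrM !normr_arm_sign !mulr1; case: coupled; rewrite ?normr1 ?normr0 ?ler01.
Qed.

Lemma coupled_neq i i' j j' (t : sample_WX) : coupled k i i' j j' t ->
  [/\ j != i, j != i', j != j', j' != i' & j' != i].
Proof.
move=> /and3P[/apart_neq[h1 h2 h3] /matched_neq h4 /matched_neq h5].
by split.
Qed.

Lemma increment_bounded t i j : `|increment t i j| <= Kg * `|D0|.
Proof. exact: diffg_bounded (rd_diam rd) (rd_Kg rd) (rd_g_lip rd) _ _. Qed.

Lemma sym_increment_bounded t i j :
  `|sym_increment t i j| <= Ksym lo hi Kg K2 Kf * (`|D0| ^+ 2 + `|D0|).
Proof.
exact: symg_bounded (rd_f0 rd) (rd_diam rd) (rd_lo rd) (rd_Kg rd) (rd_K2 rd) (rd_Kf rd)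
  (rd_f_bounds rd) (rd_g_lip rd) (rd_f_lip rd) (rd_g_second rd) _ _.
Qed.

Lemma coupled_sign_reflected i i' j j' t : j != i -> j != i' -> j != j' ->
  coupled_sign i i' j j' (upd j (reflect_unit (tnth t i) (tnth t j)) t) =
  coupled_sign i i' j j' t.
Proof.
move=> ji ji' jj'; rewrite /coupled_sign coupled_reflected//.
by rewrite /arm_sign !arm_reflected.
Qed.

Lemma coupled_sign_sym i i' j j' t :
  coupled_sign i i' j j' t = coupled_sign i' i j' j t.
Proof. by rewrite /coupled_sign coupled_sym [arm_sign t i * _]mulrC. Qed.

(** Both increments are symmetrized in turn.  Reflecting [X j] about [X i] leaves the other
    increment alone since the four units are distinct, and then the roles are exchanged. *)
Lemma expectation_coupled i i' j j' :
  (\int[P]_s (coupled_sign i i' j j' (smp s) * increment (smp s) i j *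
      increment (smp s) i' j')%:E =
   \int[P]_s (coupled_sign i i' j j' (smp s) * sym_increment (smp s) i j *
      sym_increment (smp s) i' j')%:E)%E.
Proof.
have [/and5P[ji ji' jj' nji' nji]|] :=
  boolP [&& j != i, j != i', j != j', j' != i' & j' != i]; last first.
  move=> nd; apply: eq_integral => s _; rewrite /coupled_sign.
  have -> : coupled k i i' j j' (smp s) = false.
    by apply/negP => /coupled_neq[h1 h2 h3 h4 h5]; move: nd; rewrite h1 h2 h3 h4 h5.
  by rewrite !mul0r.
pose lower w x (XXx : XX x) : lo <= f w x := proj1 (andP (rd_f_bounds rd w XXx)).
have ES := expectation_symg (rd_closed rd) (rd_proper rd)
  (rd_mf rd) (rd_f0 rd) (rd_mg rd) (rd_lo rd) lower (sp_iid sp) (sp_disint sp).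
have dC z z' := diffg_bounded (rd_diam rd) (rd_Kg rd) (rd_g_lip rd) z z'.
have sC z z' := symg_bounded (rd_f0 rd) (rd_diam rd) (rd_lo rd) (rd_Kg rd) (rd_K2 rd) (rd_Kf rd)
  (rd_f_bounds rd) (rd_g_lip rd) (rd_f_lip rd) (rd_g_second rd) z z'.
have bound (a b B : R) : `|a| <= 1 -> `|b| <= B -> `|a * b| <= B.
  by move=> a1 bB; rewrite normrM -[leRHS]mul1r ler_pM.
transitivity (\int[P]_s ((coupled_sign i i' j j' (smp s) * increment (smp s) i' j') *
    increment (smp s) i j)%:E)%E.
  by apply: eq_integral => s _; rewrite mulrAC.
have step1 := ES i j (fun t => coupled_sign i i' j j' t * increment t i' j') _ _ _ _ _
  (fun t => bound _ _ _ (coupled_sign_le1 _ _ _ _ _) (increment_bounded _ _ _)) dC sC.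
have step2 := ES i' j' (fun t => coupled_sign i i' j j' t * sym_increment t i j) _ _ _ _ _
  (fun t => bound _ _ _ (coupled_sign_le1 _ _ _ _ _) (sym_increment_bounded _ _ _)) dC sC.
rewrite {}step1.
- rewrite (_ : integral _ _ _ = \int[P]_s ((coupled_sign i i' j j' (smp s) *
      sym_increment (smp s) i j) * increment (smp s) i' j')%:E)%E; last first.
    by apply: eq_integral => s _; rewrite mulrAC.
  apply: step2.
  + by rewrite eq_sym.
  + apply: measurable_funM; first exact: measurable_coupled_sign.
    exact: measurable_sym_increment.
  move=> t _; rewrite coupled_sign_sym coupled_sign_reflected// 1?eq_sym//.
  rewrite -coupled_sign_sym /sym_increment !tnth_upd.
  by rewrite [i == j']eq_sym (negbTE nji) (negbTE jj').
- by rewrite eq_sym.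
- apply: measurable_funM; first exact: measurable_coupled_sign.
  exact: measurable_increment.
move=> t _; rewrite coupled_sign_reflected// /increment !tnth_upd.
by rewrite [i' == j]eq_sym (negbTE ji') [j' == j]eq_sym (negbTE jj').
Qed.

Definition bias (t : sample_WX) : R :=
  N%:R^-1 * \sum_(i < N) arm_sign t i *
    (k%:R^-1 * \sum_(j < N) (matched k t i j)%:R * increment t i j).

Notation quad := (('I_N * 'I_N) * ('I_N * 'I_N))%type.

Definition signed_pair (q : quad) (t : sample_WX) : R :=
  (matched k t q.1.1 q.1.2)%:R * (matched k t q.2.1 q.2.2)%:R *
  (arm_sign t q.1.1 * arm_sign t q.2.1).

(** Overlapping and disjoint pairs of matches; the sum of the two is the full product. *)
Definition near_term (q : quad) t : R :=
  (~~ apart t q.1.1 q.2.1 q.1.2 q.2.2)%:R * signed_pair q t *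
  increment t q.1.1 q.1.2 * increment t q.2.1 q.2.2.

Definition far_term (q : quad) t : R :=
  coupled_sign q.1.1 q.2.1 q.1.2 q.2.2 t *
  increment t q.1.1 q.1.2 * increment t q.2.1 q.2.2.

Definition sym_far_term (q : quad) t : R :=
  coupled_sign q.1.1 q.2.1 q.1.2 q.2.2 t *
  sym_increment t q.1.1 q.1.2 * sym_increment t q.2.1 q.2.2.

Lemma bias_sqE t : bias t ^+ 2 =
  (N%:R * k%:R) ^- 2 * \sum_(q : quad) (near_term q t + far_term q t).
Proof.
pose b (p : 'I_N * 'I_N) := arm_sign t p.1 * ((matched k t p.1 p.2)%:R * increment t p.1 p.2).
have -> : bias t = (N%:R * k%:R)^-1 * \sum_p b p.
  rewrite /bias invfM -mulrA; congr (_ * _).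
  rewrite -(pair_bigA _ (fun i j => b (i, j)))/= mulr_sumr.
  by apply: eq_bigr => i _; rewrite mulrCA; congr (_ * _); rewrite mulr_sumr.
rewrite exprMn exprVn; congr (_ * _); rewrite expr2 big_distrlr/= pair_bigA/=.
apply: eq_bigr => q _; rewrite /b /near_term /far_term /coupled_sign /signed_pair /coupled.
case: (apart _ _ _ _ _); case: (matched _ _ _ _); case: (matched _ _ _ _) => /=; ring.
Qed.

Lemma measurable_near_term q : measurable_fun setT (near_term q).
Proof.
apply: measurable_funM; last exact: measurable_increment.
apply: measurable_funM; last exact: measurable_increment.
apply: measurable_funM.
  by apply: measurable_bool_natr; apply: measurable_neg; exact: measurable_apart.
apply: measurable_funM; last by apply: measurable_funM; exact: measurable_arm_sign.
by apply: measurable_funM; apply: measurable_bool_natr; exact: measurable_matched.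
Qed.

Lemma measurable_far_term q : measurable_fun setT (far_term q).
Proof.
apply: measurable_funM; last exact: measurable_increment.
by apply: measurable_funM; [exact: measurable_coupled_sign|exact: measurable_increment].
Qed.

Lemma measurable_sym_far_term q : measurable_fun setT (sym_far_term q).
Proof.
apply: measurable_funM; last exact: measurable_sym_increment.
by apply: measurable_funM; [exact: measurable_coupled_sign|exact: measurable_sym_increment].
Qed.

Lemma signed_pair_norm q t : `|signed_pair q t| =
  (matched k t q.1.1 q.1.2)%:R * (matched k t q.2.1 q.2.2)%:R.
Proof. by rewrite !normrM !normr_arm_sign !mulr1 !normr_nat. Qed.

Let sample_integrable (h : sample_WX -> R) (M : R) :
  measurable_fun setT h -> (forall t, `|h t| <= M) ->
  P.-integrable setT (EFin \o (h \o smp)).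
Proof.
move=> mh hM; apply: bounded_integrable (fun s => hM (smp s)).
by apply: measurableT_comp mh _; exact: measurable_sample (sp_iid sp).
Qed.

Let mul3_le (a b c B : R) : `|a| <= 1 -> `|b| <= B -> `|c| <= B -> `|a * b * c| <= B * B.
Proof.
move=> a1 bB cB; rewrite !normrM ler_pM ?mulr_ge0//.
by rewrite -[leRHS]mul1r ler_pM.
Qed.

Let nat_bool3 (a b c : bool) : a%:R * (b%:R * c%:R) <= 1 :> R.
Proof. by case: a; case: b; case: c; rewrite ?mulr1 ?mulr0 ?mul0r ?ler01. Qed.

Let near_bounded q t : `|near_term q t| <= (Kg * `|D0|) * (Kg * `|D0|).
Proof.
apply: mul3_le; [|exact: increment_bounded..].
by rewrite normrM signed_pair_norm normr_nat nat_bool3.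
Qed.

Let near_integrable q : P.-integrable setT (EFin \o (near_term q \o smp)).
Proof.
by apply: sample_integrable (near_bounded q); exact: measurable_near_term.
Qed.

Let far_integrable q : P.-integrable setT (EFin \o (far_term q \o smp)).
Proof.
apply: (@sample_integrable _ ((Kg * `|D0|) * (Kg * `|D0|))).
  exact: measurable_far_term.
move=> t; apply: mul3_le; [exact: coupled_sign_le1|exact: increment_bounded..].
Qed.

Let sym_far_integrable q : P.-integrable setT (EFin \o (sym_far_term q \o smp)).
Proof.
pose B := Ksym lo hi Kg K2 Kf * (`|D0| ^+ 2 + `|D0|).
apply: (@sample_integrable _ (B * B)); first exact: measurable_sym_far_term.
move=> t; apply: mul3_le; [exact: coupled_sign_le1|exact: sym_increment_bounded..].
Qed.

Definition sym_bias_sq t : R :=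
  (N%:R * k%:R) ^- 2 * \sum_(q : quad) (near_term q t + sym_far_term q t).

Lemma expectation_bias_sq :
  (\int[P]_s (bias (smp s) ^+ 2)%:E = \int[P]_s (sym_bias_sq (smp s))%:E)%E.
Proof.
have lin (h : quad -> sample_WX -> R) :
    (forall q, P.-integrable setT (EFin \o (h q \o smp))) ->
    (\int[P]_s ((N%:R * k%:R) ^- 2 *
       \sum_(q : quad) (near_term q (smp s) + h q (smp s)))%:E =
     ((N%:R * k%:R) ^- 2)%:E * \sum_(q : quad)
       (\int[P]_s (near_term q (smp s))%:E + \int[P]_s (h q (smp s))%:E))%E.
  move=> ih; under eq_integral do rewrite EFinM.
  have iq q : P.-integrable setT
      (fun s => (near_term q (smp s))%:E + (h q (smp s))%:E)%E.
    exact: integrableD (near_integrable q) (ih q).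
  rewrite integralZl//; last first.
    rewrite (_ : (fun _ => _) = (fun s => \sum_(q : quad)
      ((near_term q (smp s))%:E + (h q (smp s))%:E))%E).
      by apply: integrable_sum => // q _; exact: iq.
    by apply/funext => s; rewrite -sumEFin; apply: eq_bigr => q _; rewrite EFinD.
  congr (_ * _)%E.
  under eq_integral => s _.
    rewrite -sumEFin; under eq_bigr do rewrite EFinD. over.
  rewrite integral_sum//; apply: eq_bigr => q _.
  by rewrite integralD//; [exact: near_integrable|exact: ih].
under eq_integral do rewrite bias_sqE.
rewrite (lin far_term far_integrable) (lin sym_far_term sym_far_integrable).
congr (_ * _)%E; apply: eq_bigr => q _; congr (_ + _)%E.
exact: expectation_coupled.
Qed.

(** A constant that makes both [y] and [y ^+ 2] at most a multiple of [expR (b * y ^+ d)],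
    whatever the dimension. *)
Definition Kexp (b : R) : R := 1 + b^-1 + (2 / b) ^+ 2.

Lemma Kexp_ge0 b : 0 < b -> 0 <= Kexp b.
Proof. by move=> b0; rewrite !addr_ge0 ?invr_ge0 ?exprn_ge0 ?divr_ge0// ltW. Qed.

Lemma le_Kexp (b y : R) : 0 < b -> 0 <= y ->
  y <= Kexp b * expR (b * y ^+ d) /\ y ^+ 2 <= Kexp b * expR (b * y ^+ d).
Proof.
move=> b0 y0; set Y := y ^+ d.
have Y0 : 0 <= Y by rewrite exprn_ge0.
have e1 : 1 <= expR (b * Y) by rewrite -[leLHS]expR0 ler_expR mulr_ge0// ltW.
have K1 : 1 <= Kexp b.
  by rewrite /Kexp -addrA lerDl addr_ge0 ?invr_ge0 ?exprn_ge0 ?divr_ge0// ltW.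
have one : 1 <= Kexp b * expR (b * Y) by rewrite -[leLHS]mul1r ler_pM.
have [y1|/ltW y1] := leP y 1.
  split; first exact: le_trans one.
  by apply: le_trans one; rewrite expr2 mulr_ile1.
have yY : y <= Y by rewrite /Y -[leLHS]expr1; apply: ler_weXn2l => //; exact: (rd_dim rd).
have h1 : Y <= b^-1 * expR (b * Y).
  rewrite -(@ler_pM2l _ b)// mulrA divff ?gt_eqF// mul1r.
  by apply: le_trans (expR_ge1Dx _); rewrite lerDr.
have h2 : Y ^+ 2 <= (2 / b) ^+ 2 * expR (b * Y).
  have -> : expR (b * Y) = expR (b * Y / 2) ^+ 2.
    by rewrite -expRM_natl; congr expR; field.
  have b20 : 0 <= 2 / b by rewrite divr_ge0// ltW.
  have E0' : 0 <= 2 / b * expR (b * Y / 2) by rewrite mulr_ge0 ?expR_ge0.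
  rewrite -exprMn lerXn2r// ?nnegrE//.
  have b02 : 0 < b / 2 by rewrite divr_gt0.
  rewrite -(ler_pM2l b02) mulrA.
  rewrite (_ : b / 2 * (2 / b) = 1) ?mul1r; last by field; rewrite gt_eqF.
  by apply: le_trans (expR_ge1Dx _); rewrite mulrAC lerDr.
have E0 : 0 <= expR (b * Y) by exact: expR_ge0.
split.
  apply: (le_trans yY); apply: (le_trans h1); rewrite ler_wpM2r// /Kexp.
  by rewrite addrAC lerDr addr_ge0// exprn_ge0// divr_ge0// ltW.
apply: (@le_trans _ _ (Y ^+ 2)); first by rewrite lerXn2r ?nnegrE.
by apply: (le_trans h2); rewrite ler_wpM2r// /Kexp lerDr addr_ge0 ?invr_ge0// ltW.
Qed.

Notation a := (decay c1).
Let a0 : 0 < a. Proof. exact: decay_gt0 (rd_c1 rd). Qed.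
Let rho0 : 0 < rho. Proof. by apply: scale_gt0. Qed.

(** Enough shells to cover the support. *)
Definition shells : nat := (Num.truncn (N%:R / k%:R * D0 ^+ d)).+1.

Let shells_ge : N%:R / k%:R * D0 ^+ d <= shells%:R.
Proof. by rewrite ltW// real_truncnS_gt ?num_real. Qed.

(** Bounds on all neighbours of [i] at once, and blind to unit [e]. *)
Definition weight (t : sample_WX) i e : R := spread_weight k c1 D0 shells t i e.

(** The distance measured in shells: between [s] and [s + 1] in shell [s]. *)
Definition tau (t : sample_WX) i j : R := (dist_of t i j / rho) ^+ d.

Let weight_ge0 t i e : 0 <= weight t i e.
Proof. exact: spread_weight_ge0. Qed.

Lemma tau_le_weight t i e j : matched k t i j ->
  XX (pos_of t i) -> XX (pos_of t j) -> expR (a * tau t i j) <= weight t i e.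
Proof.
move=> /andP[_ kij] xi xj.
apply: knn_le_spread_weight; [exact: rd_dim rd|exact: N0|exact: k0|exact: rd_c1 rd|..] => //.
exact: rd_diam rd _ _ xj xi.
Qed.

(** The price of an overlap: the longer of two overlapping matches has length at least half
    the distance between the matched units, and the exponential of that length is paid out
    of the weight of the match. *)
Definition overlap_weight (z z' : unit_WX) : R :=
  both_in XX z z' * expR (- (a / 2 / 2 ^+ d) * (enorm (z'.2 - z.2) / rho) ^+ d).

(** The size of a symmetrized increment at a unit: [rho ^+ 2] in the interior, and an extra
    [rho] near the boundary only. *)
Definition edge_weight (z : unit_WX) : R :=
  \1_XX z.2 * (rho ^+ 2 + rho * expR (- (a / 4) * (bdist XX z.2 / rho) ^+ d)).

Let tau_ge0 t i j : 0 <= tau t i j.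
Proof. by rewrite exprn_ge0// divr_ge0 ?dist_of_ge0// ltW. Qed.

Let dist_rho (t : sample_WX) i j : dist_of t i j = rho * (dist_of t i j / rho).
Proof. by rewrite mulrC divfK// gt_eqF. Qed.

Let dist_sq_le b (t : sample_WX) i j : 0 < b ->
  dist_of t i j ^+ 2 <= Kexp b * rho ^+ 2 * expR (b * tau t i j).
Proof.
move=> b0; rewrite {1}dist_rho exprMn (_ : Kexp b * _ * _ =
  rho ^+ 2 * (Kexp b * expR (b * tau t i j))); last by ring.
apply: ler_wpM2l; first by rewrite exprn_ge0// ltW.
by have [_] := le_Kexp b0 (divr_ge0 (dist_of_ge0 t i j) (ltW rho0)).
Qed.

Let dist_le b (t : sample_WX) i j : 0 < b ->
  dist_of t i j <= Kexp b * rho * expR (b * tau t i j).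
Proof.
move=> b0; rewrite {1}dist_rho (_ : Kexp b * _ * _ =
  rho * (Kexp b * expR (b * tau t i j))); last by ring.
apply: ler_wpM2l; first exact: ltW.
by have [+ _] := le_Kexp b0 (divr_ge0 (dist_of_ge0 t i j) (ltW rho0)).
Qed.

(** Two matches of the same unit: Lipschitz increments, whose lengths are controlled by the
    weight. *)
Lemma diagonal_product_le t i j j' : matched k t i j -> matched k t i j' ->
  `|increment t i j * increment t i j'| <=
  Kg ^+ 2 * Kexp a * rho ^+ 2 * (\1_XX (pos_of t i) * weight t i i).
Proof.
move=> mij mij'; have W0 := weight_ge0 t i i.
have C0 : 0 <= Kg ^+ 2 * Kexp a * rho ^+ 2.
  by rewrite !mulr_ge0 ?exprn_ge0 ?(rd_Kg rd) ?Kexp_ge0// ltW.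
have R0 : 0 <= Kg ^+ 2 * Kexp a * rho ^+ 2 * (\1_XX (pos_of t i) * weight t i i).
  by rewrite mulr_ge0// mulr_ge0.
have hi1 := diffg_le (rd_g_lip rd) (tnth t i) (tnth t j).
have hi2 := diffg_le (rd_g_lip rd) (tnth t i) (tnth t j').
have [E|[E [x1 x2]]] := both_inP XX (tnth t i) (tnth t j).
  by move: hi1; rewrite E mul0r normr_le0 => /eqP E1; rewrite /increment E1 mul0r normr0.
have [E'|[E' [_ x3]]] := both_inP XX (tnth t i) (tnth t j').
  by move: hi2; rewrite E' mul0r normr_le0 => /eqP E1; rewrite /increment E1 mulr0 normr0.
rewrite indicE mem_set// mul1r normrM.
rewrite E mul1r in hi1; rewrite E' mul1r in hi2.
apply: (le_trans (ler_pM _ _ hi1 hi2)) => //.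
rewrite -/(dist_of t i j) -/(dist_of t i j').
have t1 : dist_of t i j ^+ 2 <= Kexp a * rho ^+ 2 * weight t i i.
  apply: le_trans (dist_sq_le _ _ _ a0) _; rewrite ler_wpM2l ?tau_le_weight//.
  by rewrite mulr_ge0 ?exprn_ge0 ?Kexp_ge0// ltW.
have t2 : dist_of t i j' ^+ 2 <= Kexp a * rho ^+ 2 * weight t i i.
  apply: le_trans (dist_sq_le _ _ _ a0) _; rewrite ler_wpM2l ?tau_le_weight//.
  by rewrite mulr_ge0 ?exprn_ge0 ?Kexp_ge0// ltW.
rewrite (_ : Kg * _ * _ = Kg ^+ 2 * (dist_of t i j * dist_of t i j')); last by ring.
rewrite (_ : _ * weight t i i = Kg ^+ 2 * (Kexp a * rho ^+ 2 * weight t i i)); last by ring.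
apply: ler_wpM2l; first by rewrite exprn_ge0 ?(rd_Kg rd).
apply: le_trans (_ : (dist_of t i j ^+ 2 + dist_of t i j' ^+ 2) / 2 <= _).
  rewrite ler_pdivlMr//; move: (dist_of t i j) (dist_of t i j') => x y.
  have := sqr_ge0 (x - y); rewrite (_ : (x - y) ^+ 2 = x ^+ 2 + y ^+ 2 - x * y * 2).
    by rewrite subr_ge0.
  by ring.
by rewrite ler_pdivrMr//; move: t1 t2; lra.
Qed.

(** The longer of the two matches is at least half as long as the distance between the
    matched units.  Its weight bounds both lengths and leaves room for the factor
    [overlap_weight]. *)
Lemma near_product_le t i i' j j' : matched k t i j -> matched k t i' j' ->
  ~~ apart t i i' j j' ->
  `|increment t i j * increment t i' j'| <= Kg ^+ 2 * Kexp (a / 2) * rho ^+ 2 *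
    (overlap_weight (tnth t i) (tnth t i') * weight t i i' +
     overlap_weight (tnth t i') (tnth t i) * weight t i' i).
Proof.
move=> mij mij' na.
have a20 : 0 < a / 2 by rewrite divr_gt0.
have ow0 z z' : 0 <= overlap_weight z z'.
  rewrite mulr_ge0 ?expR_ge0//; by have [->|[-> _]] := both_inP XX z z'; rewrite ?ler01.
have s1 : 0 <= overlap_weight (tnth t i) (tnth t i') * weight t i i' by rewrite mulr_ge0.
have s2 : 0 <= overlap_weight (tnth t i') (tnth t i) * weight t i' i by rewrite mulr_ge0.
have C0 : 0 <= Kg ^+ 2 * Kexp (a / 2) * rho ^+ 2.
  by rewrite !mulr_ge0 ?exprn_ge0 ?(rd_Kg rd) ?Kexp_ge0// ltW.
have R0 := mulr_ge0 C0 (addr_ge0 s1 s2).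
have hi1 := diffg_le (rd_g_lip rd) (tnth t i) (tnth t j).
have hi2 := diffg_le (rd_g_lip rd) (tnth t i') (tnth t j').
have [E|[E [x1 x2]]] := both_inP XX (tnth t i) (tnth t j).
  by move: hi1; rewrite E mul0r normr_le0 => /eqP E1; rewrite /increment E1 mul0r normr0.
have [E'|[E' [x3 x4]]] := both_inP XX (tnth t i') (tnth t j').
  by move: hi2; rewrite E' mul0r normr_le0 => /eqP E1; rewrite /increment E1 mulr0 normr0.
rewrite normrM; rewrite E mul1r in hi1; rewrite E' mul1r in hi2.
apply: (le_trans (ler_pM _ _ hi1 hi2)) => //.
rewrite -/(dist_of t i j) -/(dist_of t i' j').
rewrite (_ : Kg * _ * _ = Kg ^+ 2 * (dist_of t i j * dist_of t i' j')); last by ring.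
have assoc (x y z w : R) : x * y * z * w = x * (y * z * w) by ring.
rewrite [leRHS]assoc.
have CK : 0 <= Kexp (a / 2) * rho ^+ 2.
  by rewrite mulr_ge0 ?exprn_ge0 ?Kexp_ge0// ltW.
apply: ler_wpM2l; first by rewrite exprn_ge0 ?(rd_Kg rd).
have dsq l l' := dist_sq_le t l l' a20.
move: (Kexp (a / 2) * rho ^+ 2) CK dsq => CC CK dsq.
have key b b' c c' : matched k t b c -> XX (pos_of t b) -> XX (pos_of t c) ->
    XX (pos_of t b') -> dist_of t b' c' <= dist_of t b c ->
    dist_of t b b' <= dist_of t b c + dist_of t b' c' ->
    dist_of t b c * dist_of t b' c' <= CC *
      (overlap_weight (tnth t b) (tnth t b') * weight t b b').
  move=> mbc xb xc xb' cc' bb'.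
  have bb2 : dist_of t b b' <= 2 * dist_of t b c.
    by apply: (le_trans bb'); rewrite mulr2n mulrDl mul1r lerD2l.
  have ow : overlap_weight (tnth t b) (tnth t b') =
      expR (- (a / 2 / 2 ^+ d) * tau t b b').
    by rewrite /overlap_weight /both_in !indicE !mem_set// !mul1r.
  have tt : tau t b b' <= 2 ^+ d * tau t b c.
    rewrite /tau -exprMn lerXn2r// ?nnegrE.
    - by rewrite divr_ge0 ?dist_of_ge0// ltW.
    - by rewrite mulr_ge0// divr_ge0 ?dist_of_ge0// ltW.
    - by rewrite mulrA ler_wpM2r// invr_ge0 ltW.
  apply: (@le_trans _ _ (dist_of t b c ^+ 2)).
    by rewrite expr2 ler_wpM2l ?dist_of_ge0.
  apply: le_trans (dsq b c) _.
  apply: ler_wpM2l; first exact: CK.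
  apply: (@le_trans _ _ (expR (- (a / 2 / 2 ^+ d) * tau t b b') * expR (a * tau t b c))).
    have h : a / 2 / 2 ^+ d * tau t b b' <= a / 2 * tau t b c.
      rewrite (_ : a / 2 * tau t b c = a / 2 / 2 ^+ d * (2 ^+ d * tau t b c)); last first.
        by field; rewrite gt_eqF// exprn_gt0.
      by apply: ler_wpM2l => //; rewrite divr_ge0 ?exprn_ge0// ltW.
    rewrite -expRD ler_expR mulNr addrC lerBrDr.
    rewrite (_ : a * tau t b c = a / 2 * tau t b c + a / 2 * tau t b c); last by field.
    by rewrite lerD2l.
  by rewrite ow ler_wpM2l ?expR_ge0 ?tau_le_weight.
move: na; rewrite /apart -leNgt => na.
rewrite mulrDr; have [vv|/ltW vv] := leP (dist_of t i' j') (dist_of t i j).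
  apply: ler_wpDr; first exact: mulr_ge0 CK s2.
  exact: key.
apply: ler_wpDl; first exact: mulr_ge0 CK s1.
by rewrite [dist_of t i j * _]mulrC; apply: key => //; rewrite addrC dist_of_sym.
Qed.

Definition Kfar : R := Ksym lo hi Kg K2 Kf * Kexp (a / 4).

Let a40 : 0 < a / 4. Proof. by rewrite divr_gt0. Qed.

Lemma edge_weight_ge0 z : 0 <= edge_weight z.
Proof.
rewrite mulr_ge0// addr_ge0 ?exprn_ge0 ?(ltW rho0)//.
by rewrite mulr_ge0 ?expR_ge0// ltW.
Qed.

Lemma Kfar_ge0 : 0 <= Kfar.
Proof. by rewrite mulr_ge0 ?Kexp_ge0// Ksym_ge0// (rd_Kg rd). Qed.

(** If the match is longer than the distance from unit [i] to the boundary, then part of the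
    exponential in [tau] can be traded for an exponential in the distance to the boundary. *)
Lemma sym_increment_le (t : sample_WX) i j :
  `|sym_increment t i j| <= Kfar * (edge_weight (tnth t i) * expR (a / 2 * tau t i j)).
Proof.
have h := symg_le (rd_f0 rd) (rd_lo rd) (rd_Kg rd) (rd_K2 rd) (rd_Kf rd) (rd_f_bounds rd)
  (rd_g_lip rd) (rd_f_lip rd) (rd_g_second rd) (tnth t i) (tnth t j).
have W0 := edge_weight_ge0 (tnth t i).
have e0 : 0 <= expR (a / 2 * tau t i j) by exact: expR_ge0.
have [E|[E [x1 x2]]] := both_inP XX (tnth t i) (tnth t j).
  apply: (le_trans h); rewrite E mul0r; apply: mulr_ge0; first exact: Kfar_ge0.
  exact: mulr_ge0.
apply: (le_trans h); rewrite E mul1r /Kfar -[leRHS]mulrA.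
apply: ler_wpM2l; first by apply: Ksym_ge0; exact: rd_Kg rd.
rewrite /edge_weight indicE mem_set// mul1r -/(dist_of t i j).
set e1 := expR (- _ * _); have e10 : 0 <= e1 by exact: expR_ge0.
have K0 : 0 <= Kexp (a / 4) by exact: Kexp_ge0.
have half : expR (a / 4 * tau t i j) <= expR (a / 2 * tau t i j).
  rewrite ler_expR; apply: ler_wpM2r; first exact: tau_ge0.
  by have := a0; lra.
have r20 : 0 <= rho ^+ 2 by rewrite exprn_ge0// ltW.
have re0 : 0 <= rho * e1 by rewrite mulr_ge0// ltW.
case: ifPn => [_|ni].
  apply: le_trans (dist_sq_le t i j a40) _; rewrite -mulrA; apply: (ler_wpM2l K0).
  apply: ler_pM; [exact: r20|exact: expR_ge0|by rewrite lerDl|exact: half].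
apply: le_trans (dist_le t i j a40) _; rewrite -mulrA; apply: (ler_wpM2l K0).
apply: (@le_trans _ _ (rho * e1 * expR (a / 2 * tau t i j))); last first.
  by apply: ler_wpM2r => //; rewrite lerDr.
rewrite -mulrA; apply: ler_wpM2l; first exact: ltW.
rewrite -expRD ler_expR.
have dt : (bdist XX (tnth t i).2 / rho) ^+ d <= tau t i j.
  have b0 : 0 <= bdist XX (tnth t i).2 by exact: dist_to_ge0.
  rewrite /tau lerXn2r// ?nnegrE; try by rewrite divr_ge0 ?dist_of_ge0// ltW.
  rewrite ler_wpM2r// ?invr_ge0; first exact: ltW.
  by move: ni; rewrite /interior_pair -leNgt.
have := ler_wpM2l (ltW a40) dt; move: (tau t i j) (_ ^+ d) => x y; lra.
Qed.

(** The product of the two exponentials is at most the sum of their squares, so that each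
    term carries a single weight. *)
Lemma far_product_le (t : sample_WX) i i' j j' :
  matched k t i j -> matched k t i' j' ->
  `|sym_increment t i j * sym_increment t i' j'| <= Kfar ^+ 2 *
    (edge_weight (tnth t i) * edge_weight (tnth t i') * (weight t i i' + weight t i' i)).
Proof.
move=> mij mij'.
have product_le (s s' K u u' x y w w' : R) : 0 <= K -> 0 <= u -> 0 <= u' -> 0 <= x -> 0 <= y ->
    `|s| <= K * (u * x) -> `|s'| <= K * (u' * y) -> x ^+ 2 <= w -> y ^+ 2 <= w' ->
    `|s * s'| <= K ^+ 2 * (u * u' * (w + w')).
  move=> K0 u0 u0' x0 y0 sK sK' xw yw; rewrite normrM.
  apply: (le_trans (ler_pM _ _ sK sK')) => //.
  rewrite (_ : K * (u * x) * (K * (u' * y)) = K ^+ 2 * (u * u' * (x * y))); last by ring.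
  rewrite ler_wpM2l ?exprn_ge0// ler_wpM2l ?mulr_ge0//; nra.
have R0 : 0 <= Kfar ^+ 2 *
    (edge_weight (tnth t i) * edge_weight (tnth t i') * (weight t i i' + weight t i' i)).
  apply: mulr_ge0; first by apply: exprn_ge0; exact: Kfar_ge0.
  apply: mulr_ge0; first by apply: mulr_ge0; exact: edge_weight_ge0.
  by apply: addr_ge0; exact: weight_ge0.
have [E|[_ [x1 x2]]] := both_inP XX (tnth t i) (tnth t j).
  by rewrite /sym_increment /symg E !mul0r normr0.
have [E|[_ [x3 x4]]] := both_inP XX (tnth t i') (tnth t j').
  by rewrite /sym_increment /symg E mul0r mulr0 normr0.
have sq z : expR (a / 2 * z) ^+ 2 = expR (a * z).
  by rewrite -expRM_natl; congr expR; field.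
apply: (product_le _ _ _ _ _ _ _ _ _ Kfar_ge0 (edge_weight_ge0 _) (edge_weight_ge0 _)
  (expR_ge0 _) (expR_ge0 _) (sym_increment_le t i j) (sym_increment_le t i' j')).
  by rewrite sq; exact: tau_le_weight.
by rewrite sq; exact: tau_le_weight.
Qed.

Definition near_bound i i' (t : sample_WX) : R :=
  if i == i' then Kg ^+ 2 * Kexp a * rho ^+ 2 * (\1_XX (pos_of t i) * weight t i i)
  else Kg ^+ 2 * Kexp (a / 2) * rho ^+ 2 *
    (overlap_weight (tnth t i) (tnth t i') * weight t i i' +
     overlap_weight (tnth t i') (tnth t i) * weight t i' i).

Definition far_bound i i' (t : sample_WX) : R :=
  if i == i' then 0 else Kfar ^+ 2 *
    (edge_weight (tnth t i) * edge_weight (tnth t i') * (weight t i i' + weight t i' i)).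

Let near_coef_ge0 b : 0 < b -> 0 <= Kg ^+ 2 * Kexp b * rho ^+ 2.
Proof. by move=> b0; rewrite !mulr_ge0 ?exprn_ge0 ?(rd_Kg rd) ?Kexp_ge0// ltW. Qed.

Lemma overlap_weight_ge0 z z' : 0 <= overlap_weight z z'.
Proof.
by rewrite mulr_ge0 ?expR_ge0//; have [->|[-> _]] := both_inP XX z z'; rewrite ?ler01.
Qed.

Lemma near_bound_ge0 i i' t : 0 <= near_bound i i' t.
Proof.
have a20 : 0 < a / 2 by rewrite divr_gt0.
rewrite /near_bound; case: eqP => _.
  by apply: mulr_ge0; [exact: near_coef_ge0|apply: mulr_ge0; [|exact: weight_ge0]].
apply: mulr_ge0; first exact: near_coef_ge0.
by apply: addr_ge0; apply: mulr_ge0; (exact: overlap_weight_ge0 || exact: weight_ge0).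
Qed.

Lemma far_bound_ge0 i i' t : 0 <= far_bound i i' t.
Proof.
rewrite /far_bound; case: eqP => // _; apply: mulr_ge0.
  by apply: exprn_ge0; exact: Kfar_ge0.
apply: mulr_ge0; first by apply: mulr_ge0; exact: edge_weight_ge0.
by apply: addr_ge0; exact: weight_ge0.
Qed.

Lemma quad_le (q : quad) t : `|near_term q t + sym_far_term q t| <=
  (matched k t q.1.1 q.1.2)%:R * (matched k t q.2.1 q.2.2)%:R *
  (near_bound q.1.1 q.2.1 t + far_bound q.1.1 q.2.1 t).
Proof.
case: q => -[i j] [i' j'] /=.
have nb0 := near_bound_ge0 i i' t; have fb0 := far_bound_ge0 i i' t.
rewrite /near_term /sym_far_term /coupled_sign /signed_pair /coupled/=.
have [mij|_] := boolP (matched k t i j); last by rewrite andbF /= !(mul0r, mulr0, addr0) normr0.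
have [mij'|_] := boolP (matched k t i' j'); last by rewrite !andbF /= !(mul0r, mulr0, addr0) normr0.
rewrite !andbT /= !mul1r.
have s1 : `|arm_sign t i * arm_sign t i'| = 1 by rewrite normrM !normr_arm_sign mulr1.
have [ap|na] := boolP (apart t i i' j j').
  rewrite /= !mul0r add0r mul1r -mulrA normrM s1 mul1r.
  have ii' : i != i'.
    apply/eqP => E; move: ap; rewrite /apart E dist_ofii ltNge.
    by rewrite addr_ge0 ?dist_of_ge0.
  apply: (le_trans (far_product_le mij mij')).
  by rewrite /far_bound (negbTE ii') lerDr.
rewrite /= !mul0r addr0 mul1r -mulrA normrM s1 mul1r.
apply: (@le_trans _ _ (near_bound i i' t)); last by rewrite lerDl.
rewrite /near_bound; case: eqP => [E|_]; last exact: near_product_le.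
by move: mij'; rewrite -E => mij'; exact: diagonal_product_le.
Qed.

(** Each unit has [k] matches, or none when an arm is too small. *)
Lemma sum_matched_le (t : sample_WX) i :
  \sum_(j < N) (matched k t i j)%:R <= k%:R :> R.
Proof.
rewrite /matched; have [en|_] := boolP (enough k t); last by rewrite big1 ?ler0n.
have kW : (k <= arm_size (arm_of t) (~~ arm_of t i))%N.
  by move: en; rewrite /enough leq_min => /andP[]; case: (arm_of t i).
have cK := card_knn (pos_of t) kW.
rewrite -natr_sum ler_nat -[leqRHS]cK -sum1_card [leqRHS]big_mkcond/=.
by apply: leq_sum => j _; rewrite unfold_in /knn; case: ifP => b; rewrite ?b.
Qed.

Lemma sym_bias_sq_le t : `|sym_bias_sq t| <=
  N%:R ^- 2 * \sum_(p : 'I_N * 'I_N) (near_bound p.1 p.2 t + far_bound p.1 p.2 t).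
Proof.
have N2 : 0 <= (N%:R * k%:R) ^- 2 :> R by rewrite invr_ge0 exprn_ge0.
rewrite /sym_bias_sq normrM ger0_norm//.
have B0 i i' : 0 <= near_bound i i' t + far_bound i i' t.
  by apply: addr_ge0; [exact: near_bound_ge0|exact: far_bound_ge0].
pose B i i' := near_bound i i' t + far_bound i i' t.
apply: (@le_trans _ _ ((N%:R * k%:R) ^- 2 * \sum_(q : quad)
   ((matched k t q.1.1 q.1.2)%:R * (matched k t q.2.1 q.2.2)%:R * B q.1.1 q.2.1))).
  apply: ler_wpM2l => //; apply: le_trans (ler_norm_sum _ _ _) _.
  by apply: ler_sum => q _; exact: quad_le.
rewrite (_ : N%:R ^- 2 = (N%:R * k%:R) ^- 2 * (k%:R ^+ 2)); last first.
  by field; rewrite !pnatr_eq0 -!lt0n k0 N0.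
rewrite -[leRHS]mulrA; apply: ler_wpM2l => //.
rewrite -(pair_bigA _ (fun p p' : 'I_N * 'I_N =>
  (matched k t p.1 p.2)%:R * (matched k t p'.1 p'.2)%:R * B p.1 p'.1))/=.
rewrite -(pair_bigA _ (fun i j => \sum_(p' : 'I_N * 'I_N)
  (matched k t i j)%:R * (matched k t p'.1 p'.2)%:R * B i p'.1))/=.
rewrite -(pair_bigA _ B)/= mulr_sumr.
apply: ler_sum => i _.
have E j : \sum_(p' : 'I_N * 'I_N)
    (matched k t i j)%:R * (matched k t p'.1 p'.2)%:R * B i p'.1 =
  (matched k t i j)%:R * \sum_(i' < N) (B i i' * \sum_(j' < N) (matched k t i' j')%:R).
  rewrite -(pair_bigA _ (fun i' j' => (matched k t i j)%:R * (matched k t i' j')%:R * B i i'))/=.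
  rewrite mulr_sumr; apply: eq_bigr => i' _; rewrite !mulr_sumr.
  by apply: eq_bigr => j' _; rewrite mulrA mulrAC.
under eq_bigr do rewrite E.
rewrite -mulr_suml expr2 -mulrA.
apply: ler_pM; first by rewrite sumr_ge0.
- rewrite sumr_ge0// => i' _; apply: mulr_ge0; first exact: B0.
  by rewrite sumr_ge0.
- exact: sum_matched_le.
rewrite mulr_sumr; apply: ler_sum => i' _; rewrite mulrC.
by apply: ler_wpM2r; [exact: B0|exact: sum_matched_le].
Qed.

Lemma measurable_overlap_weight :
  measurable_fun setT (fun p : unit_WX * unit_WX => overlap_weight p.1 p.2).
Proof.
apply: measurable_funM.
  by apply: measurable_both_in => //; exact: rd_closed rd.
apply: (measurableT_comp (@measurable_expR R)); apply: measurable_funM => //.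
apply: measurable_funX; apply: measurable_funM => //.
by apply: measurable_fun_enorm; apply: measurableT_comp.
Qed.

Lemma measurable_edge_weight : measurable_fun setT edge_weight.
Proof.
apply: measurable_funM.
  by apply: measurableT_comp => //; apply: measurable_indic; exact: rd_closed rd.
apply: measurable_funD => //; apply: measurable_funM => //.
apply: (measurableT_comp (@measurable_expR R)); apply: measurable_funM => //.
apply: measurable_funX; apply: measurable_funM => //.
by apply: (@measurable_bdist _ _ XX (rd_proper rd) _ unit_WX id).
Qed.

Definition Kedge : R := 1 + M8 * (a / 4)^-1 `^ d%:R^-1.

(** The boundary condition at [L = a / 4 / rho ^+ d] gives the second factor [rho]. *)
Lemma edge_weight_mean : (\int[Q]_z (edge_weight z)%:E <= (Kedge * rho ^+ 2)%:E)%E.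
Proof.
have mXX := rd_closed rd; pose L := a / 4 / rho ^+ d.
have L0 : 0 < L by rewrite divr_gt0// exprn_gt0.
pose h (z : unit_WX) : R := \1_XX z.2 * expR (- L * bdist XX z.2 ^+ d).
have mh : measurable_fun setT h.
  apply: measurable_funM.
    by apply: measurableT_comp => //; apply: measurable_indic.
  apply: (measurableT_comp (@measurable_expR R)); apply: measurable_funM => //.
  by apply: measurable_funX; apply: (@measurable_bdist _ _ XX (rd_proper rd) _ unit_WX id).
have h0 z : 0 <= h z by rewrite mulr_ge0// expR_ge0.
have r20 : 0 <= rho ^+ 2 by rewrite exprn_ge0// ltW.
apply: (@le_trans _ _ (\int[Q]_z (rho ^+ 2 + rho * h z)%:E)%E).
  apply: integral_real_le; [exact: measurable_edge_weight| |exact: edge_weight_ge0|].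
    by apply: measurable_funD => //; apply: measurable_funM.
  move=> z; rewrite /edge_weight mulrDr; apply: lerD.
    by rewrite ler_piMl// indicE; case: (_ \in _).
  rewrite mulrCA ler_wpM2l ?(ltW rho0)// /h le_eqVlt; apply/orP; left; apply/eqP.
  congr (_ * expR _); rewrite exprMn exprVn /L; field.
  by rewrite gt_eqF// exprn_gt0.
rewrite integral_realD//; last 2 first.
- by apply: measurable_funM.
- by move=> z; rewrite mulr_ge0// ltW.
have I1 : (\int[Q]_z (rho ^+ 2)%:E = (rho ^+ 2)%:E)%E.
  rewrite integral_cst//; transitivity ((rho ^+ 2)%:E * 1)%E; last by rewrite mule1.
  by congr (_ * _)%E; exact: probability_setT.
rewrite [X in (_ + X)%E]integral_realZ// ?(ltW rho0)//.
rewrite [X in (X + _)%E](_ : _ = (rho ^+ 2)%:E)%E//.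
rewrite /Kedge mulrDl mul1r EFinD leeD2l//.
have hL : (\int[Q]_z (h z)%:E <= (M8 * L^-1 `^ d%:R^-1)%:E)%E.
  exact: sp_boundary sp _ L0.
apply: (le_trans (lee_wpmul2l _ hL)); first by rewrite lee_fin ltW.
rewrite -EFinM lee_fin le_eqVlt; apply/orP; left; apply/eqP.
rewrite /L invf_div powRM ?exprn_ge0 ?invr_ge0 ?(ltW rho0)//; last exact: ltW.
rewrite -powR_mulrn ?(ltW rho0)// -powRrM divff ?powRr1 ?(ltW rho0)//.
  by ring.
by rewrite pnatr_eq0 -lt0n (rd_dim rd).
Qed.

Definition Kover : R := let b := a / 2 / 2 ^+ d in
  c2 * (1 + 2 / b) / (1 - expR (- (b / 2))).

(** Shell [s] has mass at most a constant times [rho ^+ d * s.+1], which the exponential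
    makes summable. *)
Lemma overlap_weight_mean (z : unit_WX) :
  (\int[Q]_z' (overlap_weight z z')%:E <= (Kover * rho ^+ d)%:E)%E.
Proof.
pose b := a / 2 / 2 ^+ d.
have b0 : 0 < b.
  by apply: divr_gt0; [apply: divr_gt0; [exact: a0|]|exact: exprn_gt0].
have mXX := rd_closed rd.
pose S (s : nat) := [set z' : unit_WX | XX z'.2 /\ (enorm (z'.2 - z.2) <= shell R d N k s.+1)%R].
have mS s : measurable (S s).
  rewrite (_ : S s = setT `*` (XX `&` eball z.2 (shell R d N k s.+1))).
    by apply: measurableX => //; apply: measurableI => //; exact: measurable_eball.
  by apply/seteqP; split=> -[w x] /= => [|[_]].
have mow : measurable_fun setT (overlap_weight z).
  exact: (measurable_fun_pair2 _ measurable_overlap_weight).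
have mI s : measurable_fun setT (\1_(S s) : unit_WX -> R) by exact: measurable_indic.
apply: (@le_trans _ _ (\int[Q]_z' (\sum_(s < shells) expR (- b * s%:R) * \1_(S s) z')%:E)%E).
  apply: integral_real_le => //; [|exact: overlap_weight_ge0|].
    by apply: measurable_sum => s; apply: measurable_funM.
  move=> z'.
  have R0 : 0 <= \sum_(s < shells) expR (- b * s%:R) * \1_(S s) z'.
    by apply: sumr_ge0 => s _; rewrite mulr_ge0// expR_ge0.
  rewrite /overlap_weight; have [->|[-> [x1 x2]]] := both_inP XX z z'.
    by rewrite mul0r.
  rewrite mul1r -/b; set y := (_ / rho) ^+ d.
  have v0 : 0 <= enorm (z'.2 - z.2) / rho by rewrite divr_ge0 ?enorm_ge0// ltW.
  have y0 : 0 <= y by exact: exprn_ge0.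
  have yT : y <= N%:R / k%:R * D0 ^+ d.
    rewrite /y exprMn exprVn scaleXd ?(rd_dim rd)// invf_div mulrC.
    rewrite ler_wpM2l ?divr_ge0// lerXn2r ?nnegrE ?enorm_ge0//.
      exact: le_trans (enorm_ge0 _) (rd_diam rd x2 x1).
    exact: rd_diam rd _ _ x2 x1.
  have [s [sT sy ys]] : exists s : nat, [/\ (s < shells)%N, s%:R <= y & y <= s.+1%:R].
    move: y0; rewrite le_eqVlt => /orP[/eqP <-|yp]; first by exists 0%N.
    have [s /andP[sy ys]] := exists_shell yp; exists s; split=> //; last exact: ltW.
    by rewrite -(ltr_nat R) (lt_le_trans sy)// (le_trans yT)// shells_ge.
  rewrite (bigD1 (Ordinal sT))//= indicE mem_set; last first.
    split=> //; rewrite -(@ler_pXn2r _ d) ?nnegrE ?enorm_ge0 ?shell_ge0 ?(rd_dim rd)//.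
    rewrite shellXd ?(rd_dim rd)// -(@scaleXd R d (rd_dim rd) N k).
    rewrite mulrC -ler_pdivrMr ?exprn_gt0// -exprVn -exprMn.
    exact: ys.
  rewrite mulr1; apply: ler_wpDr.
    by apply: sumr_ge0 => m _; rewrite mulr_ge0// expR_ge0.
  by rewrite ler_expR !mulNr lerN2 ler_wpM2l// ltW.
rewrite integral_real_sum; last 2 first.
- by move=> s; apply: measurable_funM.
- by move=> s z'; rewrite mulr_ge0// expR_ge0.
have c20 := rd_c2 rd.
apply: (@le_trans _ _ (\sum_(s < shells)
    (c2 * (1 + 2 / b) * rho ^+ d * expR (- (b / 2)) ^+ s)%:E)%E).
  apply: lee_sum => s _; rewrite integral_realZ ?expR_ge0//.
  rewrite integral_indic// setIT.
  have Sle : (Q (S s) <= (c2 * shell R d N k s.+1 ^+ d)%:E)%E.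
    by apply: sp_mass_le sp _ _ _; exact: shell_ge0.
  apply: (le_trans (lee_wpmul2l _ Sle)); first by rewrite lee_fin expR_ge0.
  rewrite -EFinM lee_fin shellXd ?(rd_dim rd)// -(@scaleXd R d (rd_dim rd) N k).
  have -> : expR (- b * s%:R) = expR (- (b / 2)) ^+ s * expR (- (b / 2)) ^+ s.
    by rewrite -!expRM_natl -expRD; congr expR; field.
  set q := expR (- (b / 2)) ^+ s; have q0 : 0 <= q by rewrite exprn_ge0 ?expR_ge0.
  rewrite (_ : q * q * _ = c2 * (q * s.+1%:R) * rho ^+ d * q); last by ring.
  rewrite ler_wpM2r// ler_wpM2r ?exprn_ge0 ?(ltW rho0)// ler_wpM2l//.
  have p1 : 0 <= 2 / b by rewrite divr_ge0// ltW.
  have p2 : 0 <= b / 2 * s%:R by rewrite mulr_ge0// divr_ge0// ltW.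
  have qE : q = (expR (b / 2 * s%:R))^-1.
    by rewrite /q -expRM_natl -expRN; congr expR; ring.
  rewrite qE mulrC ler_pdivrMr ?expR_gt0//.
  have e1 : 1 + b / 2 * s%:R <= expR (b / 2 * s%:R) by exact: expR_ge1Dx.
  apply: (@le_trans _ _ ((1 + 2 / b) * (1 + b / 2 * s%:R))).
    rewrite (_ : (1 + 2 / b) * (1 + b / 2 * s%:R) = s.+1%:R + (2 / b + b / 2 * s%:R)).
      by rewrite lerDl addr_ge0.
    by rewrite -natr1; field; rewrite gt_eqF.
  by rewrite ler_wpM2l// addr_ge0.
rewrite sumEFin lee_fin -mulr_sumr /Kover -/b.
have b20 : 0 < b / 2 by rewrite divr_gt0.
rewrite [leRHS]mulrAC ler_wpM2l//.
  have p1 : 0 <= 2 / b by rewrite divr_ge0// ltW.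
  by rewrite mulr_ge0 ?exprn_ge0 ?(ltW rho0)// mulr_ge0// addr_ge0.
apply: geometric_sum_le; first exact: expR_ge0.
by rewrite expR_lt1 oppr_lt0.
Qed.

Notation S1 := (spread_bound c1).

Let S1_ge0 : 0 <= S1. Proof. by apply: ltW; apply: spread_bound_gt0; exact: rd_c1 rd. Qed.

Lemma weight_mean (i e : 'I_N) (Phi : unit_WX -> unit_WX -> R) (B : R) :
  measurable_fun setT (fun p : unit_WX * unit_WX => Phi p.1 p.2) ->
  (forall z z', 0 <= Phi z z') -> (forall z z', Phi z z' != 0 -> XX z.2) ->
  (\int[P]_s (Phi (tnth (smp s) i) (tnth (smp s) e))%:E <= B%:E)%E ->
  (\int[P]_s (Phi (tnth (smp s) i) (tnth (smp s) e) * weight (smp s) i e)%:E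
   <= (S1 * B)%:E)%E.
Proof.
move=> mPhi Phi0 PhiXX PhiB.
apply: le_trans (_ : _ <= S1%:E * B%:E)%E _; last by rewrite EFinM.
apply: le_trans (lee_wpmul2l _ PhiB); last by rewrite lee_fin; exact: S1_ge0.
apply: spread_weight_mean (sp_iid sp) XX (sp_mass_ge sp) _ _ _ _ mPhi Phi0 PhiXX.
- exact: rd_dim rd.
- exact: N0.
- exact: k0.
- exact: rd_c1 rd.
Qed.

(** Independence of two distinct units, as integration of the second one against the
    common law. *)
Lemma pair_mean (i e : 'I_N) (Phi : unit_WX -> unit_WX -> R) : i != e ->
  measurable_fun setT (fun p : unit_WX * unit_WX => Phi p.1 p.2) ->
  (forall z z', 0 <= Phi z z') ->
  (\int[P]_s (Phi (tnth (smp s) i) (tnth (smp s) e))%:E =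
   \int[P]_s \int[Q]_z (Phi (tnth (smp s) i) z)%:E)%E.
Proof.
move=> ie mPhi Phi0; pose F (t : sample_WX) := (Phi (tnth t i) (tnth t e))%:E.
have mF : measurable_fun setT F.
  by apply/measurable_EFinP; exact: measurable_pair_of.
rewrite -[LHS]/(\int[P]_s F (smp s))%E (resample (sp_iid sp) e mF); last first.
  by move=> t; rewrite lee_fin; exact: Phi0.
apply: eq_integral => s _; apply: eq_integral => z _.
by rewrite /F !tnth_upd eqxx (negbTE ie).
Qed.

Lemma single_mean (i : 'I_N) (phi : unit_WX -> R) : measurable_fun setT phi ->
  (forall z, 0 <= phi z) ->
  (\int[P]_s (phi (tnth (smp s) i))%:E = \int[Q]_z (phi z)%:E)%E.
Proof.
move=> mphi phi0; pose F (t : sample_WX) := (phi (tnth t i))%:E.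
have mF : measurable_fun setT F.
  apply/measurable_EFinP; apply: measurableT_comp mphi _; exact: measurable_tnth.
rewrite -[LHS]/(\int[P]_s F (smp s))%E (resample (sp_iid sp) i mF); last first.
  by move=> t; rewrite lee_fin; exact: phi0.
transitivity (\int[P]_s \int[Q]_z (phi z)%:E)%E.
  apply: eq_integral => s _; apply: eq_integral => z _.
  by rewrite /F tnth_upd eqxx.
by rewrite integral_probability_cst.
Qed.

Lemma pair_overlap_mean (i e : 'I_N) : i != e ->
  (\int[P]_s (overlap_weight (tnth (smp s) i) (tnth (smp s) e))%:E
    <= (Kover * rho ^+ d)%:E)%E.
Proof.
move=> ie; rewrite pair_mean//; [|exact: measurable_overlap_weight|exact: overlap_weight_ge0].
apply: (@le_trans _ _ (\int[P]_s (Kover * rho ^+ d)%:E)%E).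
  apply: ge0_le_integral => //.
  - by move=> s _; apply: integral_ge0 => z _; rewrite lee_fin overlap_weight_ge0.
  - pose F (t : sample_WX) := (overlap_weight (tnth t i) (tnth t e))%:E.
    have mF : measurable_fun setT F.
      apply/measurable_EFinP; exact: measurable_pair_of measurable_overlap_weight.
    have F0 t : (0 <= F t)%E by rewrite lee_fin overlap_weight_ge0.
    rewrite (_ : (fun _ => _) = (fun s => \int[Q]_z F (upd e z (smp s)))%E).
      exact: (measurable_sample_comp (sp_iid sp) (measurable_resampled _ e mF F0)).
    apply/funext => s; apply: eq_integral => z _.
    by rewrite /F !tnth_upd eqxx (negbTE ie).
  by move=> s _; exact: overlap_weight_mean.
by rewrite integral_probability_cst.
Qed.

Lemma Kedge_ge0 : 0 <= Kedge.
Proof. by apply: addr_ge0 => //; apply: mulr_ge0; [exact: rd_M8 rd|exact: powR_ge0]. Qed.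

(** The squared rate comes from the independence of the two units. *)
Lemma pair_edge_mean (i e : 'I_N) : i != e ->
  (\int[P]_s (edge_weight (tnth (smp s) i) * edge_weight (tnth (smp s) e))%:E
    <= ((Kedge * rho ^+ 2) ^+ 2)%:E)%E.
Proof.
move=> ie; have mu := measurable_edge_weight; have u0 := edge_weight_ge0.
have me (l : 'I_N) : measurable_fun setT (fun s => edge_weight (tnth (smp s) l)).
  apply/measurable_EFinP.
  apply: (measurable_sample_comp (sp_iid sp) (F := fun t => (edge_weight (tnth t l))%:E)).
  by apply/measurable_EFinP; apply: measurableT_comp mu _; exact: measurable_tnth.
have B0 : 0 <= Kedge * rho ^+ 2.
  by apply: mulr_ge0; [exact: Kedge_ge0|rewrite exprn_ge0// ltW].
rewrite (@pair_mean _ _ (fun z z' => edge_weight z * edge_weight z') ie); last 2 first.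
- by apply: measurable_funM; apply: measurableT_comp mu _.
- by move=> z z'; rewrite mulr_ge0.
apply: (@le_trans _ _ (\int[P]_s ((Kedge * rho ^+ 2) * edge_weight (tnth (smp s) i))%:E)%E).
  have E s : (\int[Q]_z (edge_weight (tnth (smp s) i) * edge_weight z)%:E =
      (edge_weight (tnth (smp s) i))%:E * \int[Q]_z (edge_weight z)%:E)%E.
    exact: integral_realZ.
  under eq_integral do rewrite E.
  apply: ge0_le_integral => //.
  - by move=> s _; rewrite mule_ge0 ?lee_fin// integral_ge0// => z _; rewrite lee_fin.
  - apply: emeasurable_funM; first by apply/measurable_EFinP; exact: me.
    exact: measurable_cst.
  - apply/measurable_EFinP; apply: measurable_funM; first exact: measurable_cst.
    exact: me.
  by move=> s _; rewrite [leRHS]EFinM muleC lee_wpmul2r ?lee_fin//; exact: edge_weight_mean.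
rewrite integral_realZ; [|exact: me|by move=> s; exact: u0|exact: B0].
rewrite (single_mean i mu u0) [X in (_ <= X%:E)%E]expr2 [leRHS]EFinM.
by apply: lee_wpmul2l; [rewrite lee_fin|exact: edge_weight_mean].
Qed.

Definition Kdiag : R := Kg ^+ 2 * Kexp a * S1.
Definition Knear : R := Kg ^+ 2 * Kexp (a / 2) * (2 * S1 * Kover).
Definition Kcross : R := Kfar ^+ 2 * (2 * S1 * Kedge ^+ 2).

Let measurable_weight i e : measurable_fun setT (fun t : sample_WX => weight t i e).
Proof. exact: measurable_spread_weight. Qed.

Let measurable_overlap_at i e :
  measurable_fun setT (fun t : sample_WX => overlap_weight (tnth t i) (tnth t e)).
Proof. exact: measurable_pair_of measurable_overlap_weight. Qed.

Let measurable_edge_at (i : 'I_N) :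
  measurable_fun setT (fun t : sample_WX => edge_weight (tnth t i)).
Proof.
by apply: measurableT_comp measurable_edge_weight _; exact: measurable_tnth.
Qed.

Let measurable_smp (h : sample_WX -> R) :
  measurable_fun setT h -> measurable_fun setT (fun s => h (smp s)).
Proof.
by move=> mh; apply: measurableT_comp mh _; exact: measurable_sample (sp_iid sp).
Qed.

Lemma measurable_near_bound i i' : measurable_fun setT (near_bound i i').
Proof.
rewrite /near_bound; case: (i == i'); apply: measurable_funM => //.
  apply: measurable_funM; last exact: measurable_weight.
  have mI : measurable_fun setT (\1_XX : 'rV[R]_d -> R).
    by apply: measurable_indic; exact: rd_closed rd.
  exact: measurableT_comp mI (@measurable_pos_of R d N i).
by apply: measurable_funD; apply: measurable_funM;
  first [exact: measurable_weight|exact: measurable_overlap_at].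
Qed.

Lemma measurable_far_bound i i' : measurable_fun setT (far_bound i i').
Proof.
rewrite /far_bound; case: (i == i') => //; apply: measurable_funM => //.
apply: measurable_funM; first by apply: measurable_funM; exact: measurable_edge_at.
by apply: measurable_funD; exact: measurable_weight.
Qed.

Let sample_integralZ (c : R) (h : sample_WX -> R) :
  measurable_fun setT h -> (forall t, 0 <= h t) -> 0 <= c ->
  (\int[P]_s (c * h (smp s))%:E = c%:E * \int[P]_s (h (smp s))%:E)%E.
Proof.
by move=> mh h0; apply: integral_realZ; [exact: measurable_smp|move=> s; exact: h0].
Qed.

Let sample_integralD (h1 h2 : sample_WX -> R) :
  measurable_fun setT h1 -> measurable_fun setT h2 ->
  (forall t, 0 <= h1 t) -> (forall t, 0 <= h2 t) ->
  (\int[P]_s (h1 (smp s) + h2 (smp s))%:E =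
   \int[P]_s (h1 (smp s))%:E + \int[P]_s (h2 (smp s))%:E)%E.
Proof.
move=> m1 m2 p1 p2; apply: integral_realD;
  [exact: measurable_smp|exact: measurable_smp|by move=> s; exact: p1|by move=> s; exact: p2].
Qed.

Let measurable_indicXX : measurable_fun setT (\1_XX : 'rV[R]_d -> R).
Proof. by apply: measurable_indic; exact: rd_closed rd. Qed.

Lemma integral_near_bound i i' : (\int[P]_s (near_bound i i' (smp s))%:E <=
  (if i == i' then Kdiag * rho ^+ 2 else Knear * (rho ^+ 2 * rho ^+ d))%:E)%E.
Proof.
have a20 : 0 < a / 2 by rewrite divr_gt0.
rewrite /near_bound; case: (eqVneq i i') => [_|ii'].
  have mw : measurable_fun setT (fun t : sample_WX => \1_XX (pos_of t i) * weight t i i).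
    apply: measurable_funM; last exact: measurable_weight.
    exact: measurableT_comp measurable_indicXX (@measurable_pos_of R d N i).
  have pw (t : sample_WX) : 0 <= \1_XX (pos_of t i) * weight t i i.
    by apply: mulr_ge0; [|exact: weight_ge0].
  rewrite (sample_integralZ mw pw (near_coef_ge0 a0)).
  rewrite (_ : Kdiag * _ = Kg ^+ 2 * Kexp a * rho ^+ 2 * (S1 * 1)); last by rewrite /Kdiag; ring.
  rewrite [leRHS]EFinM; apply: lee_wpmul2l; first by rewrite lee_fin; exact: near_coef_ge0.
  apply: (@weight_mean i i (fun z _ => \1_XX z.2)).
  - apply: (measurableT_comp measurable_indicXX).
    by apply: measurableT_comp => //; exact: measurable_fst.
  - by [].
  - move=> z _; rewrite indicE; case: (boolP (z.2 \in XX)) => [/set_mem//|_].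
    by rewrite eqxx.
  rewrite (@single_mean i (fun z => \1_XX z.2)) => //; last first.
    exact: (measurableT_comp measurable_indicXX measurable_snd).
  apply: (@le_trans _ _ (\int[Q]_z 1%:E)%E); last by rewrite integral_probability_cst.
  apply: integral_real_le => //.
    exact: (measurableT_comp measurable_indicXX measurable_snd).
have m1 l e : measurable_fun setT
    (fun t : sample_WX => overlap_weight (tnth t l) (tnth t e) * weight t l e).
  by apply: measurable_funM; [exact: measurable_overlap_at|exact: measurable_weight].
have p1 l e (t : sample_WX) : 0 <= overlap_weight (tnth t l) (tnth t e) * weight t l e.
  by apply: mulr_ge0; [exact: overlap_weight_ge0|exact: weight_ge0].
have mw : measurable_fun setT (fun t : sample_WX =>
    overlap_weight (tnth t i) (tnth t i') * weight t i i' +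
    overlap_weight (tnth t i') (tnth t i) * weight t i' i).
  by apply: measurable_funD; exact: m1.
have pw (t : sample_WX) : 0 <=
    overlap_weight (tnth t i) (tnth t i') * weight t i i' +
    overlap_weight (tnth t i') (tnth t i) * weight t i' i.
  by apply: addr_ge0; exact: p1.
rewrite (sample_integralZ mw pw (near_coef_ge0 a20)).
rewrite (_ : Knear * _ = Kg ^+ 2 * Kexp (a / 2) * rho ^+ 2 *
   (S1 * (Kover * rho ^+ d) + S1 * (Kover * rho ^+ d))); last by rewrite /Knear; ring.
rewrite [leRHS]EFinM; apply: lee_wpmul2l; first by rewrite lee_fin; exact: near_coef_ge0.
rewrite (sample_integralD (m1 i i') (m1 i' i) (p1 i i') (p1 i' i)).
have ov l e : l != e -> (\int[P]_s (overlap_weight (tnth (smp s) l) (tnth (smp s) e) *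
    weight (smp s) l e)%:E <= (S1 * (Kover * rho ^+ d))%:E)%E.
  move=> le; apply: weight_mean (pair_overlap_mean le).
  - exact: measurable_overlap_weight.
  - exact: overlap_weight_ge0.
  move=> z z'; rewrite /overlap_weight; have [->|[_ [x1 _]]] := both_inP XX z z'; last by [].
  by rewrite mul0r eqxx.
by rewrite EFinD; apply: leeD; apply: ov => //; rewrite eq_sym.
Qed.

Lemma integral_far_bound i i' : i != i' ->
  (\int[P]_s (far_bound i i' (smp s))%:E <= (Kcross * rho ^+ 4)%:E)%E.
Proof.
move=> ii'; rewrite /far_bound (negbTE ii').
have m1 l e : measurable_fun setT
    (fun t : sample_WX => edge_weight (tnth t l) * edge_weight (tnth t e) * weight t l e).
  apply: measurable_funM; last exact: measurable_weight.
  by apply: measurable_funM; exact: measurable_edge_at.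
have e0 (t : sample_WX) l : 0 <= edge_weight (tnth t l) by exact: edge_weight_ge0.
have p1 l e (t : sample_WX) :
    0 <= edge_weight (tnth t l) * edge_weight (tnth t e) * weight t l e.
  by apply: mulr_ge0; [apply: mulr_ge0; exact: e0|exact: weight_ge0].
have K0 : 0 <= Kfar ^+ 2 by apply: exprn_ge0; exact: Kfar_ge0.
have E (t : sample_WX) : edge_weight (tnth t i) * edge_weight (tnth t i') *
    (weight t i i' + weight t i' i) =
    edge_weight (tnth t i) * edge_weight (tnth t i') * weight t i i' +
    edge_weight (tnth t i') * edge_weight (tnth t i) * weight t i' i.
  have swap (x y u v : R) : x * y * (u + v) = x * y * u + y * x * v by ring.
  exact: swap.
under eq_integral do rewrite E.
have mw : measurable_fun setT (fun t : sample_WX =>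
    edge_weight (tnth t i) * edge_weight (tnth t i') * weight t i i' +
    edge_weight (tnth t i') * edge_weight (tnth t i) * weight t i' i).
  by apply: measurable_funD; exact: m1.
have pw (t : sample_WX) : 0 <=
    edge_weight (tnth t i) * edge_weight (tnth t i') * weight t i i' +
    edge_weight (tnth t i') * edge_weight (tnth t i) * weight t i' i.
  by apply: addr_ge0; exact: p1.
rewrite (sample_integralZ mw pw K0).
rewrite (_ : Kcross * _ = Kfar ^+ 2 * (S1 * (Kedge * rho ^+ 2) ^+ 2 +
   S1 * (Kedge * rho ^+ 2) ^+ 2)); last by rewrite /Kcross; ring.
rewrite [leRHS]EFinM; apply: lee_wpmul2l; first by rewrite lee_fin; exact: K0.
rewrite (sample_integralD (m1 i i') (m1 i' i) (p1 i i') (p1 i' i)).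
have ed l e : l != e -> (\int[P]_s (edge_weight (tnth (smp s) l) * edge_weight (tnth (smp s) e) *
    weight (smp s) l e)%:E <= (S1 * (Kedge * rho ^+ 2) ^+ 2)%:E)%E.
  move=> le.
  apply: (@weight_mean l e (fun z z' => edge_weight z * edge_weight z')) (pair_edge_mean le).
  - by apply: measurable_funM; apply: measurableT_comp measurable_edge_weight _.
  - by move=> z z'; apply: mulr_ge0; exact: edge_weight_ge0.
  move=> z z'; rewrite /edge_weight indicE; case: (boolP (z.2 \in XX)) => [/set_mem//|_].
  by rewrite !mul0r eqxx.
by rewrite EFinD; apply: leeD; apply: ed => //; rewrite eq_sym.
Qed.

Let scale_sqE : rho ^+ 2 = (k%:R / N%:R) `^ (2 / d%:R).
Proof.
rewrite /scale -powR_mulrn ?powR_ge0// -powRrM; congr (_ `^ _).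
by rewrite mulrC.
Qed.

Let ratio01 : (0 < k%:R / N%:R :> R) && (k%:R / N%:R <= 1 :> R).
Proof.
rewrite divr_gt0 ?ltr0n//= ler_pdivrMr ?ltr0n// mul1r ler_nat; exact: kN.
Qed.

(** The exponent of [k / N] on the left is [1 + 2 / d], which is [3] if [d = 1] and at least
    [4 / d] if [d >= 2]. *)
Lemma rate_near : rho ^+ 2 * rho ^+ d <= (k%:R / N%:R) `^ Num.min 3 (4 / d%:R).
Proof.
have [q0 q1] := andP ratio01.
rewrite scaleXd ?(rd_dim rd)// scale_sqE -[X in _ * X](powRr1 (ltW q0)) -powRD; last first.
  by apply/implyP => _; rewrite gt_eqF.
apply: ger_powR; first exact: ratio01.
have [d1|d1] := eqVneq d 1%N; first by rewrite d1 ge_min; apply/orP; left; lra.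
rewrite ge_min; apply/orP; right.
have d2 : 2 <= d%:R :> R by rewrite ler_nat ltn_neqAle eq_sym d1 (rd_dim rd).
have dp : 0 < d%:R :> R by apply: lt_le_trans d2.
have u1 : 2 / d%:R <= 1 :> R by rewrite ler_pdivrMr// mul1r.
by rewrite (_ : 4 / d%:R = 2 / d%:R + 2 / d%:R); [rewrite lerD2l|field; rewrite gt_eqF].
Qed.

Lemma rate_far : rho ^+ 4 <= (k%:R / N%:R) `^ Num.min 3 (4 / d%:R).
Proof.
have [q0 q1] := andP ratio01.
rewrite (_ : rho ^+ 4 = (rho ^+ 2) ^+ 2); last by rewrite -exprM.
rewrite scale_sqE -powR_mulrn ?powR_ge0// -powRrM.
apply: ger_powR; first exact: ratio01.
rewrite ge_min; apply/orP; right; rewrite le_eqVlt; apply/orP; left; apply/eqP.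
by field; rewrite pnatr_eq0 -lt0n (rd_dim rd).
Qed.

Definition Kmoment : R := Kdiag + Knear + Kcross.

Lemma Kdiag_ge0 : 0 <= Kdiag.
Proof.
apply: mulr_ge0; last exact: S1_ge0.
by apply: mulr_ge0; [rewrite exprn_ge0 ?(rd_Kg rd)|exact: Kexp_ge0].
Qed.

Lemma Kover_ge0 : 0 <= Kover.
Proof.
have b0 : 0 < a / 2 / 2 ^+ d.
  by apply: divr_gt0; [apply: divr_gt0; [exact: a0|]|exact: exprn_gt0].
apply: divr_ge0.
  apply: mulr_ge0; first exact: rd_c2 rd.
  by apply: addr_ge0 => //; apply: divr_ge0 => //; exact: ltW.
by rewrite subr_ge0 expR_le1 oppr_le0 divr_ge0// ltW.
Qed.

Lemma Knear_ge0 : 0 <= Knear.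
Proof.
apply: mulr_ge0.
  by apply: mulr_ge0; [rewrite exprn_ge0 ?(rd_Kg rd)|apply: Kexp_ge0; rewrite divr_gt0].
by apply: mulr_ge0; [apply: mulr_ge0; [|exact: S1_ge0]|exact: Kover_ge0].
Qed.

Lemma Kcross_ge0 : 0 <= Kcross.
Proof.
apply: mulr_ge0; first by apply: exprn_ge0; exact: Kfar_ge0.
apply: mulr_ge0; first by apply: mulr_ge0 => //; exact: S1_ge0.
by apply: exprn_ge0; exact: Kedge_ge0.
Qed.

Lemma Kmoment_ge0 : 0 <= Kmoment.
Proof.
by apply: addr_ge0; [apply: addr_ge0; [exact: Kdiag_ge0|exact: Knear_ge0]|exact: Kcross_ge0].
Qed.

Lemma measurable_sym_bias_sq : measurable_fun setT sym_bias_sq.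
Proof.
apply: measurable_funM; first exact: measurable_cst.
apply: measurable_sum => q.
by apply: measurable_funD; [exact: measurable_near_term|exact: measurable_sym_far_term].
Qed.

(** The [N] diagonal terms are divided by [N ^ 2], and [1 / N <= k / N = rho ^+ d]. *)
Lemma moment_sum_le (r : R) : r = (k%:R / N%:R) `^ Num.min 3 (4 / d%:R) ->
  N%:R ^- 2 * \sum_(p : 'I_N * 'I_N)
     ((if p.1 == p.2 then Kdiag * rho ^+ 2 else Knear * (rho ^+ 2 * rho ^+ d)) +
      (if p.1 == p.2 then 0 else Kcross * rho ^+ 4)) <= Kmoment * r.
Proof.
move=> rE.
have r0 : 0 <= r by rewrite rE powR_ge0.
have A1 : Knear * (rho ^+ 2 * rho ^+ d) <= Knear * r.
  by apply: ler_wpM2l; [exact: Knear_ge0|rewrite rE; exact: rate_near].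
have A2 : Kcross * rho ^+ 4 <= Kcross * r.
  by apply: ler_wpM2l; [exact: Kcross_ge0|rewrite rE; exact: rate_far].
have n0 : 0 < N%:R :> R by rewrite ltr0n.
have A3 : Kdiag * rho ^+ 2 <= N%:R * (Kdiag * r).
  rewrite [leRHS]mulrCA; apply: ler_wpM2l; first exact: Kdiag_ge0.
  apply: (@le_trans _ _ (N%:R * (rho ^+ 2 * rho ^+ d))); last first.
    by apply: ler_wpM2l; [exact: ltW|rewrite rE; exact: rate_near].
  rewrite [leRHS]mulrCA ler_peMr ?exprn_ge0 ?(ltW rho0)//.
  rewrite scaleXd ?(rd_dim rd)// mulrCA divff ?mulr1 ?gt_eqF//.
  by rewrite ler1n; exact: k0.
have B1 : 0 <= Knear * r by apply: mulr_ge0 => //; exact: Knear_ge0.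
have B2 : 0 <= Kcross * r by apply: mulr_ge0 => //; exact: Kcross_ge0.
rewrite mulrC ler_pdivrMr ?exprn_gt0//.
pose D := N%:R * (Kdiag * r).
apply: (@le_trans _ _ (\sum_(p : 'I_N * 'I_N)
   ((if p.1 == p.2 then D else 0) + (Knear * r + Kcross * r)))).
  apply: ler_sum => -[i i'] _ /=; case: eqP => _.
    by rewrite addr0; apply: (le_trans A3); rewrite /D lerDl addr_ge0.
  by rewrite add0r lerD.
rewrite big_split /= sumr_const card_prod card_ord -(pair_bigA _
  (fun i i' : 'I_N => if i == i' then D else 0))/=.
have -> : \sum_(i < N) \sum_(j < N) (if i == j then D else 0) = N%:R * D.
  rewrite (eq_bigr (fun => D)) => [|i _]; first by rewrite sumr_const card_ord mulr_natl.
  by rewrite -big_mkcond/= (big_pred1 i)// => j; rewrite eq_sym.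
rewrite -[X in _ + X <= _]mulr_natl natrM /D /Kmoment le_eqVlt; apply/orP; left; apply/eqP.
by ring.
Qed.

(** Averaging the pointwise bound [sym_bias_sq_le] over the sample. *)
Theorem expectation_bias_sq_le :
  (\int[P]_s (bias (smp s) ^+ 2)%:E <=
   (Kmoment * (k%:R / N%:R) `^ Num.min 3 (4 / d%:R))%:E)%E.
Proof.
rewrite expectation_bias_sq.
have mb (p : 'I_N * 'I_N) :
    measurable_fun setT (fun t => near_bound p.1 p.2 t + far_bound p.1 p.2 t).
  by apply: measurable_funD; [exact: measurable_near_bound|exact: measurable_far_bound].
have pb (p : 'I_N * 'I_N) t : 0 <= near_bound p.1 p.2 t + far_bound p.1 p.2 t.
  by apply: addr_ge0; [exact: near_bound_ge0|exact: far_bound_ge0].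
have N2 : 0 <= N%:R ^- 2 :> R by rewrite invr_ge0 exprn_ge0.
have mS : measurable_fun setT (fun t => \sum_(p : 'I_N * 'I_N)
    (near_bound p.1 p.2 t + far_bound p.1 p.2 t)).
  by apply: measurable_sum => p; exact: mb.
have pS t : 0 <= \sum_(p : 'I_N * 'I_N) (near_bound p.1 p.2 t + far_bound p.1 p.2 t).
  by apply: sumr_ge0 => p _; exact: pb.
have mB : measurable_fun setT (fun s => (sym_bias_sq (smp s))%:E).
  by apply/measurable_EFinP; apply: measurable_smp; exact: measurable_sym_bias_sq.
apply: (le_trans (lee_abs _)); apply: (le_trans (le_abse_integral P measurableT mB)).
apply: (@le_trans _ _ (\int[P]_s (N%:R ^- 2 * \sum_(p : 'I_N * 'I_N)
    (near_bound p.1 p.2 (smp s) + far_bound p.1 p.2 (smp s)))%:E)%E).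
  apply: integral_real_le.
  - apply: (measurable_smp (h := fun t => `|sym_bias_sq t|)).
    by apply: measurableT_comp; [exact: normr_measurable|exact: measurable_sym_bias_sq].
  - apply: measurable_funM; first exact: measurable_cst.
    exact: (measurable_smp mS).
  - by move=> s; exact: normr_ge0.
  - by move=> s; exact: sym_bias_sq_le.
rewrite (sample_integralZ mS pS N2).
rewrite integral_real_sum; last 2 first.
- by move=> p; exact: (measurable_smp (mb p)).
- by move=> p s; exact: pb.
apply: (@le_trans _ _ ((N%:R ^- 2)%:E * (\sum_(p : 'I_N * 'I_N)
   ((if p.1 == p.2 then Kdiag * rho ^+ 2 else Knear * (rho ^+ 2 * rho ^+ d)) +
      (if p.1 == p.2 then 0 else Kcross * rho ^+ 4)))%:E)%E).
  apply: lee_wpmul2l; first by rewrite lee_fin.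
  rewrite -sumEFin; apply: lee_sum => p _.
  rewrite (sample_integralD (measurable_near_bound p.1 p.2) (measurable_far_bound p.1 p.2)
    (near_bound_ge0 p.1 p.2) (far_bound_ge0 p.1 p.2)) EFinD.
  apply: leeD; first exact: integral_near_bound.
  case: (boolP (p.1 == p.2)) => [/eqP E|]; last exact: integral_far_bound.
  by rewrite /far_bound E eqxx; rewrite integral0.
by rewrite -EFinM lee_fin; exact: moment_sum_le.
Qed.

End second_moment.

(** * From the population to the design constants *)
Section disintegration.
Context (R : realType) (d : nat).
Notation unit_WX := (bool * 'rV[R]_d)%type.
Notation la := (@lebesgue_rV R d).
Variables (Q : probability unit_WX R) (pr : bool -> R) (f : bool -> 'rV[R]_d -> R).
Hypotheses (pr0 : forall w, 0 <= pr w) (f0 : forall w x, 0 <= f w x).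
Hypothesis mf : forall w, measurable_fun setT (f w).
Hypothesis armQ : forall w A, measurable A ->
  (Q ([set w] `*` A) = (pr w)%:E * \int[la]_(x in A) (f w x)%:E)%E.

Let arm w : set unit_WX := [set w] `*` setT.

Let measurable_arm w : measurable (arm w).
Proof. exact: measurableX. Qed.

Let arm_law w : {measure set 'rV[R]_d -> \bar R} :=
  measure_function_pushforward__canonical__measure_function_Measure
    (mrestr Q (measurable_arm w)) (@measurable_snd _ _ bool 'rV[R]_d).

Lemma arm_lawE w A : measurable A ->
  arm_law w A = (\int[la]_(x in A) (pr w * f w x)%:E)%E.
Proof.
move=> mA; transitivity (Q ([set w] `*` A)).
  rewrite /arm_law/= /pushforward /mrestr; congr (Q _).
  by apply/seteqP; split=> [[v x] [/= ? [? _]]|[v x] [/= ? ?]].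
rewrite armQ// -ge0_integralZl_EFin//.
- by move=> x _; rewrite lee_fin.
- by apply/measurable_EFinP; exact: measurable_funTS.
Qed.

(** The restriction of [Q] to one arm is the image of a measure with a density. *)
Lemma disintegrate (psi : unit_WX -> \bar R) :
  measurable_fun setT psi -> (forall z, 0 <= psi z)%E ->
  (\int[Q]_z psi z = \sum_(w : bool) (pr w)%:E *
    \int[la]_y (psi (w, y) * (f w y)%:E))%E.
Proof.
move=> mpsi psi0.
have mpsiw w : measurable_fun setT (fun y => psi (w, y)) by exact: measurable_fun_pair2.
have mpsi2 w : measurable_fun setT (fun z : unit_WX => psi (w, z.2)).
  exact: measurableT_comp (mpsiw w) measurable_snd.
have mI w : measurable_fun setT (\1_(arm w) : unit_WX -> R) by exact: measurable_indic.
have splitE z : psi z = (\sum_(w : bool) psi (w, z.2) * (\1_(arm w) z)%:E)%E.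
  have inE (v w : bool) (x : 'rV[R]_d) : \1_(arm v) (w, x) = (w == v)%:R :> R.
    rewrite indicE; congr ((nat_of_bool _)%:R); apply/idP/eqP => [/set_mem[]//|<-].
    by apply/mem_set; split.
  by case: z => -[] x; rewrite big_bool/= !inE /= mule1 mule0 ?adde0 ?add0e.
transitivity (\int[Q]_z (\sum_(w : bool) psi (w, z.2) * (\1_(arm w) z)%:E))%E.
  by apply: eq_integral => z _; exact: splitE.
rewrite ge0_integral_sum//; last 2 first.
- by move=> w; apply: emeasurable_funM; [exact: mpsi2|exact/measurable_EFinP].
- by move=> w z _; rewrite mule_ge0// lee_fin.
apply: eq_bigr => w _.
transitivity (\int[mrestr Q (measurable_arm w)]_z psi (w, z.2))%E.
  apply/esym; apply: (ge0_integral_density (mI w)) => //.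
  by move=> A mA; rewrite integral_indic//= /mrestr setIC.
transitivity (\int[arm_law w]_y psi (w, y))%E.
  by rewrite /arm_law ge0_integral_pushforward.
rewrite (ge0_integral_density (f := fun y => pr w * f w y) (la := la))//; last 3 first.
- by apply: measurable_funM.
- by move=> x; rewrite mulr_ge0.
- by move=> A mA; exact: arm_lawE.
rewrite -ge0_integralZl_EFin//.
- by apply: eq_integral => y _; rewrite EFinM muleCA.
- by move=> y _; rewrite mule_ge0// lee_fin.
- by apply: emeasurable_funM => //; exact/measurable_EFinP.
Qed.

End disintegration.

Section compact_domain.
Context (R : realType) (d : nat).
Implicit Types (K : set 'rV[R]_d) (h : 'rV[R]_d -> R).
Notation la := (@lebesgue_rV R d).

Lemma compact_enorm_bound K : compact K ->
  exists2 M : R, 0 < M & forall x, K x -> enorm x <= M.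
Proof.
move=> cK; apply: (compact_uniform_bound (Q := fun M x => enorm x <= M) cK).
  by move=> M M' x MM' /le_trans; exact.
move=> a _; exists (`|enorm (a - 0)| + 1).
have := near_bounded (@enorm_sub_continuous R d 0 a).
apply: filterS => x; rewrite subr0; apply: le_trans; exact: ler_norm.
Qed.

Lemma compact_proper K : (0 < d)%N -> compact K -> ~` K !=set0.
Proof.
move=> d0 cK; have [M M0 hM] := compact_enorm_bound cK.
exists (const_mx (M + 1)) => /hM le_M.
have := le_trans (coord_le_enorm _ (Ordinal d0)) le_M; rewrite mxE ger0_norm; first by lra.
by rewrite addr_ge0// ltW.
Qed.

Lemma enorm_le_ediam K x y : compact K -> K x -> K y -> enorm (x - y) <= ediam K.
Proof.
move=> cK Kx Ky; have [M _ hM] := compact_enorm_bound cK.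
apply: ub_le_sup; last by exists x => //; exists y.
exists (M + M) => _ [u Ku [v Kv <-]].
by apply: le_trans (enormD _ _) _; rewrite enormN lerD ?hM.
Qed.

Lemma compact_measurable K : compact K -> measurable K.
Proof. by move=> cK; apply: closed_measurable_rV; apply: compact_closed cK; exact: norm_hausdorff. Qed.

(** A set of diameter zero lies in a ball of radius zero, which is negligible. *)
Lemma ediam_gt0 K : (0 < d)%N -> compact K -> (la K != 0)%E -> 0 < ediam K.
Proof.
move=> d0 cK; apply: contra_neqT; rewrite -leNgt => D0.
have mK := compact_measurable cK.
have [->|/set0P[x Kx]] := eqVneq K set0; first exact: measure0.
apply/eqP; rewrite eq_le measure_ge0 andbT.
apply: (@le_trans _ _ (la (eball x 0))).
  apply: le_measure; rewrite ?inE//; first exact: measurable_eball.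
  by move=> y Ky; apply: le_trans D0; exact: enorm_le_ediam.
by apply: le_trans (lebesgue_eball_le x (lexx 0)) _; rewrite mulr0 expr0n gtn_eqF.
Qed.

Lemma ball_volume_lower_bound K : (0 < d)%N -> ball_volume_regular K ->
  exists2 cv : R, 0 < cv & forall x r, K x -> 0 <= r <= ediam K ->
    ((cv * r ^+ d)%:E <= la (eball x r `&` K))%E.
Proof.
move=> d0 [c c0 hc]; exists (c * (2 / Num.sqrt d%:R) ^+ d).
  by rewrite mulr_gt0// exprn_gt0// divr_gt0// sqrtr_gt0 ltr0n.
move=> x r Kx /[dup] /andP[r0 _] rD; apply: le_trans (hc x r Kx rD).
rewrite -mulrA -exprMn EFinM lee_wpmul2l ?lee_fin ?(ltW c0)//.
exact: lebesgue_eball_ge.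
Qed.

(** The average of [h] over a ball around [x] so small that [h] varies there by at most
    [c / 2] is at least [c].  Volume regularity makes this ball non-negligible in [K]. *)
Lemma lipschitz_lower_bound K h c : (0 < d)%N -> compact K -> 0 < ediam K ->
  ball_volume_regular K -> measurable_fun setT h -> (forall x, 0 <= h x) ->
  lipschitz_on_set K h -> 0 < c ->
  (forall A, measurable A -> A `<=` K -> (c%:E * la A <= \int[la]_(x in A) (h x)%:E)%E) ->
  forall x, K x -> c / 2 <= h x.
Proof.
move=> d0 cK D0 /(ball_volume_lower_bound d0)[cv cv0 hcv] mh h0 [L hL] c0 hc x Kx.
pose L' := `|L| + 1; have L'0 : 0 < L' by rewrite ltr_wpDl.
(* on the ball of radius r, the function varies by at most c / 2 *)
pose r := Num.min (ediam K) (c / 2 / L').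
have r0 : 0 < r by rewrite lt_min D0/= !divr_gt0.
have rD : 0 <= r <= ediam K by rewrite ltW//= ge_min lexx.
have Lr : L' * r <= c / 2.
  by rewrite mulrC -ler_pdivlMr// ge_min lexx orbT.
pose A := eball x r `&` K.
have mA : measurable A.
  by apply: measurableI; [exact: measurable_eball|exact: compact_measurable].
have A0 : (0 < la A)%E.
  by apply: lt_le_trans (hcv x r Kx rD); rewrite lte_fin mulr_gt0// exprn_gt0.
have Aoo : (la A < +oo)%E.
  apply: (@le_lt_trans _ _ (la (eball x r))).
    by apply: le_measure; rewrite ?inE//; [exact: measurable_eball|exact: subIsetl].
  by apply: le_lt_trans (lebesgue_eball_le x (ltW r0)) _; rewrite ltry.
have := hc A mA (@subIsetr _ _ _); rewrite leNgt => /negP A1.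
rewrite leNgt; apply/negP => hx; apply: A1.
apply: (@le_lt_trans _ _ (\int[la]_(y in A) (h x + L' * r)%:E)%E).
  apply: ge0_le_integral => //.
  - by move=> y _; rewrite lee_fin.
  - by apply/measurable_EFinP; exact: measurable_funTS.
  move=> y [xy Ky]; rewrite lee_fin -lerBlDl.
  apply: le_trans (ler_norm _) _; apply: le_trans (hL y x Ky Kx) _.
  apply: (@le_trans _ _ (L' * enorm (y - x))).
    by rewrite ler_wpM2r ?enorm_ge0// /L' (le_trans (ler_norm _))// lerDl.
  by rewrite ler_wpM2l ?(ltW L'0).
rewrite integral_cst// lte_pmul2r//; last by rewrite ge0_fin_numE.
by rewrite lte_fin; move: Lr hx; lra.
Qed.

End compact_domain.

Lemma measure_le_setU dT (T : measurableType dT) (R : realType)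
    (mu : {measure set T -> \bar R}) (A B C : set T) :
  measurable A -> measurable B -> measurable C -> A `<=` B `|` C ->
  (mu A <= mu B + mu C)%E.
Proof.
move=> mA mB mC ABC; apply: (@le_trans _ _ (mu (B `|` C))); last exact: measureU2.
by apply: le_measure; rewrite ?inE//; exact: measurableU.
Qed.

Section population.
Context (R : realType) (d : nat) disp (Omega : measurableType disp).
Notation unit_WX := (bool * 'rV[R]_d)%type.
Notation la := (@lebesgue_rV R d).
Variables (P : probability Omega R).

Lemma measurable_arm_position (Z : {RV P >-> unit_data R d}) :
  measurable_fun setT (fun s => (Z s).1).
Proof. exact: measurableT_comp measurable_fst (measurable_funP Z). Qed.

Definition arm_position (Z : {RV P >-> unit_data R d}) : {mfun Omega >-> unit_WX} :=
  HB.pack (fun s => (Z s).1)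
    (isMeasurableFun.Build _ _ _ _ (fun s => (Z s).1) (measurable_arm_position Z)).

Definition unit_law Z : probability unit_WX R := distribution P (arm_position Z).

Lemma unit_lawE Z w A : unit_law Z ([set w] `*` A) =
  P ((treatment \o Z) @^-1` [set w] `&` (covariate \o Z) @^-1` A).
Proof. by []. Qed.

Lemma iid_sample_units N (S : 'I_N -> {RV P >-> unit_data R d}) Z :
  (forall i, identically_distributed (S i) Z) -> mutually_independent S ->
  iid_sample P (unit_law Z) (fun i s => (S i s).1).
Proof.
move=> idS inS.
have mfst A : measurable A ->
    measurable ((fst : unit_data R d -> unit_WX) @^-1` A).
  by move=> mA; rewrite -[X in measurable X]setTI; exact: measurable_fst.
have lawE i A : measurable A -> P ((fun s => (S i s).1) @^-1` A) = unit_law Z A.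
  by move=> mA; exact: idS i _ (mfst A mA).
split=> [i|//|A mA]; first exact: measurable_arm_position.
transitivity (\prod_(i < N) P (S i @^-1` (fst @^-1` A i)))%E.
  by apply: (inS (fun i => fst @^-1` A i)) => i; exact: mfst.
by apply: eq_bigr => i _; exact: lawE.
Qed.

Variable Z : {RV P >-> unit_data R d}.
Variables (XX : set 'rV[R]_d) (eta : R).
Hypothesis supp : XX = support_covariate Z.
Hypothesis mXX : measurable XX.

Lemma measurable_treatment : measurable_fun setT (treatment \o Z).
Proof. exact: measurableT_comp measurable_fst (measurable_arm_position Z). Qed.

Lemma measurable_covariate : measurable_fun setT (covariate \o Z).
Proof. exact: measurableT_comp measurable_snd (measurable_arm_position Z). Qed.

Let X := covariate \o Z.
Let W := treatment \o Z.

Let mX A : measurable A -> measurable (X @^-1` A).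
Proof. by move=> mA; rewrite -[X in measurable X]setTI; exact: measurable_covariate. Qed.

Let mW w : measurable (W @^-1` [set w]).
Proof. by rewrite -[X in measurable X]setTI; exact: measurable_treatment. Qed.

Let mapX : {mfun Omega >-> 'rV[R]_d} :=
  HB.pack X (isMeasurableFun.Build _ _ _ _ X measurable_covariate).

Lemma covariate_in_support : P (X @^-1` (~` XX)) = 0%E.
Proof.
have := support_conegligible (mu := distribution P mapX) supp.
by move=> [B [mB B0 sB]]; apply: (subset_measure0 (mX (measurableC mXX)) (mX mB)) => // s; exact: sB.
Qed.

Hypothesis dens : bounded_density Z XX.
Hypothesis over : overlap Z XX eta.
Hypothesis eta0 : 0 < eta.

Lemma law_covariate_dominated A : measurable A -> la A = 0%E -> P (X @^-1` A) = 0%E.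
Proof.
move=> mA A0; case: dens => h [[mh h0 hE] _].
rewrite -[LHS]/(law_covariate Z A) hE//; apply: null_set_integral => //.
by apply/measurable_EFinP; exact: measurable_funTS.
Qed.

(** Integrating the propensity score over [A]: it lies between [eta] and [1 - eta] outside a
    Lebesgue-null set, which the law of the covariate does not charge. *)
Lemma overlap_mass w A : measurable A ->
  (eta%:E * P (X @^-1` A) <= P (W @^-1` [set w] `&` X @^-1` A))%E.
Proof.
move=> mA; case: over => e [[We me eE] [B [mB B0 hB]]].
(* the part of the support where the bounds on the propensity score hold *)
pose G := XX `\` B.
have mG : measurable G by exact: measurableD.
have nG : P (X @^-1` (~` G)) = 0%E.
  apply/eqP; rewrite eq_le measure_ge0 andbT.
  apply: (@le_trans _ _ (P (X @^-1` (~` XX)) + P (X @^-1` B))%E).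
    apply: measure_le_setU; [exact: mX (measurableC mG)|exact: mX (measurableC mXX)|exact: mX|].
    by rewrite -preimage_setU; apply: preimage_subset; rewrite /G setDE setCI setCK.
  by rewrite covariate_in_support law_covariate_dominated// adde0.
have Ge x : G x -> eta < e x < 1 - eta.
  move=> [Xx nB]; apply: contrapT => ne; apply: nB; apply: hB => /= H.
  by apply: ne; exact: H.
have red C : measurable C -> P (C `&` X @^-1` A) = P (C `&` X @^-1` (A `&` G)).
  move=> mC; apply/eqP; rewrite eq_le; apply/andP; split; last first.
    apply: le_measure; rewrite ?inE; [| |by move=> s /= [? []]];
      by apply: measurableI => //; apply: mX => //; exact: measurableI.
  rewrite -[leRHS]adde0 -nG; apply: measure_le_setU.
  - by apply: measurableI => //; exact: mX.
  - by apply: measurableI => //; apply: mX; exact: measurableI.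
  - exact: mX (measurableC mG).
  - by move=> s /= [Cs As]; have [Gs|nGs] := pselect (G (X s)); [left|right].
have mAG : measurable (X @^-1` (A `&` G)) by apply: mX; exact: measurableI.
have := red setT measurableT; rewrite !setTI => ->; rewrite red//.
have eM : measurable_fun (X @^-1` (A `&` G)) (fun s => (e (X s))%:E).
  apply/measurable_EFinP; apply: measurable_funTS.
  exact: measurableT_comp me measurable_covariate.
have treatedE : (P (W @^-1` [set true] `&` X @^-1` (A `&` G)) =
    \int[P]_(s in X @^-1` (A `&` G)) (e (X s))%:E)%E.
  rewrite -eE; last exact: measurableI.
  rewrite -integral_indic//; apply: eq_integral => s _.
  rewrite indicE /=; congr ((nat_of_bool _)%:R%:E).
  by apply/idP/idP => [/set_mem //|h]; exact: mem_set.
have treated_ge : (eta%:E * P (X @^-1` (A `&` G)) <=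
    P (W @^-1` [set true] `&` X @^-1` (A `&` G)))%E.
  rewrite treatedE -integral_cst//; apply: ge0_le_integral => //.
  - by move=> s _; rewrite lee_fin ltW.
  - by move=> s [_ /Ge /andP[e1 _]]; rewrite lee_fin ltW.
case: w => //.
have treated_le : (P (W @^-1` [set true] `&` X @^-1` (A `&` G)) <=
    (1 - eta)%:E * P (X @^-1` (A `&` G)))%E.
  rewrite treatedE -integral_cst//; apply: ge0_le_integral => //.
  - by move=> s [_ /Ge /andP[e1 _]]; rewrite lee_fin ltW// (lt_trans eta0).
  - by move=> s [_ /Ge /andP[_ e2]]; rewrite lee_fin ltW.
have sumE : (P (X @^-1` (A `&` G)) = P (W @^-1` [set true] `&` X @^-1` (A `&` G)) +
    P (W @^-1` [set false] `&` X @^-1` (A `&` G)))%E.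
  rewrite -measureU; [|by apply: measurableI|by apply: measurableI|].
    congr (P _); rewrite -setIUl; apply/seteqP; split=> [s ?|s [_ ?]]//.
    by split=> //=; case: (W s); [left|right].
  apply/seteqP; split=> // s [[/= h1 _] [/= h2 _]].
  by move: h1; rewrite h2.
have fin C : measurable C -> P C = (fine (P C))%:E.
  by move=> mC; rewrite fineK// fin_num_measure.
move: treated_le sumE.
rewrite (fin (X @^-1` _))// (fin (W @^-1` [set true] `&` _)); last exact: measurableI.
rewrite (fin (W @^-1` [set false] `&` _)); last exact: measurableI.
by rewrite -!EFinM -EFinD !lee_fin => h1 [] h2; move: h1; rewrite h2; lra.
Qed.

Definition arm_prob (w : bool) : R := fine (P (W @^-1` [set w])).

Lemma arm_probE w : P (W @^-1` [set w]) = (arm_prob w)%:E.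
Proof. by rewrite fineK// fin_num_measure. Qed.

Lemma arm_prob_ge w : eta <= arm_prob w.
Proof.
have := overlap_mass w measurableT; rewrite preimage_setT probability_setT mule1 setIT.
by rewrite arm_probE lee_fin.
Qed.

Lemma arm_prob_le1 w : arm_prob w <= 1.
Proof. by rewrite -lee_fin -arm_probE; exact: probability_le1. Qed.

Lemma arm_prob_gt0 w : 0 < arm_prob w.
Proof. exact: lt_le_trans eta0 (arm_prob_ge w). Qed.

(** The bound on the density holds almost everywhere on the support, so it is integrated
    after removal of the exceptional set. *)
Lemma covariate_mass_ge : exists2 lo : R, 0 < lo &
  forall A, measurable A -> A `<=` XX -> (lo%:E * la A <= P (X @^-1` A))%E.
Proof.
case: dens => h [[mh h0 hE] [lo [hi [lo0 _ [B [mB B0 hB]]]]]].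
exists lo => // A mA AXX.
have mAB : measurable (A `\` B) by exact: measurableD.
apply: (@le_trans _ _ (lo%:E * la (A `\` B))%E).
  apply: lee_wpmul2l; first by rewrite lee_fin ltW.
  rewrite -[leRHS]adde0 -B0; apply: measure_le_setU => //.
  by move=> x Ax; have [Bx|nBx] := pselect (B x); [right|left].
apply: (@le_trans _ _ (P (X @^-1` (A `\` B)))); last first.
  by apply: le_measure; rewrite ?inE; [exact: mX|exact: mX|move=> s []].
rewrite -[leRHS]/(law_covariate Z (A `\` B)) hE// -integral_cst//.
apply: ge0_le_integral => //.
- by move=> x _; rewrite lee_fin ltW.
- by apply/measurable_EFinP; exact: measurable_funTS.
move=> x [Ax nBx]; rewrite lee_fin; apply: contrapT => /negP; rewrite -ltNge => hx.
apply: nBx; apply: hB => /= /(_ (AXX _ Ax)) /andP[+ _].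
by apply/negP; rewrite -ltNge.
Qed.

Lemma support_mass : la XX != 0%E.
Proof.
apply/eqP => XX0; have PX := law_covariate_dominated mXX XX0.
have : (P setT <= P (X @^-1` XX) + P (X @^-1` (~` XX)))%E.
  apply: measure_le_setU => //; [exact: mX|exact: mX (measurableC mXX)|].
  by move=> s _; have [h|h] := pselect (XX (X s)); [left|right].
by rewrite PX covariate_in_support adde0 probability_setT lee_fin ler10.
Qed.

Variable f : bool -> 'rV[R]_d -> R.
Hypothesis fdens : forall w, is_density (law_covariate_given Z w) (f w).

Lemma arm_lawP w A : measurable A ->
  (unit_law Z ([set w] `*` A) = (arm_prob w)%:E * \int[la]_(x in A) (f w x)%:E)%E.
Proof.
move=> mA; case: (fdens w) => _ _ <- //; rewrite unit_lawE /law_covariate_given.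
rewrite arm_probE inver gt_eqF ?arm_prob_gt0//.
rewrite muleCA -EFinM divff ?mule1// gt_eqF// arm_prob_gt0//.
Qed.

(** By overlap, an arm receives at least the proportion [eta] of the mass of any set. *)
Lemma density_mass_ge : exists2 lo : R, 0 < lo & forall w A, measurable A -> A `<=` XX ->
  (lo%:E * la A <= \int[la]_(x in A) (f w x)%:E)%E.
Proof.
have [lo lo0 hlo] := covariate_mass_ge; exists (eta * lo); first exact: mulr_gt0.
move=> w A mA AXX; case: (fdens w) => _ f0 _.
have I0 : (0 <= \int[la]_(x in A) (f w x)%:E)%E.
  by apply: integral_ge0 => x _; rewrite lee_fin.
apply: (@le_trans _ _ ((arm_prob w)%:E * \int[la]_(x in A) (f w x)%:E)%E); last first.
  by rewrite -[leRHS]mul1e lee_wpmul2r// lee_fin arm_prob_le1.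
rewrite -arm_lawP// unit_lawE; apply: le_trans (overlap_mass w mA).
by rewrite EFinM -muleA lee_wpmul2l ?lee_fin ?(ltW eta0)//; exact: hlo.
Qed.

End population.

Section constants.
Context (R : realType) (d : nat).
Notation la := (@lebesgue_rV R d).
Variables (XX : set 'rV[R]_d) (eta : R) (f g : bool -> 'rV[R]_d -> R).

(** Constants for [regular_design] and [sampling] that refer to the support, the arm densities
    and the regression functions only; [eta] bounds the arm probabilities from below. *)
Record design_constants (lo hi Kg K2 Kf cv M : R) : Prop := DesignConstants {
  dc_regular : regular_design XX f g (ediam XX) lo hi Kg K2 Kf
    (eta * lo * cv) (2 * hi * 2 ^+ d) (2 * M);
  dc_volume : forall x r, XX x -> 0 <= r <= ediam XX ->
    ((cv * r ^+ d)%:E <= la (eball x r `&` XX))%E;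
  dc_boundary : forall w L, 0 < L ->
    (\int[la]_(x in XX) (expR (- L * bdist XX x ^+ d) * f w x)%:E
      <= (M * L^-1 `^ d%:R^-1)%:E)%E }.

Lemma boundary_supP : (0 < d)%N -> (boundary_sup XX f < +oo)%E ->
  exists2 M : R, 0 <= M & forall w L, 0 < L ->
    (\int[la]_(x in XX) (expR (- L * bdist XX x ^+ d) * f w x)%:E
      <= (M * L^-1 `^ d%:R^-1)%:E)%E.
Proof.
move=> d0 supoo; have [M M0 supM] : exists2 M : R, 0 <= M & (boundary_sup XX f <= M%:E)%E.
  move: supoo; case: (boundary_sup XX f) => [r _|//|_]; last by exists 0; rewrite ?leNye.
  by exists (Num.max 0 r); rewrite ?le_max ?lexx// lee_fin le_max lexx orbT.
exists M => // w L L0; set I := (\int[_]_(_ in _) _)%E.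
have LI : ((L `^ d%:R^-1)%:E * I <= M%:E)%E.
  by apply: le_trans supM; apply: ereal_sup_ubound; exists (L, w).
have L'0 : 0 < L `^ d%:R^-1 by rewrite powR_gt0.
have -> : L^-1 `^ d%:R^-1 = (L `^ d%:R^-1)^-1.
  apply: (mulIf (lt0r_neq0 L'0)); rewrite mulVf ?gt_eqF// -powRM ?invr_ge0 ?(ltW L0)//.
  by rewrite mulVf ?gt_eqF// powR1.
by rewrite EFinM muleC lee_pdivlMl.
Qed.

Lemma lipschitz_family (h : bool -> 'rV[R]_d -> R) :
  (forall w, exists2 K : R, 0 < K & forall x y, XX x -> XX y ->
     `|h w x - h w y| <= K * enorm (x - y)) ->
  exists2 K : R, 0 <= K & forall w x y, XX x -> XX y ->
     `|h w x - h w y| <= K * enorm (x - y).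
Proof.
move=> hw; have [K0 K00 h0] := hw false; have [K1 K10 h1] := hw true.
exists (K0 + K1); first by rewrite addr_ge0// ltW.
move=> w x y Xx Xy; have e0 := enorm_ge0 (x - y).
case: w; [apply: le_trans (h1 x y Xx Xy) _|apply: le_trans (h0 x y Xx Xy) _];
  by apply: ler_wpM2r => //; rewrite ?lerDl ?lerDr ltW.
Qed.

Lemma smooth_lipschitz : compact XX -> smooth_regression XX g ->
  exists2 K : R, 0 <= K & forall w x y, XX x -> XX y ->
    `|g w x - g w y| <= K * enorm (x - y).
Proof.
move=> cXX [U [oU _ XU hU]]; apply: lipschitz_family => w.
have [h Ch gh] := hU w; have [K K0 hK] := C2_lipschitz cXX oU XU Ch.
by exists K => // x y Xx Xy; rewrite !gh//; exact: hK.
Qed.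

Lemma smooth_second_difference : compact XX -> smooth_regression XX g ->
  exists2 K : R, 0 <= K & forall w x v, XX x -> XX (x + v) -> XX (x - v) ->
    `|g w (x + v) + g w (x - v) - 2 * g w x| <= K * enorm v ^+ 2.
Proof.
move=> cXX [U [oU _ XU hU]].
have one w : exists2 K : R, 0 < K & forall x v, XX x -> XX (x + v) -> XX (x - v) ->
    `|g w (x + v) + g w (x - v) - 2 * g w x| <= K * enorm v ^+ 2.
  have [h Ch gh] := hU w; have [K K0 hK] := C2_second_difference cXX oU XU Ch.
  by exists K => // x v Xx X1 X2; rewrite !gh//; exact: hK.
have [K0 K00 h0] := one false; have [K1 K10 h1] := one true.
exists (K0 + K1); first by rewrite addr_ge0// ltW.
move=> w x v Xx X1 X2; have e0 : 0 <= enorm v ^+ 2 by rewrite exprn_ge0 ?enorm_ge0.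
case: w; [apply: le_trans (h1 x v Xx X1 X2) _|apply: le_trans (h0 x v Xx X1 X2) _];
  by apply: ler_wpM2r => //; rewrite ?lerDl ?lerDr ltW.
Qed.

Lemma lipschitz_on_setP h : lipschitz_on_set XX h ->
  exists2 K : R, 0 < K & forall x y, XX x -> XX y -> `|h x - h y| <= K * enorm (x - y).
Proof.
move=> [K hK]; exists (`|K| + 1); first by rewrite ltr_wpDl.
move=> x y Xx Xy; apply: le_trans (hK x y Xx Xy) _.
by rewrite ler_wpM2r ?enorm_ge0// (le_trans (ler_norm _))// lerDl.
Qed.

Lemma lipschitz_bounded (h : bool -> 'rV[R]_d -> R) (K : R) : compact XX ->
  0 <= K -> (forall w x y, XX x -> XX y -> `|h w x - h w y| <= K * enorm (x - y)) ->
  exists2 hi : R, 0 <= hi & forall w x, XX x -> h w x <= hi.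
Proof.
move=> cXX K0 hK; have [e|/set0P[x0 Xx0]] := eqVneq XX set0.
  by exists 0 => // w x; rewrite e.
exists (`|h false x0| + `|h true x0| + K * ediam XX).
  rewrite addr_ge0 ?addr_ge0// mulr_ge0//.
  by apply: le_trans (enorm_le_ediam cXX Xx0 Xx0); exact: enorm_ge0.
move=> w x Xx.
have h1 : h w x - h w x0 <= K * ediam XX.
  apply: le_trans (ler_norm _) _; apply: le_trans (hK w x x0 Xx Xx0) _.
  by rewrite ler_wpM2l//; exact: enorm_le_ediam.
have n0 := normr_ge0 (h false x0); have n1 := normr_ge0 (h true x0).
by case: w h1; have := ler_norm (h false x0); have := ler_norm (h true x0); lra.
Qed.

Context disp (Omega : measurableType disp) (P : probability Omega R).
Variable Z : {RV P >-> unit_data R d}.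
Hypotheses (d0 : (0 < d)%N) (eta0 : 0 < eta).
Hypothesis reg : forall w, is_cond_expectation P (covariate \o Z) (outcome w \o Z) (g w).
Hypothesis supp : XX = support_covariate Z.
Hypothesis cXX : compact XX.
Hypothesis vol : ball_volume_regular XX.
Hypothesis dens : bounded_density Z XX.
Hypothesis over : overlap Z XX eta.
Hypothesis smooth : smooth_regression XX g.
Hypothesis fdens : forall w, is_density (law_covariate_given Z w) (f w) /\
  lipschitz_on_set XX (f w).
Hypothesis bd : (boundary_sup XX f < +oo)%E.

Let mXX := compact_measurable cXX.
Let fd w := proj1 (fdens w).

(** The constants do not mention the population, but their existence uses it: the densities
    of the arms are bounded below on the support because of overlap and of the bound on
    the density of the covariate. *)
Lemma exists_design_constants :
  exists lo hi Kg K2 Kf cv M : R, design_constants lo hi Kg K2 Kf cv M.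
Proof.
have [lo lo0 hlo] := density_mass_ge supp mXX dens over eta0 fd.
have D0 := ediam_gt0 d0 cXX (support_mass supp mXX dens).
have [cv cv0 hcv] := ball_volume_lower_bound d0 vol.
have [M M0 hM] := boundary_supP d0 bd.
have [Kg Kg0 hKg] := smooth_lipschitz cXX smooth.
have [K2 K20 hK2] := smooth_second_difference cXX smooth.
have [Kf Kf0 hKf] := lipschitz_family (fun w => lipschitz_on_setP (proj2 (fdens w))).
have [hi hi0 hhi] := lipschitz_bounded cXX Kf0 hKf.
exists (lo / 2), hi, Kg, K2, Kf, cv, M; split=> //; split=> //.
- exact: compact_proper.
- by move=> x y; exact: enorm_le_ediam.
- exact: divr_gt0.
- by rewrite !mulr_gt0// invr_gt0.
- by rewrite !mulr_ge0.
- exact: mulr_ge0.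
- by move=> w; case: (fd w).
- by move=> w x; case: (fd w).
- by move=> w; case: (reg w).
move=> w x Xx; rewrite hhi// andbT.
case: (fd w) => mf f0 _.
apply: (lipschitz_lower_bound d0 cXX D0 vol mf f0 (proj2 (fdens w)) lo0 _ Xx) => A mA AX.
exact: hlo.
Qed.

End constants.

Section sampling_of_population.
Context (R : realType) (d : nat).
Notation la := (@lebesgue_rV R d).
Variables (XX : set 'rV[R]_d) (eta : R) (f g : bool -> 'rV[R]_d -> R).
Variables (lo hi Kg K2 Kf cv M : R).
Hypothesis dc : design_constants XX eta f g lo hi Kg K2 Kf cv M.
Context disp (Omega : measurableType disp) (P : probability Omega R).
Variable Z : {RV P >-> unit_data R d}.
Hypotheses (d0 : (0 < d)%N) (eta0 : 0 < eta).
Hypothesis supp : XX = support_covariate Z.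
Hypothesis dens : bounded_density Z XX.
Hypothesis over : overlap Z XX eta.
Hypothesis fdens : forall w, is_density (law_covariate_given Z w) (f w).

Let rd := dc_regular dc.
Let mXX := rd_closed rd.
Notation Q := (unit_law Z).

Let armQ w A : measurable A ->
  (Q ([set w] `*` A) = (arm_prob Z w)%:E * \int[la]_(x in A) (f w x)%:E)%E.
Proof. exact (arm_lawP supp mXX dens over eta0 fdens w (A := A)). Qed.

Let ge_eta w : eta <= arm_prob Z w. Proof. exact: arm_prob_ge supp mXX dens over eta0 w. Qed.

Lemma unit_mass_ge w x r : XX x -> 0 <= r <= ediam XX ->
  ((eta * lo * cv * r ^+ d)%:E <= Q [set z | z.1 = w /\ (enorm (z.2 - x) <= r)%R])%E.
Proof.
move=> Xx rD; have mB := measurable_eball x r.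
rewrite (_ : [set z | _] = [set w] `*` eball x r); last by apply/seteqP; split=> -[].
rewrite armQ//.
have mBX : measurable (eball x r `&` XX) by exact: measurableI.
have mf v := rd_mf rd v; have f0 v y := rd_f0 rd v y.
have lo0 := rd_lo rd.
apply: (@le_trans _ _ (eta%:E * (lo%:E * la (eball x r `&` XX)))%E).
  rewrite -!mulrA EFinM lee_wpmul2l ?lee_fin ?(ltW eta0)// EFinM.
  by rewrite lee_wpmul2l ?lee_fin ?(ltW lo0)//; exact: (dc_volume dc).
apply: (@le_trans _ _ (eta%:E * \int[la]_(x in eball x r) (f w x)%:E)%E); last first.
  rewrite lee_wpmul2r ?lee_fin//; apply: integral_ge0 => y _; rewrite lee_fin//.
rewrite lee_wpmul2l ?lee_fin ?(ltW eta0)//.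
apply: (@le_trans _ _ (\int[la]_(x in eball x r `&` XX) (f w x)%:E)%E).
  rewrite -integral_cst//; apply: ge0_le_integral => //.
  - by move=> y _; rewrite lee_fin ltW.
  - by apply/measurable_EFinP; exact: measurable_funTS.
  - by move=> y [_ Xy]; rewrite lee_fin; case/andP: (rd_f_bounds rd w Xy).
apply: ge0_subset_integral => //; last first.
- by move=> y _; rewrite lee_fin.
- by apply/measurable_EFinP; exact: measurable_funTS.
Qed.

Lemma arm_mass_le w A : measurable A -> A `<=` XX -> (Q ([set w] `*` A) <= hi%:E * la A)%E.
Proof.
move=> mA AX; rewrite armQ//.
have mf v := rd_mf rd v; have f0 v y := rd_f0 rd v y.
apply: (@le_trans _ _ (\int[la]_(x in A) (f w x)%:E)%E).
  rewrite -[leRHS]mul1e lee_wpmul2r//; first by apply: integral_ge0 => y _; rewrite lee_fin.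
  by rewrite lee_fin arm_prob_le1.
rewrite -integral_cst//; apply: ge0_le_integral => //.
- by move=> y _; rewrite lee_fin.
- by apply/measurable_EFinP; exact: measurable_funTS.
- move=> y Ay; rewrite lee_fin.
  by case/andP: (rd_f_bounds rd w (AX _ Ay)).
Qed.

Lemma unit_mass_le x r : 0 <= r ->
  (Q [set z | XX z.2 /\ (enorm (z.2 - x) <= r)%R] <= (2 * hi * 2 ^+ d * r ^+ d)%:E)%E.
Proof.
move=> r0; pose A := XX `&` eball x r; have mB := measurable_eball x r.
have mA : measurable A by exact: measurableI.
rewrite (_ : [set z | _] = setT `*` A); last first.
  by apply/seteqP; split=> -[w y] /= => [|[_]].
have hi0 : 0 <= hi.
  by have := rd_c2 rd; rewrite pmulr_lge0 ?exprn_gt0// pmulr_rge0.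
have laA : (la A <= ((2 * r) ^+ d)%:E)%E.
  apply: le_trans (lebesgue_eball_le x r0).
  by apply: le_measure; rewrite ?inE//; exact: subIsetr.
have arm w : (Q ([set w] `*` A) <= (hi * (2 * r) ^+ d)%:E)%E.
  apply: le_trans (arm_mass_le w mA (@subIsetl _ _ _)) _.
  by rewrite EFinM lee_wpmul2l// lee_fin.
apply: (@le_trans _ _ (Q ([set true] `*` A) + Q ([set false] `*` A))%E).
  apply: measure_le_setU; try exact: measurableX.
  by move=> [[] y] [_ Ay]; [left|right].
apply: le_trans (leeD (arm true) (arm false)) _.
by rewrite -EFinD lee_fin exprMn le_eqVlt; apply/orP; left; apply/eqP; ring.
Qed.

Lemma unit_boundary L : 0 < L ->
  (\int[Q]_z (\1_XX z.2 * expR (- L * bdist XX z.2 ^+ d))%:E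
    <= (2 * M * L^-1 `^ d%:R^-1)%:E)%E.
Proof.
move=> L0; have mf v := rd_mf rd v; have f0 v y := rd_f0 rd v y.
pose b (y : 'rV[R]_d) := expR (- L * bdist XX y ^+ d).
have mb : measurable_fun setT b.
  apply: (measurableT_comp (@measurable_expR R)); apply: measurable_funM => //.
  by apply: measurable_funX; exact: measurable_dist_to (rd_proper rd).
have mI : measurable_fun setT (\1_XX : 'rV[R]_d -> R) by exact: measurable_indic.
have mIb : measurable_fun setT (fun y => \1_XX y * b y) by exact: measurable_funM.
rewrite (disintegrate (fun w => le_trans (ltW eta0) (ge_eta w)) f0 mf armQ); last 2 first.
- by apply/measurable_EFinP; exact: (measurableT_comp mIb measurable_snd).
- by move=> z; rewrite lee_fin mulr_ge0// expR_ge0.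
have arm w : ((arm_prob Z w)%:E * \int[la]_y ((\1_XX y * b y)%:E * (f w y)%:E)%E <=
    (M * L^-1 `^ d%:R^-1)%:E)%E.
  apply: le_trans (dc_boundary dc w L0).
  have -> : (\int[la]_(x in XX) (b x * f w x)%:E =
      \int[la]_y ((\1_XX y * b y)%:E * (f w y)%:E))%E.
    rewrite integral_mkcond epatch_indic; apply: eq_integral => y _.
    by rewrite -!EFinM mulrC mulrA.
  rewrite -[leRHS]mul1e lee_wpmul2r ?lee_fin ?arm_prob_le1//.
  by apply: integral_ge0 => y _; rewrite mule_ge0 ?lee_fin ?mulr_ge0 ?expR_ge0.
rewrite big_bool/=; apply: le_trans (leeD (arm true) (arm false)) _.
by rewrite -EFinD lee_fin le_eqVlt; apply/orP; left; apply/eqP; ring.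
Qed.

Lemma sampling_units N (S : 'I_N -> {RV P >-> unit_data R d}) :
  (forall i, identically_distributed (S i) Z) -> mutually_independent S ->
  sampling XX f (ediam XX) (eta * lo * cv) (2 * hi * 2 ^+ d) (2 * M) P (unit_law Z)
    (fun i s => (S i s).1) (arm_prob Z).
Proof.
move=> idS inS; split.
- exact: iid_sample_units.
- by move=> w; exact: le_trans (ltW eta0) (ge_eta w).
- move=> psi mpsi psi0.
  exact (disintegrate (fun w => le_trans (ltW eta0) (ge_eta w)) (rd_f0 rd) (rd_mf rd) armQ
    mpsi psi0).
- by move=> w x r Xx rD; exact: unit_mass_ge.
- by move=> x r r0; exact: unit_mass_le.
- exact: unit_boundary.
Qed.

End sampling_of_population.

(** * The matching estimator *)
Section matching_estimator.
Context (R : realType) (d : nat).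
Notation unit_WX := (bool * 'rV[R]_d)%type.
Variables (XX : set 'rV[R]_d) (g : bool -> 'rV[R]_d -> R) (k : nat).
Hypothesis k0 : (0 < k)%N.

(** The same as [bias] without the restriction to the support, so that it agrees everywhere
    with the bias of the matching estimator. *)
Definition sample_bias N (t : N.-tuple unit_WX) : R :=
  N%:R^-1 * \sum_(i < N) arm_sign t i * (k%:R^-1 * \sum_(j < N) (matched k t i j)%:R *
    (g (arm_of t j) (pos_of t i) - g (arm_of t j) (pos_of t j))).

Lemma matching_bias_sample N (t : N.-tuple unit_WX) :
  matching_bias (arm_of t) (pos_of t) g k = sample_bias t.
Proof.
rewrite matching_biasE//; case: ifPn => [en|nen]; last first.
  rewrite /sample_bias big1 ?mulr0// => i _; rewrite big1 ?mulr0// => j _.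
  by rewrite /matched /enough (negbTE nen) mul0r.
congr (_ * _); apply: eq_bigr => i _; congr (_ * (_ * _)).
rewrite big_mkcond/=; apply: eq_bigr => j _; rewrite /matched /enough en/=.
by case: ifP => [/andP[/eqP -> _]|_]; rewrite ?mul1r ?mul0r.
Qed.

Lemma matching_bias_few N (W : 'I_N -> bool) (X : 'I_N -> 'rV[R]_d) :
  (N < k)%N -> matching_bias W X g k = 0.
Proof.
move=> Nk; rewrite /matching_bias ifN// -ltnNge; apply: leq_ltn_trans Nk.
apply: leq_trans (geq_minl _ _) _.
by rewrite -[leqRHS]card_ord max_card.
Qed.

Lemma sample_biasE N (t : N.-tuple unit_WX) : (forall i, XX (pos_of t i)) ->
  sample_bias t = bias XX g k t.
Proof.
move=> tX; congr (_ * _); apply: eq_bigr => i _; congr (_ * (_ * _)).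
apply: eq_bigr => j _; congr (_ * _).
by rewrite /increment /diffg /both_in !indicE !mem_set ?mul1r//; exact: tX.
Qed.

Lemma measurable_sample_bias N : (forall w, measurable_fun setT (g w)) ->
  measurable_fun setT (@sample_bias N).
Proof.
move=> mg; apply: measurable_funM => //; apply: measurable_sum => i.
apply: measurable_funM; first exact: measurable_arm_sign.
apply: measurable_funM => //; apply: measurable_sum => j.
apply: measurable_funM; first by apply: measurable_bool_natr; exact: measurable_matched.
by apply: measurable_funB; apply: measurable_by_arm => //;
  first [exact: measurable_arm_of|exact: measurable_pos_of].
Qed.

Lemma measurable_bias N : measurable XX -> (forall w, measurable_fun setT (g w)) ->
  measurable_fun setT (@bias _ _ XX g N k).
Proof.
move=> mXX mg; apply: measurable_funM => //; apply: measurable_sum => i.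
apply: measurable_funM; first exact: measurable_arm_sign.
apply: measurable_funM => //; apply: measurable_sum => j.
apply: measurable_funM; first by apply: measurable_bool_natr; exact: measurable_matched.
by apply: measurable_diffg => //; exact: measurable_tnth.
Qed.

Context disp (Omega : measurableType disp) (P : probability Omega R).
Variable Z : {RV P >-> unit_data R d}.
Hypothesis supp : XX = support_covariate Z.
Hypothesis mXX : measurable XX.
Hypothesis mg : forall w, measurable_fun setT (g w).
Variables (N : nat) (S : 'I_N -> {RV P >-> unit_data R d}).
Hypothesis idS : forall i, identically_distributed (S i) Z.
Hypothesis inS : mutually_independent S.

Let V (i : 'I_N) s := (S i s).1.
Let iid : iid_sample P (unit_law Z) V. Proof. exact: iid_sample_units. Qed.

Lemma sample_in_support :
  {ae P, forall s, forall i, XX (pos_of (sample V s) i)}.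
Proof.
apply: filter_forall => i; exists (V i @^-1` (snd @^-1` (~` XX))).
have mA : measurable ((snd : unit_WX -> 'rV[R]_d) @^-1` (~` XX)).
  by rewrite -[X in measurable X]setTI; apply: measurable_snd => //; exact: measurableC.
have mV : measurable (V i @^-1` (snd @^-1` (~` XX))).
  by rewrite -[X in measurable X]setTI; case: iid => mV _ _; exact: mV.
split=> //; last by move=> s; rewrite /= /pos_of /sample tnth_mktuple.
by case: iid => _ -> // _; exact: (covariate_in_support supp mXX).
Qed.

Lemma expectation_matching_bias :
  ('E_P[fun s => (matching_bias (fun i => treatment (S i s))
                    (fun i => covariate (S i s)) g k ^+ 2)%R] =
   \int[P]_s (bias XX g k (sample V s) ^+ 2)%:E)%E.
Proof.
rewrite unlock.
have E s : matching_bias (fun i => treatment (S i s)) (fun i => covariate (S i s)) g k =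
    sample_bias (sample V s).
  rewrite -matching_bias_sample; congr (matching_bias _ _ g k); apply/funext => i;
  by rewrite /arm_of /pos_of /sample tnth_mktuple.
under eq_integral do rewrite E.
have msmp : measurable_fun setT (sample V) by exact: measurable_sample iid.
apply: ge0_ae_eq_integral => //.
- apply/measurable_EFinP; apply: measurable_funX.
  exact (measurableT_comp (@measurable_sample_bias N mg) msmp).
- apply/measurable_EFinP; apply: measurable_funX.
  exact (measurableT_comp (@measurable_bias N mXX mg) msmp).
- by move=> s _; rewrite lee_fin sqr_ge0.
- by move=> s _; rewrite lee_fin sqr_ge0.
by apply: filterS sample_in_support => s Xs _; rewrite sample_biasE.
Qed.

End matching_estimator.

Theorem theorem4 (R : realType) (d : nat) (XX : set 'rV[R]_d) (eta : R)
    (g f : bool -> 'rV[R]_d -> R) :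
  (0 < d)%N -> 0 < eta ->
  exists2 C : R, 0 < C &
  forall (disp : measure_display) (Omega : measurableType disp)
    (P : probability Omega R) (Z : {RV P >-> unit_data R d}),
  (forall w, is_cond_expectation P (covariate \o Z) (outcome w \o Z) (g w)) ->
  XX = support_covariate Z -> compact XX ->
  ball_volume_regular XX ->
  bounded_density Z XX ->
  unconfounded Z XX ->
  overlap Z XX eta ->
  smooth_regression XX g ->
  (forall w, is_density (law_covariate_given Z w) (f w) /\
             lipschitz_on_set XX (f w)) ->
  (boundary_sup XX f < +oo)%E ->
  forall (N k : nat) (S : 'I_N -> {RV P >-> unit_data R d}),
  (0 < N)%N -> (0 < k)%N ->
  (forall i, identically_distributed (S i) Z) -> mutually_independent S ->
  ('E_P[fun s => (matching_bias (fun i => treatment (S i s))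
                    (fun i => covariate (S i s)) g k ^+ 2)%R]
   <= (C * (k%:R / N%:R) `^ Num.min 3 (4 / d%:R))%R%:E)%E.
Proof.
move=> d0 eta0.
(* The constant is chosen before the population: it comes from design constants if there
   are any, and otherwise no population satisfies the hypotheses. *)
have [[lo [hi [Kg [K2 [Kf [cv [M dc]]]]]]]|nodc] := pselect (exists lo hi Kg K2 Kf cv M : R,
    design_constants XX eta f g lo hi Kg K2 Kf cv M); last first.
  exists 1 => // disp Om P Z reg supp cXX vol dens _ over smooth fdens bd; exfalso; apply: nodc.
  exact: exists_design_constants d0 eta0 reg supp cXX vol dens over smooth fdens bd.
set K := Kmoment d lo hi Kg K2 Kf (eta * lo * cv) (2 * hi * 2 ^+ d) (2 * M).
have K0 : 0 <= K by exact: Kmoment_ge0 (dc_regular dc).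
exists (K + 1) => [|disp Om P Z reg supp cXX vol dens _ over smooth fdens bd N k S N0 k0 idS inS].
  by rewrite ltr_wpDl.
have rd := dc_regular dc; have mXX := rd_closed rd; have mg := rd_mg rd.
have R0 : 0 <= (k%:R / N%:R) `^ Num.min 3 (4 / d%:R) :> R by exact: powR_ge0.
have [kN|Nk] := leqP k N; last first.
  rewrite unlock; under eq_integral do rewrite matching_bias_few// expr0n.
  by rewrite integral0 lee_fin mulr_ge0// addr_ge0.
rewrite (expectation_matching_bias k0 supp mXX mg idS inS).
have sp := sampling_units dc eta0 supp dens over (fun w => proj1 (fdens w)) idS inS.
apply: le_trans (expectation_bias_sq_le rd sp k0 kN) _.
by rewrite lee_fin ler_wpM2r// lerDl.
Qed.
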